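(* Let $M=\mathbb{R}$ or $M=\mathbb{T}$. For each $\epsilon>0$ let $u^{(\epsilon)}$ be the solution of $$i\partial_t u^{(\epsilon)}+\Delta u^{(\epsilon)}-\epsilon^2\Delta^2u^{(\epsilon)}=-\big((I-\epsilon^2\Delta)^{-1}(|u^{(\epsilon)}|^2)\big)u^{(\epsilon)}\ \text{ on } M\times\mathbb{R},\qquad u^{(\epsilon)}(0)=u_0^{(\epsilon)},$$ and let $u$ be the solution of the focusing cubic nonlinear Schrödinger equation $$i\partial_tu+\Delta u=-|u|^2u\ \text{ on } M\times\mathbb{R},\qquad u(0)=u_0 .$$ Suppose that $\{u_0^{(\epsilon)}\}_{\epsilon}$ is bounded in $H^2(M)$ and that $u_0^{(\epsilon)}\to u_0$ in $H^1(M)$ as $\epsilon\to0$. Then for every $T>0$, $u^{(\epsilon)}\to u$ in $C([-T,T];H^1(M))$ as $\epsilon\to0$.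
   Context: $\mathbb{T}$ is the one-dimensional torus, $\Delta=\partial_{xx}$, and $(I-\epsilon^2\Delta)^{-1}$ is the Fourier multiplier with symbol $(1+\epsilon^2\xi^2)^{-1}$. Solutions are the global-in-time solutions in $C(\mathbb{R};H^2(M))$ (for $u^{(\epsilon)}$) and $C(\mathbb{R};H^1(M))$ (for $u$), understood in the Duhamel (mild) sense; both Cauchy problems are globally well-posed in these spaces. *)

(* Defs.v *)
From HB Require Import structures.
From mathcomp Require Export all_boot all_order all_algebra.
From mathcomp Require Export complex.
From mathcomp Require Export all_classical all_reals all_analysis.
Set Implicit Arguments.
Unset Strict Implicit.
Unset Printing Implicit Defensive.
Import Order.TTheory GRing.Theory Num.Theory.
Import numFieldNormedType.Exports.

Local Open Scope classical_set_scope.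
Local Open Scope ring_scope.
Local Open Scope complex_scope.

(* The real line R, or the torus T = R / 2 pi Z.  A function on T is encoded as
   a 2 pi-periodic function on R, and integrated over [-pi, pi[. *)
Inductive domain := Line | Torus.

Fact measurable_integers (R : realType) :
  measurable (range (fun k : int => k%:~R) : set (measurableTypeR R)).
Proof.
by apply: countable_measurable => [t|]; [exact: measurable_set1|exact: (sub_countable (card_image_le _ _))].
Qed.

Section Fourier.
Variables (R : realType) (M : domain).
Implicit Types (f g : R -> R[i]) (m : R -> R[i]) (s : nat).

Definition space_measure : {measure set (measurableTypeR R) -> \bar R} :=
  match M with
  | Line => lebesgue_measure
  | Torus => mrestr lebesgue_measure (measurable_itv `[- pi, pi[)
  end.

(* The frequencies of T are the integers, seen inside R. *)
Definition freq_measure : {measure set (measurableTypeR R) -> \bar R} :=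
  match M with
  | Line => lebesgue_measure
  | Torus => mrestr counting (@measurable_integers R)
  end.

Definition well_defined_on_domain f : Prop :=
  match M with
  | Line => True
  | Torus => periodic f (2 * pi)
  end.

Definition cmeasurable f : Prop :=
  measurable_fun [set: measurableTypeR R] (fun x => complex.Re (f x)) /\
  measurable_fun [set: measurableTypeR R] (fun x => complex.Im (f x)).

Definition norm2 (mu : {measure set (measurableTypeR R) -> \bar R}) f
    : \bar R :=
  ('N[mu]_2%:E[EFin \o (fun x => Normc.normc (f x))])%E.

Definition L2_space f : Prop :=
  [/\ cmeasurable f, well_defined_on_domain f &
      (norm2 space_measure f < +oo)%E].

Definition L2_freq g : Prop :=
  cmeasurable g /\ (norm2 freq_measure g < +oo)%E.

Definition cis (t : R) : R[i] := cos t +i* sin t.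

Definition cintegral (mu : {measure set (measurableTypeR R) -> \bar R})
    (D : set R) f : R[i] :=
  Rintegral mu D (fun x => complex.Re (f x)) +i*
  Rintegral mu D (fun x => complex.Im (f x)).

Definition truncated_fourier (n : nat) f (xi : R) : R[i] :=
  ((Num.sqrt (2 * pi))^-1)%:C *
  cintegral space_measure `[- n%:R, n%:R] (fun x => f x * cis (- (x * xi))).

(* On the line, the Fourier-Plancherel transform of f in L^2 is the limit in
   mean of the truncated Fourier integrals; on the torus the truncation is void
   as soon as n >= 4.  The normalisation makes it unitary in both cases. *)
Definition is_fourier f g : Prop :=
  L2_freq g /\
  norm2 freq_measure (fun xi => truncated_fourier n f xi - g xi)
    @[n --> \oo] --> 0%E.

Definition fourier f : R -> R[i] := xget (fun=> 0) [set g | is_fourier f g].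

(* The operator m(D) with symbol m, i.e. the f' in L^2 whose Fourier transform
   is m times that of f; like [fourier], it is defined up to a.e. equality. *)
Definition multiplier m f : R -> R[i] :=
  xget (fun=> 0) [set g | L2_space g /\
    {ae freq_measure, forall xi, fourier g xi = m xi * fourier f xi}].

(* Equal to +oo outside L^2, hence finite exactly on H^s. *)
Definition sobolev_norm s f : \bar R :=
  if `[< L2_space f >] then
    norm2 freq_measure
      (fun xi => (Num.sqrt (1 + xi ^+ 2) ^+ s)%:C * fourier f xi)
  else +oo%E.

Definition sobolev s f : Prop := (sobolev_norm s f < +oo)%E.

Definition sobolev_dist s f g : \bar R := sobolev_norm s (fun x => f x - g x).

Definition sobolev_continuous s (u : R -> R -> R[i]) : Prop :=
  (forall t, sobolev s (u t)) /\
  (forall t0, sobolev_dist s (u t) (u t0) @[t --> t0] --> 0%E).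

(* The points x 0 = a, ..., x n = b go monotonically from a to b, with a tag
   tau k between x k and x k.+1; b < a is allowed. *)
Definition tagged_partition (a b : R) (n : nat) (x tau : nat -> R) : Prop :=
  [/\ x 0%N = a, x n = b &
      forall k, (k < n)%N ->
        if a <= b then x k <= tau k <= x k.+1 else x k.+1 <= tau k <= x k].

(* The H^s-valued Riemann integral of G from a to b is I. *)
Definition is_sobolev_integral s (G : R -> R -> R[i]) (a b : R)
    (I : R -> R[i]) : Prop :=
  forall eps : R, 0 < eps -> exists2 delta : R, 0 < delta &
    forall (n : nat) (x tau : nat -> R),
      tagged_partition a b n x tau ->
      (forall k, (k < n)%N -> `|x k.+1 - x k| < delta) ->
      (sobolev_dist s
         (fun y => (\sum_(k < n) (x k.+1 - x k)%:C * G (tau k) y)%R) I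
       < eps%:E)%E.

Definition symbol_laplacian (xi : R) : R := - xi ^+ 2.

(* exp(i t L), where L has the real symbol l *)
Definition propagator (l : R -> R) (t : R) : (R -> R[i]) -> R -> R[i] :=
  multiplier (fun xi => cis (t * l xi)).

(* u is a global solution in C(R; H^s) of  i u_t + L u = - N(u),  u(0) = u0:
     u(t) = exp(i t L) u0 + i \int_0^t exp(i (t - tau) L) N(u(tau)) dtau *)
Definition mild_solution s (l : R -> R) (N : (R -> R[i]) -> R -> R[i])
    (u0 : R -> R[i]) (u : R -> R -> R[i]) : Prop :=
  sobolev_continuous s u /\
  forall t, is_sobolev_integral s
    (fun tau y => 'i%C * propagator l (t - tau) (N (u tau)) y) 0 t
    (fun y => u t y - propagator l t u0 y).

Definition sq_modulus f (x : R) : R[i] := (Normc.normc (f x) ^+ 2)%:C.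

Definition cubic_nonlinearity f (x : R) : R[i] := sq_modulus f x * f x.

(* (I - eps^2 Delta)^-1 *)
Definition resolvent (eps : R) : (R -> R[i]) -> R -> R[i] :=
  multiplier (fun xi => ((1 - eps ^+ 2 * symbol_laplacian xi)^-1)%:C).

Definition nonlocal_nonlinearity (eps : R) f (x : R) : R[i] :=
  resolvent eps (sq_modulus f) x * f x.

Definition NLS_solution (u0 : R -> R[i]) (u : R -> R -> R[i]) : Prop :=
  mild_solution 1 symbol_laplacian cubic_nonlinearity u0 u.

Definition fourth_order_solution (eps : R) (u0 : R -> R[i])
    (u : R -> R -> R[i]) : Prop :=
  mild_solution 2
    (fun xi => symbol_laplacian xi - eps ^+ 2 * symbol_laplacian xi ^+ 2)
    (nonlocal_nonlinearity eps) u0 u.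

(* the distance of C([-T, T]; H^s) *)
Definition sup_sobolev_dist s (T : R) (u v : R -> R -> R[i]) : \bar R :=
  ereal_sup [set sobolev_dist s (u t) (v t) | t in `[- T, T]].

End Fourier.

(* Main.v *)
Require Import Defs.
From HB Require Import structures.
From mathcomp Require Import ring lra measurable_realfun.

(** Write d for the H^1 distance between the two solutions at a given time.
    Duhamel's formula expresses each solution as its free evolution plus a time
    integral of the free evolution of its nonlinearity.  The two equations only
    differ through bounded Fourier multipliers: the symbols of the free groups
    differ by at most min (2, T eps^2 xi^4) for times up to T, and the symbol of
    the resolvent differs from 1 by at most eps^2 xi^2.  Both are at most
    q = min (2, (T + 1) eps^2 (1 + xi^2)^2) ([symbol_gap]), which tends to 0 at
    each frequency.  By dominated convergence q(D) g is small in H^1 for a fixed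
    g in H^1 ([tail_cvg0]), and by compactness it is so uniformly for g along a
    continuous curve ([tail_cvg0_uniform]).  This is applied to the curves |u|^2
    and |u|^2 u.  Since H^1 is an algebra ([Hs1M]) on which the resolvent and the
    free groups are contractions, as long as d <= 1 the difference of the
    nonlinearities is at most L d plus such small terms, where L depends only
    on the bound of u in H^1 ([nonlinearity_compare]).  Hence
    d(t) <= delta + L |int_0^t d|, with delta -> 0; Gronwall's inequality gives
    d <= 2 delta exp (2 L T), which is less than 1 when eps is small, and the
    restriction d <= 1 is removed by continuity ([gronwall]).

    The H^s-valued integrals being limits of tagged Riemann sums, the argument
    is run on the sums: along a uniform partition tagged at the end of each
    step which is nearer to 0, the sum of the exponentials exp (2 L r) is below
    its integral, which is all that Gronwall's inequality needs.

    The Fourier analysis rests on the Plancherel theorem for the transform which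
    is the limit in L^2 of truncated integrals.  On the line, the transform is a
    contraction of L^2: inserting the Abel weight exp (- delta |xi|) in the
    square of the norm produces a Poisson kernel, of mass 2 pi, to which Schur's
    test applies ([line_contracts]).  Pairing with indicators of intervals, the
    primitive of the Poisson kernel being explicit, gives the inversion formula
    ([line_inversion]).  On the torus, the inverse transform is isometric by
    orthogonality of the exponentials ([torus_isometry]), and the transform is a
    contraction by duality; a function with vanishing coefficients is zero
    ([torus_injective]) because, seen on the line, its transform would be small
    near all the integers, against the isometry on the line.  In both cases the
    transform and its inverse are then inverse contractions, hence isometries
    ([norm2_fourier], [norm2_inverse]).

    The algebra property of H^1 follows from the characterization of H^1 by
    increments ([nrm_increment_le], [Hs1_of_increments]), for which the product
    rule is elementary, and from the boundedness of H^1 functions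
    ([Hs1_bounded]), a consequence of the square integrability of
    (1 + xi^2)^(-1/2). *)

Import Order.TTheory GRing.Theory Num.Theory.
Import numFieldNormedType.Exports.
Set Implicit Arguments.
Unset Strict Implicit.
Unset Printing Implicit Defensive.
Local Open Scope classical_set_scope.
Local Open Scope ring_scope.
Local Open Scope complex_scope.

Local Notation normc := Normc.normc.
Local Notation Re := complex.Re.
Local Notation Im := complex.Im.

(** * Complex numbers *)

Section ComplexModulus.
Context {R : realType}.
Implicit Types (x y z : R[i]) (a b : R).

Lemma Re_D x y : Re (x + y) = Re x + Re y. Proof. by case: x y => ? ? []. Qed.
Lemma Im_D x y : Im (x + y) = Im x + Im y. Proof. by case: x y => ? ? []. Qed.
Lemma Re_N x : Re (- x) = - Re x. Proof. by case: x. Qed.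
Lemma Im_N x : Im (- x) = - Im x. Proof. by case: x. Qed.
Lemma Re_B x y : Re (x - y) = Re x - Re y. Proof. by rewrite Re_D Re_N. Qed.
Lemma Im_B x y : Im (x - y) = Im x - Im y. Proof. by rewrite Im_D Im_N. Qed.
Lemma Re_M x y : Re (x * y) = Re x * Re y - Im x * Im y.
Proof. by case: x y => ? ? []. Qed.
Lemma Im_M x y : Im (x * y) = Re x * Im y + Im x * Re y.
Proof. by case: x y => ? ? []. Qed.
Lemma Re_J x : Re (x^*) = Re x. Proof. by case: x. Qed.
Lemma Im_J x : Im (x^*) = - Im x. Proof. by case: x. Qed.
Lemma Re_C a : Re a%:C = a. Proof. by []. Qed.
Lemma Im_C a : Im a%:C = 0. Proof. by []. Qed.
Definition ReImE := (Re_D, Im_D, Re_N, Im_N, Re_M, Im_M, Re_J, Im_J, Re_C, Im_C).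

Lemma complex_eqP x y : Re x = Re y -> Im x = Im y -> x = y.
Proof. by case: x y => ? ? [? ?] /= -> ->. Qed.

Lemma normc_ge0 z : 0 <= normc z. Proof. by case: z => ? ?; exact: sqrtr_ge0. Qed.

Lemma sqr_normc z : normc z ^+ 2 = Re z ^+ 2 + Im z ^+ 2.
Proof. by case: z => a b /=; rewrite sqr_sqrtr// addr_ge0// sqr_ge0. Qed.

Lemma normc_sqrt z : normc z = Num.sqrt (Re z ^+ 2 + Im z ^+ 2).
Proof. by case: z. Qed.

Lemma normcD x y : normc (x + y) <= normc x + normc y.
Proof. exact: le_normcD. Qed.

Lemma normc_N z : normc (- z) = normc z. Proof. exact: normcN. Qed.

Lemma normcB x y : normc (x - y) <= normc x + normc y.
Proof. by rewrite -(normc_N y) normcD. Qed.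

Lemma normcBC x y : normc (x - y) = normc (y - x).
Proof. by rewrite -normc_N opprB. Qed.

Lemma normc_M x y : normc (x * y) = normc x * normc y.
Proof. exact: Normc.normcM. Qed.

Lemma normc_C a : normc a%:C = `|a|.
Proof. by rewrite /= expr0n/= addr0 sqrtr_sqr. Qed.

Lemma normc_J z : normc (z^*) = normc z.
Proof. by rewrite !normc_sqrt !ReImE sqrrN. Qed.

Lemma normc_i : normc ('i%C : R[i]) = 1.
Proof. by rewrite normc_sqrt/= expr0n expr1n add0r sqrtr1. Qed.

Lemma normc_cis t : normc (cis t : R[i]) = 1.
Proof. by rewrite normc_sqrt/= cos2Dsin2 sqrtr1. Qed.

Lemma ler_Re z : `|Re z| <= normc z.
Proof. by rewrite normc_sqrt -sqrtr_sqr ler_wsqrtr// lerDl sqr_ge0. Qed.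

Lemma ler_Im z : `|Im z| <= normc z.
Proof. by rewrite normc_sqrt -sqrtr_sqr ler_wsqrtr// lerDr sqr_ge0. Qed.

Lemma normc_le_ReIm z : normc z <= `|Re z| + `|Im z|.
Proof.
rewrite -(ler_pXn2r (ltn0Sn 1)) ?nnegrE ?addr_ge0 ?normc_ge0//.
rewrite sqr_normc sqrrD !real_normK ?num_real//.
by rewrite addrAC lerDl mulrn_wge0// mulr_ge0.
Qed.

Lemma normc_eq0 z : normc z = 0 -> z = 0. Proof. exact: Normc.eq0_normc. Qed.

Lemma cisD s t : cis (s + t) = cis s * cis t :> R[i].
Proof. by apply: complex_eqP; rewrite ?ReImE/= ?cosD ?sinD; ring. Qed.

Lemma cisN t : cis (- t) = (cis t)^* :> R[i].
Proof. by apply: complex_eqP; rewrite ?ReImE/= ?cosN ?sinN. Qed.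

Lemma normc_cisB1 t : normc (cis t - 1 : R[i]) ^+ 2 = 2 - 2 * cos t.
Proof.
by rewrite sqr_normc !ReImE /= oppr0 addr0; have := cos2Dsin2 t; lra.
Qed.

Lemma Re_mulJ z : Re (z * z^*) = normc z ^+ 2.
Proof. by rewrite sqr_normc !ReImE; ring. Qed.

Lemma Re_mulJ_le x y : `|Re (x * y^*)| <= normc x * normc y.
Proof. by rewrite (le_trans (ler_Re _))// normc_M normc_J. Qed.

Lemma Re_mulJC x y : Re (x * y^*) = Re (y * x^*).
Proof. by rewrite !ReImE; ring. Qed.

End ComplexModulus.

Section ComplexMeasurability.
Context {R : realType}.
Implicit Types f g : R -> R[i].

Lemma cmeasurable_cst (c : R[i]) : cmeasurable (fun=> c).
Proof. by split; exact: measurable_cst. Qed.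

Lemma cmeasurableD f g : cmeasurable f -> cmeasurable g ->
  cmeasurable (fun x => f x + g x).
Proof.
move=> [rf jf] [rg jg]; split.
  by under eq_fun do rewrite Re_D; exact: measurable_funD.
by under eq_fun do rewrite Im_D; exact: measurable_funD.
Qed.

Lemma cmeasurableN f : cmeasurable f -> cmeasurable (fun x => - f x).
Proof.
move=> [rf jf]; split.
  by under eq_fun do rewrite Re_N; exact: measurableT_comp.
by under eq_fun do rewrite Im_N; exact: measurableT_comp.
Qed.

Lemma cmeasurableB f g : cmeasurable f -> cmeasurable g ->
  cmeasurable (fun x => f x - g x).
Proof. by move=> mf mg; apply: cmeasurableD => //; exact: cmeasurableN. Qed.

Lemma cmeasurableM f g : cmeasurable f -> cmeasurable g ->
  cmeasurable (fun x => f x * g x).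
Proof.
move=> [rf jf] [rg jg]; split.
  under eq_fun do rewrite Re_M.
  by apply: measurable_funB; exact: measurable_funM.
under eq_fun do rewrite Im_M.
by apply: measurable_funD; exact: measurable_funM.
Qed.

Lemma cmeasurableJ f : cmeasurable f -> cmeasurable (fun x => (f x)^*).
Proof.
move=> [rf jf]; split; first by under eq_fun do rewrite Re_J.
by under eq_fun do rewrite Im_J; exact: measurableT_comp.
Qed.

Lemma cmeasurableC (f : R -> R) :
  measurable_fun [set: measurableTypeR R] (f : measurableTypeR R -> R) ->
  cmeasurable (fun x => (f x)%:C).
Proof. by move=> mf; split => //; exact: measurable_cst. Qed.

Lemma measurable_normc f : cmeasurable f ->
  measurable_fun [set: measurableTypeR R]
    (fun x : measurableTypeR R => normc (f x)).
Proof.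
move=> [rf jf]; under eq_fun do rewrite normc_sqrt.
apply: (measurableT_comp (f := @Num.sqrt R)).
  by apply: continuous_measurable_fun; exact: sqrt_continuous.
by apply: measurable_funD; exact: measurable_funX.
Qed.

Lemma measurable_sqr_normc f : cmeasurable f ->
  measurable_fun [set: measurableTypeR R]
    (fun x : measurableTypeR R => (normc (f x) ^+ 2)%:E).
Proof.
move=> mf; apply/measurable_EFinP; apply: measurable_funX.
exact: measurable_normc.
Qed.

Lemma cmeasurable_cis (f : R -> R) :
  measurable_fun [set: measurableTypeR R] (f : measurableTypeR R -> R) ->
  cmeasurable (fun x => cis (f x)).
Proof.
move=> mf; split => /=.
  apply: (measurableT_comp (f := @cos R)) => //.
  by apply: continuous_measurable_fun; exact: continuous_cos.
apply: (measurableT_comp (f := @sin R)) => //.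
by apply: continuous_measurable_fun; exact: continuous_sin.
Qed.

Lemma cmeasurable_indic (D : set (measurableTypeR R)) f : measurable D ->
  cmeasurable f -> cmeasurable (fun x => (\1_D x)%:C * f x).
Proof.
move=> mD mf; apply: cmeasurableM => //; apply: cmeasurableC.
exact: measurable_indic.
Qed.

End ComplexMeasurability.

(** * Square integrable functions *)

Section AlmostEverywhere.
Context {R : realType}.
Variable mu : {measure set (measurableTypeR R) -> \bar R}.
Implicit Types P Q S : R -> Prop.

Lemma ae_imp P Q : (forall x, P x -> Q x) ->
  {ae mu, forall x, P x} -> {ae mu, forall x, Q x}.
Proof.
move=> PQ; exact: (@filterS _ _ (ae_filter_ringOfSetsType mu) _ _ PQ).
Qed.

Lemma ae_imp2 P Q S : (forall x, P x -> Q x -> S x) ->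
  {ae mu, forall x, P x} -> {ae mu, forall x, Q x} -> {ae mu, forall x, S x}.
Proof.
move=> PQ; exact: (@filterS2 _ _ (ae_filter_ringOfSetsType mu) _ _ _ PQ).
Qed.

End AlmostEverywhere.

Section NormL2.
Context {R : realType}.
Variable mu : {measure set (measurableTypeR R) -> \bar R}.
Implicit Types f g h : R -> R[i].

Definition energy f : \bar R := (\int[mu]_x (normc (f x) ^+ 2)%:E)%E.

Lemma energy_ge0 f : (0 <= energy f)%E.
Proof. by apply: integral_ge0 => x _; rewrite lee_fin sqr_ge0. Qed.

Lemma norm2E f : norm2 mu f = sqrte (energy f).
Proof.
rewrite /norm2 unlock -poweR12_sqrt ?energy_ge0//; congr (_ `^ _)%E.
apply: eq_integral => x _.
by rewrite [(`| _ |)%E]/= ger0_norm ?normc_ge0// poweR_EFin -powR_mulrn// normc_ge0.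
Qed.

Lemma norm2_ge0 f : (0 <= norm2 mu f)%E.
Proof. exact: Lnorm_ge0. Qed.

Lemma energyE f : energy f = (norm2 mu f * norm2 mu f)%E.
Proof. by rewrite norm2E -expe2 sqr_sqrte// energy_ge0. Qed.

Lemma le_norm2_energy f g : (energy f <= energy g)%E ->
  (norm2 mu f <= norm2 mu g)%E.
Proof. by move=> fg; rewrite !norm2E lee_sqrt// energy_ge0. Qed.

Lemma le_norm2 f g : cmeasurable f -> cmeasurable g ->
  {ae mu, forall x, normc (f x) <= normc (g x)} ->
  (norm2 mu f <= norm2 mu g)%E.
Proof.
move=> mf mg fg; apply: le_norm2_energy; apply: ae_ge0_le_integral => //.
- by move=> x _; rewrite lee_fin sqr_ge0.
- exact: measurable_sqr_normc.
- by move=> x _; rewrite lee_fin sqr_ge0.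
- exact: measurable_sqr_normc.
- apply: ae_imp fg => x fg _.
  by rewrite lee_fin lerXn2r// nnegrE normc_ge0.
Qed.

Lemma eq_norm2 f g : cmeasurable f -> cmeasurable g ->
  {ae mu, forall x, f x = g x} -> norm2 mu f = norm2 mu g.
Proof.
move=> mf mg fg; apply/eqP; rewrite eq_le !le_norm2//;
  by apply: ae_imp fg => x ->.
Qed.

Lemma norm2_0 : norm2 mu (fun=> 0) = 0.
Proof.
rewrite norm2E /energy.
under eq_integral do rewrite Normc.normc0 expr0n.
by rewrite integral0 sqrte0.
Qed.

Lemma norm2D f g : cmeasurable f -> cmeasurable g ->
  (norm2 mu (fun x => f x + g x)%R <= norm2 mu f + norm2 mu g)%E.
Proof.
move=> mf mg; pose a (x : measurableTypeR R) := normc (f x).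
pose b (x : measurableTypeR R) := normc (g x).
have ma := measurable_normc mf; have mb := measurable_normc mg.
have := @minkowski_EFin _ _ _ mu a b 2 ma mb; rewrite ler1n => /(_ isT).
apply: le_trans.
rewrite -[leRHS](_ : norm2 mu (fun x => (a x + b x)%:C)%R = _); last first.
  rewrite /norm2; congr Lnorm; apply/funext => x /=.
  by rewrite expr0n/= addr0 sqrtr_sqr ger0_norm// addr_ge0// normc_ge0.
apply: le_norm2.
- exact: cmeasurableD.
- by apply: cmeasurableC; exact: measurable_funD.
- apply: aeW => x; rewrite normc_C ger0_norm ?normcD//.
  by rewrite addr_ge0// normc_ge0.
Qed.

Lemma norm2Z (c : R[i]) f : cmeasurable f ->
  norm2 mu (fun x => c * f x)%R = ((normc c)%:E * norm2 mu f)%E.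
Proof.
move=> mf; rewrite !norm2E /energy.
under eq_integral do rewrite normc_M exprMn EFinM.
rewrite ge0_integralZl//.
- rewrite sqrteM ?lee_fin ?sqr_ge0//; congr (_ * _)%E.
  by rewrite /= sqrtr_sqr ger0_norm// normc_ge0.
- exact: measurable_sqr_normc.
- by move=> x _; rewrite lee_fin sqr_ge0.
- by rewrite lee_fin sqr_ge0.
Qed.

Lemma eq_norm2_normc f g : (forall x, normc (f x) = normc (g x)) ->
  norm2 mu f = norm2 mu g.
Proof. by move=> fg; rewrite /norm2; congr Lnorm; apply/funext => x /=; rewrite fg. Qed.

Lemma norm2N f : norm2 mu (fun x => - f x)%R = norm2 mu f.
Proof. by apply: eq_norm2_normc => x; rewrite normc_N. Qed.

Lemma norm2BC f g : norm2 mu (fun x => f x - g x)%R = norm2 mu (fun x => g x - f x)%R.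
Proof. by apply: eq_norm2_normc => x; rewrite normcBC. Qed.

Lemma norm2B f g : cmeasurable f -> cmeasurable g ->
  (norm2 mu (fun x => f x - g x)%R <= norm2 mu f + norm2 mu g)%E.
Proof.
move=> mf mg; rewrite -(norm2N g); apply: norm2D => //; exact: cmeasurableN.
Qed.

Lemma norm2_dist_trans f g h : cmeasurable f -> cmeasurable g -> cmeasurable h ->
  (norm2 mu (fun x => f x - h x)%R <=
   norm2 mu (fun x => f x - g x)%R + norm2 mu (fun x => g x - h x)%R)%E.
Proof.
move=> mf mg mh; rewrite -[leLHS](_ : norm2 mu (fun x => (f x - g x) + (g x - h x))%R = _).
  by apply: norm2D; exact: cmeasurableB.
by apply: eq_norm2_normc => x; congr normc; ring.
Qed.

Lemma norm2_eq0 f : cmeasurable f -> norm2 mu f = 0 -> {ae mu, forall x, f x = 0}.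
Proof.
move=> mf f0; have mEf : measurable_fun [set: measurableTypeR R]
    (EFin \o (fun x => normc (f x))).
  by apply/measurable_EFinP; exact: measurable_normc.
have h : (0 < 2%:E :> \bar R)%E by rewrite lte_fin.
move: {h} (Lnorm_eq0_eq0 mEf h f0) => h; apply: ae_imp h => x /= /(_ I) [h]; exact: normc_eq0.
Qed.

Definition L2 f := cmeasurable f /\ (norm2 mu f < +oo)%E.

Lemma L2_0 : L2 (fun=> 0).
Proof. by split; [exact: cmeasurable_cst|rewrite norm2_0]. Qed.

Lemma L2D f g : L2 f -> L2 g -> L2 (fun x => f x + g x).
Proof.
move=> [mf f2] [mg g2]; split; first exact: cmeasurableD.
by rewrite (le_lt_trans (norm2D mf mg))// lte_add_pinfty.
Qed.

Lemma L2N f : L2 f -> L2 (fun x => - f x).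
Proof. by move=> [mf f2]; split; [exact: cmeasurableN|rewrite norm2N]. Qed.

Lemma L2B f g : L2 f -> L2 g -> L2 (fun x => f x - g x).
Proof. by move=> f2 /L2N; exact: L2D. Qed.

Lemma norm2_bounded (C : R) f g : 0 <= C -> cmeasurable f -> cmeasurable g ->
  {ae mu, forall x, normc (f x) <= C} ->
  (norm2 mu (fun x => f x * g x)%R <= C%:E * norm2 mu g)%E.
Proof.
move=> C0 mf mg fC.
rewrite -[X in (X%:E * _)%E](ger0_norm C0) -normc_C -norm2Z//.
apply: le_norm2; [exact: cmeasurableM|apply: cmeasurableM => //; exact: cmeasurable_cst|].
by apply: ae_imp fC => x fC; rewrite !normc_M ler_wpM2r ?normc_ge0// normc_C ger0_norm.
Qed.

Lemma L2_bounded (C : R) f g : 0 <= C -> cmeasurable f ->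
  {ae mu, forall x, normc (f x) <= C} -> L2 g -> L2 (fun x => f x * g x).
Proof.
move=> C0 mf fC [mg g2]; split; first exact: cmeasurableM.
by rewrite (le_lt_trans (norm2_bounded C0 mf mg fC))// lte_mul_pinfty// lee_fin.
Qed.

Lemma L2_normc_le f g : cmeasurable f ->
  {ae mu, forall x, normc (f x) <= normc (g x)} -> L2 g -> L2 f.
Proof.
move=> mf fg [mg g2]; split => //.
by rewrite (le_lt_trans _ g2)// le_norm2.
Qed.

Definition nrm f : R := fine (norm2 mu f).

Lemma nrm_ge0 f : 0 <= nrm f.
Proof. by rewrite fine_ge0// norm2_ge0. Qed.

Lemma nrmE f : L2 f -> norm2 mu f = (nrm f)%:E.
Proof. by move=> [_ f2]; rewrite fineK// ge0_fin_numE// norm2_ge0. Qed.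

Lemma sqr_nrm f : L2 f -> energy f = (nrm f ^+ 2)%:E.
Proof. by move=> f2; rewrite energyE nrmE. Qed.

Lemma nrmD f g : L2 f -> L2 g -> nrm (fun x => f x + g x) <= nrm f + nrm g.
Proof.
move=> f2 g2; rewrite -lee_fin EFinD -!nrmE//; last exact: L2D.
by case: f2 g2 => [? ?] [? ?]; exact: norm2D.
Qed.

(** The real part of the inner product is enough for duality and polarization,
    and it spares complex-valued integrals. *)
Definition ip f g : R := \int[mu]_x Re (f x * (g x)^*).

Lemma measurable_ReJ f g : cmeasurable f -> cmeasurable g ->
  measurable_fun [set: measurableTypeR R]
    (fun x : measurableTypeR R => Re (f x * (g x)^*)).
Proof. by move=> mf mg; have [] := cmeasurableM mf (cmeasurableJ mg). Qed.

Lemma ip_integrable f g : L2 f -> L2 g ->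
  mu.-integrable setT (fun x => (Re (f x * (g x)^*))%:E).
Proof.
move=> f2 g2; have [mf _] := f2; have [mg _] := g2.
apply: (@le_integrable _ _ _ mu _ _ _ (fun x => (normc (f x) ^+ 2)%:E + (normc (g x) ^+ 2)%:E)%E) => //.
- by apply/measurable_EFinP; exact: measurable_ReJ.
- move=> x _; rewrite -EFinD lee_fin.
  rewrite (le_trans (Re_mulJ_le _ _))// ger0_norm ?addr_ge0 ?sqr_ge0//.
  have := sqr_ge0 (normc (f x) - normc (g x)); have := sqr_ge0 (normc (f x) + normc (g x)); nra.
- apply: integrableD => //.
    apply/integrableP; split; first exact: measurable_sqr_normc.
    rewrite -[X in (X < _)%E](_ : energy f = _); first by rewrite sqr_nrm ?ltry.
    by apply: eq_integral => x _; rewrite gee0_abs// lee_fin sqr_ge0.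
  apply/integrableP; split; first exact: measurable_sqr_normc.
  rewrite -[X in (X < _)%E](_ : energy g = _); first by rewrite sqr_nrm ?ltry.
  by apply: eq_integral => x _; rewrite gee0_abs// lee_fin sqr_ge0.
Qed.

Lemma ipC f g : ip f g = ip g f.
Proof. by rewrite /ip; under eq_Rintegral do rewrite Re_mulJC. Qed.

Lemma ipBl f g h : L2 f -> L2 g -> L2 h ->
  ip (fun x => f x - g x) h = ip f h - ip g h.
Proof.
move=> f2 g2 h2; rewrite /ip -RintegralB//; [|exact: ip_integrable..].
by apply: eq_Rintegral => x _; rewrite mulrBl Re_B.
Qed.

Lemma ipBr f g h : L2 f -> L2 g -> L2 h ->
  ip h (fun x => f x - g x) = ip h f - ip h g.
Proof. by move=> f2 g2 h2; rewrite ![ip h _]ipC ipBl. Qed.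

Lemma ipff f : L2 f -> ip f f = nrm f ^+ 2.
Proof.
move=> f2; rewrite -[RHS]/(fine (nrm f ^+ 2)%:E) -sqr_nrm//; congr fine.
by apply: eq_integral => x _; rewrite Re_mulJ.
Qed.

Lemma ip_CauchySchwarz f g : L2 f -> L2 g -> `|ip f g| <= nrm f * nrm g.
Proof.
move=> f2 g2; have [mf f2'] := f2; have [mg g2'] := g2.
rewrite (le_trans (le_normr_Rintegral _ (ip_integrable f2 g2)))//.
pose a (x : measurableTypeR R) := normc (f x).
pose b (x : measurableTypeR R) := normc (g x).
have ma := measurable_normc mf; have mb := measurable_normc mg.
have p2 : (2^-1 + 2^-1 = 1 :> R) by lra.
have t2 : 0 < 2 :> R by [].
have := @hoelder _ _ _ mu a b 2 2 ma mb t2 t2 p2.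
rewrite -![Lnorm mu 2%:E (EFin \o _)]/(norm2 mu _) !nrmE// -EFinM => H.
rewrite -lee_fin fineK; last first.
  rewrite ge0_fin_numE; last by apply: integral_ge0 => x _; rewrite lee_fin.
  by have /integrableP[] := ip_integrable f2 g2.
apply: le_trans H; rewrite Lnorm1.
apply: ge0_le_integral => //.
- by apply/measurable_EFinP; apply: measurableT_comp => //; exact: measurable_ReJ.
- apply: measurableT_comp => //; apply/measurable_EFinP; exact: measurable_funM.
- by move=> x _ /=; rewrite lee_fin (le_trans (Re_mulJ_le _ _))// ler_norm.
Qed.

End NormL2.

(** * Completeness of L^2 *)

Lemma cvge0P {R : realType} {T : Type} (F : set_system T) {FF : Filter F}
    (u : T -> \bar R) : (forall t, (0 <= u t)%E) ->
  (u @ F --> 0%E <-> forall e : R, 0 < e -> \forall t \near F, (u t < e%:E)%E).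
Proof.
move=> u0; split => [+ e e0|ue].
  move=> /fine_cvgP[ufin /cvgrPdist_lt /(_ e e0) ue].
  near=> t; rewrite -[u t]fineK; last by near: t.
  rewrite lte_fin (le_lt_trans (ler_norm _))//.
  by near: t; apply: filterS ue => t; rewrite /= sub0r normrN.
apply/fine_cvgP; split.
  apply: filterS (ue _ ltr01) => t ut; rewrite ge0_fin_numE//.
  exact: (lt_trans ut (ltry _)).
apply/cvgrPdist_lt => e e0; apply: filterS (ue e e0) => t ut.
rewrite /= sub0r normrN ger0_norm ?fine_ge0// -lte_fin fineK//.
by rewrite ge0_fin_numE// (lt_trans ut (ltry _)).
Unshelve. all: by end_near. Qed.

Section Completeness.
Context {R : realType}.
Variable mu : {measure set (measurableTypeR R) -> \bar R}.
Implicit Types (f g : R -> R[i]) (s : nat -> R -> R[i]).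

(** Fatou's lemma, for the squared moduli. *)
Lemma fatou_norm2 s g (C : R) : (forall n, cmeasurable (s n)) -> cmeasurable g ->
  {ae mu, forall x, normc (s n x - g x) @[n --> \oo] --> (0 : R)} -> 0 <= C ->
  (\forall n \near \oo, (norm2 mu (s n) <= C%:E)%E) -> (norm2 mu g <= C%:E)%E.
Proof.
move=> ms mg sg C0 sC.
pose u n (x : measurableTypeR R) := (normc (s n x) ^+ 2)%:E.
have mu_ n : measurable_fun setT (u n) by exact: measurable_sqr_normc.
have ug : {ae mu, forall x, limn_einf (u^~ x) = (normc (g x) ^+ 2)%:E}.
  apply: ae_imp sg => x sg.
  suff H : u n x @[n --> \oo] --> (normc (g x) ^+ 2)%:E.
    by rewrite is_cvg_limn_einfE; [exact/cvg_lim|apply/cvg_ex; eexists; exact: H].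
  apply: cvg_EFin; first exact: nearW.
  apply: (@cvg_comp _ _ _ (fun n => normc (s n x)) (fun r : R => r ^+ 2)); last first.
    exact: exprn_continuous.
  apply/cvgrPdist_le => e e0; move/cvgrPdist_le : sg => /(_ e e0).
  apply: filterS => n /=; rewrite sub0r normrN ger0_norm ?normc_ge0//.
  apply: le_trans; rewrite ler_norml.
  have := normcD (s n x - g x) (g x); have := normcB (s n x) (s n x - g x).
  by rewrite subrK subKr; lra.
have m_einf : measurable_fun [set: measurableTypeR R] (fun x => limn_einf (u^~ x)).
  rewrite (_ : (fun x => _) = (fun x => - limn_esup (fun n => - u n x))%E).
    apply: measurableT_comp => //; apply: measurable_fun_limn_esup => n.
    exact: measurableT_comp.
  by apply/funext => x; rewrite -[RHS]/(- limn_esup (-%E \o u^~ x))%E limn_esupN oppeK.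
have : (energy mu g <= (C ^+ 2)%:E)%E.
  have -> : energy mu g = (\int[mu]_x limn_einf (u^~ x))%E.
    apply: ae_eq_integral => //; first exact: measurable_sqr_normc.
    by apply: ae_imp ug => x -> _.
  apply: (@le_trans _ _ (limn_einf (fun n => energy mu (s n)))).
    by apply: fatou => // n x _; rewrite lee_fin sqr_ge0.
  rewrite limn_einf_lim; apply: lime_le; first exact: is_cvg_einfs.
  near=> n.
  apply: (@le_trans _ _ (energy mu (s n))).
    by apply: ereal_inf_lbound; exists n => /=.
  rewrite energyE expr2 EFinM; apply: lee_pmul; rewrite ?norm2_ge0//; near: n; exact: sC.
rewrite norm2E => H; rewrite -(ger0_norm C0) -sqrtr_sqr.
by rewrite -[X in (_ <= X)%E]/(sqrte (C ^+ 2)%:E) lee_sqrt// lee_fin sqr_ge0.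
Unshelve. all: by end_near. Qed.

(** The sum of the 4^n |a_{n+1} - a_n|^2 has a finite integral, so it is finite
    almost everywhere, where the steps are then O(2^-n). *)
Lemma ae_cvg_fast_steps (a : nat -> R -> R) :
  (forall n, measurable_fun [set: measurableTypeR R] (a n : measurableTypeR R -> R)) ->
  (forall n, (\int[mu]_x ((a n.+1 x - a n x) ^+ 2)%:E <= (8 ^- n)%:E)%E) ->
  {ae mu, forall x, cvgn (fun n => a n x)}.
Proof.
move=> ma da.
pose d n (x : measurableTypeR R) := (4 ^+ n * (a n.+1 x - a n x) ^+ 2)%:E.
have md n : measurable_fun setT (d n).
  apply/measurable_EFinP; apply: measurable_funM => //.
  by apply: measurable_funX; exact: measurable_funB.
have d0 n x : (0 <= d n x)%E.
  by rewrite lee_fin; apply: mulr_ge0; [exact: exprn_ge0|exact: sqr_ge0].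
have sum_fin : (\int[mu]_x (\sum_(n <oo) d n x) < +oo)%E.
  rewrite integral_nneseries//.
  apply: (@le_lt_trans _ _ (\sum_(n <oo) (geometric 1 2^-1 n)%:E)%E).
    apply: lee_nneseries => [n _ _|n _]; first exact: integral_ge0.
    rewrite /d; under eq_integral do rewrite EFinM.
    rewrite ge0_integralZl//; last 2 first.
      by apply/measurable_EFinP; apply: measurable_funX; exact: measurable_funB.
      by move=> x _; rewrite lee_fin sqr_ge0.
    apply: (@le_trans _ _ ((4 ^+ n)%:E * (8 ^- n)%:E)%E).
      by apply: lee_wpmul2l => //; rewrite lee_fin exprn_ge0.
    rewrite -EFinM lee_fin /geometric /= mul1r -!exprVn -exprMn.
    by rewrite (_ : 4 * 8^-1 = 2^-1 :> R)//; lra.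
  apply: (@le_lt_trans _ _ 2%:E); last exact: ltry.
  apply: lime_le; first by apply: is_cvg_nneseries => n _ _; rewrite lee_fin /geometric/= mul1r exprn_ge0.
  apply: nearW => n; rewrite sumEFin lee_fin -[leLHS]/(series (geometric 1 2^-1) n).
  rewrite geometric_seriesE ?mul1r; last by rewrite lt_eqF//; lra.
  have : (0 <= 2^-1 ^+ n :> R) by rewrite exprn_ge0.
  by rewrite ler_pdivrMr; lra.
have : {ae mu, forall x, (\sum_(n <oo) d n x)%E \is a fin_num}.
  have /(@integrable_ae _ _ _ mu setT measurableT) :
      mu.-integrable setT (fun x => \sum_(n <oo) d n x)%E.
    apply/integrableP; split.
      exact: ge0_emeasurable_sum.
    under eq_integral do rewrite gee0_abs ?nneseries_ge0//.
    exact: sum_fin.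
  by apply: ae_imp => x; apply.
apply: ae_imp => x fin.
pose M := fine (\sum_(n <oo) d n x)%E.
have dM n : 4 ^+ n * (a n.+1 x - a n x) ^+ 2 <= M.
  rewrite -lee_fin fineK// -[leLHS]/(d n x).
  apply: (@le_trans _ _ (\sum_(0 <= k < n.+1) d k x)%E); last first.
    by apply: nneseries_lim_ge => k *; exact: d0.
  by rewrite big_nat_recr//= leeDr// sume_ge0.
have M0 : 0 <= M by rewrite fine_ge0// nneseries_ge0.
have step n : `|a n.+1 x - a n x| <= geometric (Num.sqrt M) 2^-1 n.
  rewrite -sqrtr_sqr /geometric/= -[leRHS]ger0_norm ?mulr_ge0 ?sqrtr_ge0 ?exprn_ge0//.
  rewrite -sqrtr_sqr ler_wsqrtr// exprMn sqr_sqrtr//.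
  have -> : (2^-1 ^+ n) ^+ 2 = (4 ^+ n)^-1 :> R.
    by rewrite -exprM mulnC exprM -exprVn; congr (_ ^+ n); field.
  by rewrite ler_pdivlMr ?exprn_gt0// mulrC dM.
have : cvgn (series (fun n => a n.+1 x - a n x)).
  apply: normed_cvg; apply: (series_le_cvg _ _ step) => //.
    by move=> n; rewrite /geometric/= mulr_ge0 ?sqrtr_ge0 ?exprn_ge0.
  by apply: is_cvg_geometric_series; rewrite ger0_norm; lra.
move=> /cvg_ex[l sl]; apply/cvg_ex; exists (l + a 0%N x).
rewrite (_ : (fun n => a n x) = (fun n => series (fun n => a n.+1 x - a n x) n + a 0%N x)).
  by apply: cvgD => //; exact: cvg_cst.
by apply/funext => n; rewrite /series/= telescope_sumr// subrK.
Qed.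

End Completeness.

Section CompletenessTheorem.
Context {R : realType}.
Variable mu : {measure set (measurableTypeR R) -> \bar R}.
Implicit Types (f g : R -> R[i]) (s : nat -> R -> R[i]).

(** The limit at a point depends on nothing but the values of the sequence at
    this point, so it inherits the periods of the terms; this is why the upper
    limit is preferred to a choice of limit. *)
Definition pointwise_lim s (x : R) : R[i] :=
  fine (limn_esup (fun n => (Re (s n x))%:E)) +i*
  fine (limn_esup (fun n => (Im (s n x))%:E)).

Lemma cmeasurable_pointwise_lim s : (forall n, cmeasurable (s n)) ->
  cmeasurable (pointwise_lim s).
Proof.
by move=> ms; split; (apply: measurableT_comp => //;
  apply: measurable_fun_limn_esup => n; apply/measurable_EFinP; have [] := ms n).
Qed.

Lemma cvg_pointwise_lim s (x : R) :
  cvgn (fun n => Re (s n x)) -> cvgn (fun n => Im (s n x)) ->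
  normc (s n x - pointwise_lim s x) @[n --> \oo] --> (0 : R).
Proof.
have esupE (a : nat -> R) : cvgn a -> fine (limn_esup (fun n => (a n)%:E)) = limn a.
  move=> ca; have H : (a n)%:E @[n --> \oo] --> (limn a)%:E.
    by apply: cvg_EFin; [exact: nearW|exact: ca].
  by rewrite is_cvg_limn_esupE; [rewrite (cvg_lim _ H)|apply/cvg_ex; eexists; exact: H].
move=> cR cI.
have nR : `|Re (s n x - pointwise_lim s x)| @[n --> \oo] --> (0 : R).
  apply/norm_cvg0P; under eq_fun do rewrite Re_B /= esupE//.
  by apply/subr_cvg0; rewrite //=.
have nI : `|Im (s n x - pointwise_lim s x)| @[n --> \oo] --> (0 : R).
  apply/norm_cvg0P; under eq_fun do rewrite Im_B /= esupE//.
  by apply/subr_cvg0; rewrite //=.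
apply: (@squeeze_cvgr _ _ _ _ (fun=> 0) (fun n => `|Re (s n x - pointwise_lim s x)| + `|Im (s n x - pointwise_lim s x)|)).
- by apply: nearW => n; rewrite normc_ge0 normc_le_ReIm.
- exact: cvg_cst.
- by rewrite -[X in _ --> X](addr0 0); apply: cvgD.
Qed.

Lemma L2_complete s : (forall n, L2 mu (s n)) ->
  (forall e : R, 0 < e -> exists N, forall m n, (N <= m)%N -> (N <= n)%N ->
     (norm2 mu (fun x => s m x - s n x)%R < e%:E)%E) ->
  exists g, [/\ L2 mu g, norm2 mu (fun x => s n x - g x)%R @[n --> \oo] --> 0%E &
     forall x y, (forall n, s n x = s n y) -> g x = g y].
Proof.
move=> sL2 cauchy.
have e0 k : 0 < (8 ^- k : R) by rewrite invr_gt0 exprn_gt0.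
have [N N_] := choice (fun k => cauchy _ (e0 k)).
pose phi k := (k + \sum_(i < k.+1) N i)%N.
have Nphi k m : (k <= m)%N -> (N k <= phi m)%N.
  by move=> km; rewrite /phi (bigD1 (Ordinal (km : (k < m.+1)%N)))//= addnCA leq_addr.
have ms n : cmeasurable (s n) by have [] := sL2 n.
pose g := pointwise_lim (fun k => s (phi k)).
have mg : cmeasurable g by exact: cmeasurable_pointwise_lim.
have fast k : (energy mu (fun x => s (phi k.+1) x - s (phi k) x)%R <= (8 ^- k)%:E)%E.
  have lt := N_ k _ _ (Nphi _ _ (leqnSn k)) (Nphi _ _ (leqnn k)).
  rewrite energyE; apply: (@le_trans _ _ ((8 ^- k)%:E * (8 ^- k)%:E)%E).
    by apply: lee_pmul; rewrite ?norm2_ge0// ltW.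
  rewrite -EFinM lee_fin ler_piMl ?(ltW (e0 _))// invf_le1 ?exprn_gt0//.
  by rewrite exprn_ege1// ler1n.
have ae_lim : {ae mu, forall x, normc (s (phi k) x - g x) @[k --> \oo] --> (0 : R)}.
  have aeR : {ae mu, forall x, cvgn (fun k => Re (s (phi k) x))}.
    apply: ae_cvg_fast_steps => n; first by have [] := ms (phi n).
    apply: le_trans (fast n); apply: ge0_le_integral => //.
    - by move=> x _; rewrite lee_fin sqr_ge0.
    - apply/measurable_EFinP; apply: measurable_funX.
      by apply: measurable_funB; [have [] := ms (phi n.+1)|have [] := ms (phi n)].
    - by apply: measurable_sqr_normc; exact: cmeasurableB.
    - by move=> x _; rewrite lee_fin sqr_normc !ReImE lerDl sqr_ge0.
  have aeI : {ae mu, forall x, cvgn (fun k => Im (s (phi k) x))}.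
    apply: ae_cvg_fast_steps => n; first by have [] := ms (phi n).
    apply: le_trans (fast n); apply: ge0_le_integral => //.
    - by move=> x _; rewrite lee_fin sqr_ge0.
    - apply/measurable_EFinP; apply: measurable_funX.
      by apply: measurable_funB; [have [] := ms (phi n.+1)|have [] := ms (phi n)].
    - by apply: measurable_sqr_normc; exact: cmeasurableB.
    - by move=> x _; rewrite lee_fin sqr_normc !ReImE lerDr sqr_ge0.
  by apply: ae_imp2 aeR aeI => x; exact: cvg_pointwise_lim.
have close e : 0 < e -> exists M, forall n, (M <= n)%N ->
    (norm2 mu (fun x => s n x - g x)%R <= e%:E)%E.
  move=> e_gt0; have [M M_] := cauchy _ e_gt0; exists M => n Mn.
  apply: (@fatou_norm2 _ mu (fun k x => s n x - s (phi k) x)) => //.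
  - by move=> k; exact: cmeasurableB.
  - exact: cmeasurableB.
  - apply: ae_imp ae_lim => x; apply: cvg_trans; apply: near_eq_cvg.
    by apply: nearW => k; rewrite normcBC; congr normc; ring.
  - exact: ltW.
  - near=> k; apply/ltW/M_ => //.
    by apply: (@leq_trans k); [near: k; exact: nbhs_infty_ge|exact: leq_addr].
exists g; split.
- split => //; have [M M_] := close 1 ltr01.
  have := norm2D mu (cmeasurableB mg (ms M)) (ms M).
  rewrite (_ : (fun x => g x - s M x + s M x)%R = g); last by apply/funext => x; exact: subrK.
  move=> /le_lt_trans -> //; rewrite norm2BC lte_add_pinfty//; last by case: (sL2 M).
  by rewrite (le_lt_trans (M_ _ _))// ltry.
- apply/cvge0P => [n|e e_gt0]; first exact: norm2_ge0.
  have e2 : 0 < e / 2 by rewrite divr_gt0.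
  have [M M_] := close _ e2; near=> n.
  apply: (@le_lt_trans _ _ (e / 2)%:E); last by rewrite lte_fin ltr_pdivrMr// ltr_pMr// ltr1n.
  by apply: M_; near: n; exact: nbhs_infty_ge.
- by move=> x y xy; rewrite /g /pointwise_lim; congr (fine (limn_esup _) +i* fine (limn_esup _)); apply/funext => k; rewrite xy.
Unshelve. all: by end_near. Qed.

End CompletenessTheorem.

(** * Integral operators with oscillating kernels *)

Section FubiniLocallyFinite.
Context {R : realType}.
Implicit Types (mu nu : {measure set (measurableTypeR R) -> \bar R}).

Definition ball0 (n : nat) : set (measurableTypeR R) := `[- n%:R, n%:R].

Lemma measurable_ball0 n : measurable (ball0 n).
Proof. exact: measurable_itv. Qed.

Lemma bigcup_ball0 : \bigcup_n ball0 n = setT.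
Proof.
apply/seteqP; split => // x _; exists (Num.bound x) => //.
rewrite /ball0 /= in_itv/= -ler_norml ltW//.
by have := archi_boundP (normr_ge0 x); rewrite /Num.bound normr_id.
Qed.

Lemma near_ball0 (x : R) : \forall n \near \oo, ball0 n x.
Proof.
exists (Num.bound x) => // n /= xn; rewrite /ball0 /= in_itv/= -ler_norml ltW//.
have := archi_boundP (normr_ge0 x); rewrite /Num.bound normr_id => /lt_le_trans; apply.
by rewrite ler_nat.
Qed.

Definition locally_finite mu := forall n, (mu (ball0 n) < +oo)%E.

Lemma locally_finite_sigma_finite mu : locally_finite mu -> sigma_finite setT mu.
Proof.
move=> lf; exists ball0; first by rewrite bigcup_ball0.
by move=> n; split; [exact: measurable_ball0|exact: lf].
Qed.

Lemma sigma_finite_measureP mu : locally_finite mu ->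
  exists m : {sigma_finite_measure set (measurableTypeR R) -> \bar R},
    mu = (m : {measure set (measurableTypeR R) -> \bar R}).
Proof.
move=> lf.
have sf := locally_finite_sigma_finite lf.
pose sfin := isSFinite.Build _ _ _ _ (sfinite_measure_sigma_finite sf).
pose b := isSigmaFinite.Build _ _ _ _ sf.
pose m := HB.pack_for (SigmaFiniteMeasure.type (measurableTypeR R) R) (Measure.sort mu) sfin b.
by exists m; exact: eq_measure.
Qed.

End FubiniLocallyFinite.

Section IntegrableComplex.
Context {R : realType}.
Variable mu : {measure set (measurableTypeR R) -> \bar R}.
Implicit Types (f g : R -> R[i]).

Definition L1 f := cmeasurable f /\ (\int[mu]_x (normc (f x))%:E < +oo)%E.

Lemma L1_le f g : cmeasurable f -> (forall x, normc (f x) <= normc (g x)) ->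
  L1 g -> L1 f.
Proof.
move=> mf fg [mg g1]; split => //; apply: le_lt_trans g1.
apply: ge0_le_integral => //.
- by move=> x _; rewrite lee_fin normc_ge0.
- by apply/measurable_EFinP; exact: measurable_normc.
- by apply/measurable_EFinP; exact: measurable_normc.
- by move=> x _; rewrite lee_fin.
Qed.

Lemma L1M f g (C : R) : L1 f -> cmeasurable g -> (forall x, normc (g x) <= C) ->
  L1 (fun x => f x * g x).
Proof.
move=> f1 mg gC; have C0 : 0 <= C := le_trans (normc_ge0 _) (gC 0).
have [mf f1'] := f1.
apply: (@L1_le _ (fun x => C%:C * f x)).
- exact: cmeasurableM.
- by move=> x; rewrite !normc_M mulrC ler_wpM2r ?normc_ge0// normc_C ger0_norm.
- split; first by apply: cmeasurableM => //; exact: cmeasurable_cst.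
  under eq_integral do rewrite normc_M EFinM.
  rewrite ge0_integralZl//.
  + by rewrite lte_mul_pinfty// ?lee_fin ?normc_ge0.
  + by apply/measurable_EFinP; exact: measurable_normc.
  + by move=> x _; rewrite lee_fin normc_ge0.
  + by rewrite lee_fin normc_ge0.
Qed.

Lemma L1_dominated f (a : R -> R) :
  measurable_fun [set: measurableTypeR R] (a : measurableTypeR R -> R) -> L1 f ->
  (forall x, `|a x| <= normc (f x)) -> mu.-integrable setT (fun x => (a x)%:E).
Proof.
move=> ma [mf f1] af; apply/integrableP; split; first exact/measurable_EFinP.
apply: le_lt_trans f1; apply: ge0_le_integral => //.
- by apply: measurableT_comp => //; exact/measurable_EFinP.
- by apply/measurable_EFinP; exact: measurable_normc.
- by move=> x _; rewrite lee_fin.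
Qed.

Lemma L1_Re f : L1 f -> mu.-integrable setT (fun x => (Re (f x))%:E).
Proof. by move=> f1; apply: L1_dominated (f1) _ => [|x]; [have [[]] := f1|exact: ler_Re]. Qed.

Lemma L1_Im f : L1 f -> mu.-integrable setT (fun x => (Im (f x))%:E).
Proof. by move=> f1; apply: L1_dominated (f1) _ => [|x]; [have [[]] := f1|exact: ler_Im]. Qed.

Lemma Re_cintegralM f (z : R[i]) : L1 f ->
  Re (cintegral mu setT f * z) = \int[mu]_x Re (f x * z).
Proof.
move=> f1; rewrite Re_M /=.
rewrite -!RintegralZr//; [|exact: L1_Im|exact: L1_Re].
rewrite -RintegralB//; last 2 first.
  exact: (@integrableZr _ _ _ mu _ measurableT (Re z) _ (L1_Re f1)).
  exact: (@integrableZr _ _ _ mu _ measurableT (Im z) _ (L1_Im f1)).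
by apply: eq_Rintegral => x _; rewrite Re_M.
Qed.

Lemma normc_cintegral_le f : L1 f ->
  normc (cintegral mu setT f) <= 2 * fine (\int[mu]_x (normc (f x))%:E).
Proof.
move=> f1; have [mf f1'] := f1; rewrite (le_trans (normc_le_ReIm _))//= mulr_natl mulr2n.
have fin : (\int[mu]_x (normc (f x))%:E)%E \is a fin_num.
  by rewrite ge0_fin_numE//; apply: integral_ge0 => x _; rewrite lee_fin normc_ge0.
have bnd (a : R -> R) :
    measurable_fun [set: measurableTypeR R] (a : measurableTypeR R -> R) ->
    (forall x, `|a x| <= normc (f x)) ->
    `|\int[mu]_x a x| <= fine (\int[mu]_x (normc (f x))%:E).
  move=> ma af; have ia := L1_dominated ma f1 af.
  rewrite (le_trans (le_normr_Rintegral _ ia))//; apply: fine_le => //.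
  - by rewrite ge0_fin_numE; [have /integrableP[] := ia|apply: integral_ge0 => x _; rewrite lee_fin].
  - apply: ge0_le_integral => //.
    + by apply/measurable_EFinP; exact: measurableT_comp.
    + by apply/measurable_EFinP; exact: measurable_normc.
    + by move=> x _; rewrite lee_fin.
have [mRe mIm] := mf; apply: lerD; apply: bnd => // x; [exact: ler_Re|exact: ler_Im].
Qed.

End IntegrableComplex.

Section Exchange.
Context {R : realType}.
Implicit Types (mu nu : {measure set (measurableTypeR R) -> \bar R}) (f g : R -> R[i]).

Definition tfun mu (s : R) f (xi : R) : R[i] :=
  cintegral mu setT (fun x => f x * cis (s * (x * xi))).

Lemma measurable_Rintegral_param mu (k : R * R -> R) : locally_finite mu ->
  measurable_fun [set: measurableTypeR R * measurableTypeR R]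
    (k : measurableTypeR R * measurableTypeR R -> R) ->
  measurable_fun [set: measurableTypeR R]
    (fun y : measurableTypeR R => \int[mu]_x k (x, y)).
Proof.
move=> /sigma_finite_measureP[m ->] mk; apply: measurableT_comp => //.
have mEk : measurable_fun [set: measurableTypeR R * measurableTypeR R] (EFin \o k).
  exact/measurable_EFinP.
under eq_fun do rewrite integralE.
apply: emeasurable_funB.
- rewrite (_ : (fun x => _) = fubini_G m (funepos (EFin \o k)));
    last by apply/funext => y; apply: eq_integral => x _; rewrite ?funeposE ?funenegE.
  apply: measurable_fun_fubini_tonelli_G; first exact: measurable_funepos.
  exact: funepos_ge0.
- rewrite (_ : (fun x => _) = fubini_G m (funeneg (EFin \o k)));
    last by apply/funext => y; apply: eq_integral => x _; rewrite ?funeposE ?funenegE.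
  apply: measurable_fun_fubini_tonelli_G; first exact: measurable_funeneg.
  exact: funeneg_ge0.
Qed.

Lemma measurable_fst_comp (a : R -> R) :
  measurable_fun [set: measurableTypeR R] (a : measurableTypeR R -> R) ->
  measurable_fun [set: measurableTypeR R * measurableTypeR R]
    (fun p : measurableTypeR R * measurableTypeR R => a p.1).
Proof. by move=> ma; apply: (measurableT_comp ma); exact: measurable_fst. Qed.

Lemma measurable_snd_comp (a : R -> R) :
  measurable_fun [set: measurableTypeR R] (a : measurableTypeR R -> R) ->
  measurable_fun [set: measurableTypeR R * measurableTypeR R]
    (fun p : measurableTypeR R * measurableTypeR R => a p.2).
Proof. by move=> ma; apply: (measurableT_comp ma); exact: measurable_snd. Qed.

Lemma measurable_phase (s : R) :
  measurable_fun [set: measurableTypeR R * measurableTypeR R]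
    (fun p : measurableTypeR R * measurableTypeR R => s * (p.1 * p.2) : R).
Proof.
apply: measurable_funM => //; apply: measurable_funM.
  exact: (@measurable_fst_comp id).
exact: (@measurable_snd_comp id).
Qed.

Lemma measurable_cos_phase (s : R) :
  measurable_fun [set: measurableTypeR R * measurableTypeR R]
    (fun p : measurableTypeR R * measurableTypeR R => cos (s * (p.1 * p.2)) : R).
Proof.
apply: (measurableT_comp (f := @cos R)); last exact: measurable_phase.
by apply: continuous_measurable_fun; exact: continuous_cos.
Qed.

Lemma measurable_sin_phase (s : R) :
  measurable_fun [set: measurableTypeR R * measurableTypeR R]
    (fun p : measurableTypeR R * measurableTypeR R => sin (s * (p.1 * p.2)) : R).
Proof.
apply: (measurableT_comp (f := @sin R)); last exact: measurable_phase.
by apply: continuous_measurable_fun; exact: continuous_sin.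
Qed.

Lemma cmeasurable_tfun mu (s : R) f : locally_finite mu -> cmeasurable f ->
  cmeasurable (tfun mu s f).
Proof.
move=> lf [mRe mIm].
have mR := measurable_fst_comp mRe; have mI := measurable_fst_comp mIm.
have mc := measurable_cos_phase s; have ms := measurable_sin_phase s.
split; rewrite /tfun /cintegral /=.
- under eq_fun do under eq_Rintegral do rewrite Re_M /=.
  apply: (@measurable_Rintegral_param mu (fun p => Re (f p.1) * cos (s * (p.1 * p.2)) - Im (f p.1) * sin (s * (p.1 * p.2)))) => //.
  by apply: measurable_funB; exact: measurable_funM.
- under eq_fun do under eq_Rintegral do rewrite Im_M /=.
  apply: (@measurable_Rintegral_param mu (fun p => Re (f p.1) * sin (s * (p.1 * p.2)) + Im (f p.1) * cos (s * (p.1 * p.2)))) => //.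
  by apply: measurable_funD; exact: measurable_funM.
Qed.

Lemma measurable_lin (s xi : R) :
  measurable_fun [set: measurableTypeR R] (fun x : measurableTypeR R => s * (x * xi) : R).
Proof. by apply: measurable_funM => //; exact: measurable_funM. Qed.

Lemma L1_cis mu (s xi : R) f : L1 mu f -> L1 mu (fun x => f x * cis (s * (x * xi))).
Proof.
move=> f1; apply: (@L1M _ mu _ _ 1) => // [|x]; last by rewrite normc_cis.
apply: cmeasurable_cis; exact: measurable_lin.
Qed.

(** By Fubini, the kernels e^{i s x xi} and e^{- i s x xi} being conjugate. *)
Lemma tfun_adjoint mu nu (s : R) f g : locally_finite mu -> locally_finite nu ->
  L1 mu f -> L1 nu g ->
  \int[nu]_xi Re (tfun mu s f xi * (g xi)^*) =
  \int[mu]_x Re (f x * (tfun nu (- s) g x)^*).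
Proof.
move=> lmu lnu f1 g1.
pose k (p : R * R) : R := Re (f p.1 * cis (s * (p.1 * p.2)) * (g p.2)^*).
have [[mfR mfI] f1'] := f1; have [[mgR mgI] g1'] := g1.
have mk : measurable_fun [set: measurableTypeR R * measurableTypeR R]
    (k : measurableTypeR R * measurableTypeR R -> R).
  rewrite /k; under eq_fun do rewrite !ReImE /=.
  have := measurable_fst_comp mfR; have := measurable_fst_comp mfI.
  have := measurable_snd_comp mgR; have := measurable_snd_comp mgI.
  have := measurable_cos_phase s; have := measurable_sin_phase s.
  move=> ms mc mGI mGR mFI mFR.
  by repeat (apply: measurable_funB || apply: measurable_funD ||
    apply: measurable_funM || (apply: measurableT_comp => //)) => //.
have kle x xi : `|k (x, xi)| <= normc (f x) * normc (g xi).
  by rewrite (le_trans (ler_Re _))// !normc_M normc_J normc_cis mulr1.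
have lhsE xi : Re (tfun mu s f xi * (g xi)^*) = \int[mu]_x k (x, xi).
  by rewrite Re_cintegralM//; exact: L1_cis.
have rhsE x : Re (f x * (tfun nu (- s) g x)^*) = \int[nu]_xi k (x, xi).
  rewrite Re_mulJC Re_cintegralM; last exact: L1_cis.
  apply: eq_Rintegral => xi _; rewrite /k/= mulNr cisN !ReImE /= (mulrC xi x); ring.
under eq_Rintegral do rewrite lhsE.
under [RHS]eq_Rintegral do rewrite rhsE.
have ikx x : nu.-integrable setT (fun xi => (k (x, xi))%:E).
  apply: (@L1_dominated _ _ (fun xi => f x * g xi)).
  - by apply: (measurableT_comp mk); exact: measurable_pair1.
  - have [mg _] := g1; split; first by apply: cmeasurableM => //; exact: cmeasurable_cst.
    under eq_integral do rewrite normc_M EFinM.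
    rewrite ge0_integralZl//.
    + by rewrite lte_mul_pinfty// ?lee_fin ?normc_ge0.
    + by apply/measurable_EFinP; exact: measurable_normc.
    + by move=> ? _; rewrite lee_fin normc_ge0.
    + by rewrite lee_fin normc_ge0.
  - by move=> xi; rewrite normc_M.
have ikxi xi : mu.-integrable setT (fun x => (k (x, xi))%:E).
  apply: (@L1_dominated _ _ (fun x => g xi * f x)).
  - by apply: (measurableT_comp mk); exact: measurable_pair2.
  - have [mf _] := f1; split; first by apply: cmeasurableM => //; exact: cmeasurable_cst.
    under eq_integral do rewrite normc_M EFinM.
    rewrite ge0_integralZl//.
    + by rewrite lte_mul_pinfty// ?lee_fin ?normc_ge0.
    + by apply/measurable_EFinP; exact: measurable_normc.
    + by move=> ? _; rewrite lee_fin normc_ge0.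
    + by rewrite lee_fin normc_ge0.
  - by move=> x; rewrite normc_M mulrC.
rewrite /Rintegral; congr fine.
under eq_integral do rewrite fineK ?integrable_fin_num//.
under [RHS]eq_integral do rewrite fineK ?integrable_fin_num//.
move: lmu lnu ikx ikxi f1 g1 f1' g1' {lhsE rhsE} => /sigma_finite_measureP[m ->] /sigma_finite_measureP[n ->] ikx ikxi f1 g1 f1' g1'.
apply/esym; apply: (@Fubini _ _ _ _ _ m n (EFin \o k)).
apply/integrable12ltyP; first exact/measurable_EFinP.
apply: (@le_lt_trans _ _ (\int[m]_x ((normc (f x))%:E * \int[n]_xi (normc (g xi))%:E))%E).
  apply: ge0_le_integral => //.
  - by move=> x _; apply: integral_ge0.
  - apply: (@measurable_fun_fubini_tonelli_F _ _ _ _ _ n (fun p => `|(k p)%:E|)%E) => //.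
    by apply: measurableT_comp => //; exact/measurable_EFinP.
  - apply: emeasurable_funM => //; apply/measurable_EFinP.
    by apply: measurable_normc.
  - move=> x _; rewrite -ge0_integralZl//.
    + apply: ge0_le_integral => //.
      * by apply: measurableT_comp => //; have /integrableP[] := ikx x.
      * by apply: emeasurable_funM => //; apply/measurable_EFinP; exact: measurable_normc.
      * by move=> xi _; rewrite -EFinM lee_fin kle.
    + by apply/measurable_EFinP; exact: measurable_normc.
    + by move=> ? _; rewrite lee_fin normc_ge0.
    + by rewrite lee_fin normc_ge0.
rewrite ge0_integralZr//.
- by rewrite lte_mul_pinfty// ?integral_ge0// ?ge0_fin_numE ?integral_ge0// => *; rewrite lee_fin normc_ge0.
- by apply/measurable_EFinP; exact: measurable_normc.
- by move=> ? _; rewrite lee_fin normc_ge0.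
- by apply: integral_ge0 => *; rewrite lee_fin normc_ge0.
Qed.

End Exchange.

(** * Truncated Fourier integrals *)

Section FourierTransforms.
Context {R : realType}.
Implicit Types (mu nu : {measure set (measurableTypeR R) -> \bar R}) (f g : R -> R[i]).

Definition truncate (n : nat) f (x : R) : R[i] := (\1_(ball0 n) x)%:C * f x.

Lemma cmeasurable_truncate n f : cmeasurable f -> cmeasurable (truncate n f).
Proof. by move=> mf; apply: cmeasurable_indic => //; exact: measurable_ball0. Qed.

Lemma truncate_in n f x : ball0 n x -> truncate n f x = f x.
Proof. by move=> nx; rewrite /truncate indicE mem_set// mul1r. Qed.

Lemma truncate_notin n f x : ~ ball0 n x -> truncate n f x = 0.
Proof. by move=> nx; rewrite /truncate indicE memNset// mul0r. Qed.

Lemma normc_truncate n f x : normc (truncate n f x) <= normc (f x).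
Proof.
rewrite /truncate normc_M ler_piMl ?normc_ge0// normc_C indicE.
by case: (x \in _); rewrite ?normr1 ?normr0 ?ler01.
Qed.

Lemma L2_truncate mu n f : L2 mu f -> L2 mu (truncate n f).
Proof.
move=> f2; have [mf _] := f2; apply: L2_normc_le f2.
  exact: cmeasurable_truncate.
by apply: aeW => x; exact: normc_truncate.
Qed.

Lemma norm2_truncate mu n f : cmeasurable f ->
  (norm2 mu (truncate n f) <= norm2 mu f)%E.
Proof.
move=> mf; apply: le_norm2 => //; first exact: cmeasurable_truncate.
by apply: aeW => x; exact: normc_truncate.
Qed.

Lemma L1_truncate mu n f : locally_finite mu -> L2 mu f -> L1 mu (truncate n f).
Proof.
move=> lf f2; have [mf _] := f2; split; first exact: cmeasurable_truncate.
apply: (@le_lt_trans _ _ (\int[mu]_x ((normc (f x) ^+ 2)%:E + (\1_(ball0 n) x)%:E))%E).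
  apply: ge0_le_integral => //.
  - by move=> x _; rewrite lee_fin normc_ge0.
  - by apply/measurable_EFinP; apply: measurable_normc; exact: cmeasurable_truncate.
  - apply: emeasurable_funD; first exact: measurable_sqr_normc.
    by apply/measurable_EFinP; apply: measurable_indic; exact: measurable_ball0.
  - move=> x _; rewrite -EFinD lee_fin /truncate normc_M normc_C indicE.
    case: (x \in _); rewrite ?normr1 ?normr0 ?mul1r ?mul0r ?addr0 ?sqr_ge0//=.
    have := sqr_ge0 (normc (f x) - 1); nra.
have mi : measurable_fun [set: measurableTypeR R] (fun x => (\1_(ball0 n) x)%:E : \bar R).
  by apply/measurable_EFinP; apply: measurable_indic; exact: measurable_ball0.
have i0 x : (0 <= (\1_(ball0 n) x)%:E :> \bar R)%E by rewrite lee_fin.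
have f0 x : (0 <= (normc (f x) ^+ 2)%:E)%E by rewrite lee_fin sqr_ge0.
rewrite ge0_integralD//; last exact: measurable_sqr_normc.
rewrite -/(energy mu f) sqr_nrm// integral_indic//; last exact: measurable_ball0.
by rewrite setIT lte_add_pinfty ?ltry// lf.
Qed.

(** By dominated convergence, with bound K^2 |f|^2. *)
Lemma norm2_mul_cvg0 mu (m : nat -> R -> R[i]) f (K : R) :
  (forall n, cmeasurable (m n)) -> (forall n x, normc (m n x) <= K) -> L2 mu f ->
  (forall x, normc (m n x) @[n --> \oo] --> (0 : R)) ->
  norm2 mu (fun x => m n x * f x)%R @[n --> \oo] --> 0%E.
Proof.
move=> mm mK f2 m0; have [mf _] := f2.
have mmf n : cmeasurable (fun x => m n x * f x) by exact: cmeasurableM.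
pose u n (x : measurableTypeR R) := (normc (m n x * f x) ^+ 2)%:E.
have [_ _] : [/\ mu.-integrable setT (cst 0%E : measurableTypeR R -> \bar R),
    [sequence (\int[mu]_x `|u n x - 0|)%E]_n @ \oo --> 0%E
  & [sequence (\int[mu]_x u n x)%E]_n @ \oo --> (\int[mu]_x 0)%E].
  apply: (@dominated_convergence _ _ _ mu setT measurableT u (cst 0%E)
    (fun x => ((K ^+ 2)%:E * (normc (f x) ^+ 2)%:E)%E)) => //.
  - by move=> n; exact: measurable_sqr_normc.
  - apply: aeW => x _; apply: cvg_EFin; first exact: nearW.
    have H : normc (m n x) ^+ 2 * normc (f x) ^+ 2 @[n --> \oo] --> (0 : R).
      rewrite -[X in _ --> X](mul0r (normc (f x) ^+ 2)); apply: cvgMl.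
      rewrite -[X in _ --> X](expr0n R 2).
      apply: (@cvg_comp _ _ _ (fun n => normc (m n x)) (fun r : R => r ^+ 2)); first exact: m0.
      exact: exprn_continuous.
    by under eq_fun do rewrite /u /= normc_M exprMn.
  - apply: integrableZl => //; apply/integrableP; split; first exact: measurable_sqr_normc.
    rewrite -[X in (X < _)%E](_ : energy mu f = _); first by rewrite sqr_nrm ?ltry.
    by apply: eq_integral => x _; rewrite gee0_abs// lee_fin sqr_ge0.
  - apply: aeW => x n _; rewrite gee0_abs; last by rewrite lee_fin sqr_ge0.
    rewrite /u -EFinM lee_fin.
    by rewrite normc_M exprMn ler_wpM2r ?sqr_ge0// lerXn2r ?nnegrE ?normc_ge0// (le_trans _ (mK 0%N x))// normc_ge0.
rewrite integral0 => H; apply/cvge0P => [n|e e0]; first exact: norm2_ge0.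
have /cvge0P H' := H.
have {H'} : \forall n \near \oo, (\int[mu]_x u n x < (e ^+ 2)%:E)%E.
  by apply: H' => [n|]; [exact: energy_ge0|exact: exprn_gt0].
apply: filterS => n; rewrite -[integral _ _ _]/(energy mu (fun x => m n x * f x)%R) energyE.
rewrite !ltNge; apply: contra => en.
by rewrite expr2 EFinM lee_pmul// lee_fin ltW.
Qed.

Lemma truncate_cvg mu f : L2 mu f ->
  norm2 mu (fun x => truncate n f x - f x)%R @[n --> \oo] --> 0%E.
Proof.
move=> f2; have := @norm2_mul_cvg0 mu (fun n x => (\1_(ball0 n) x)%:C - 1) f 1.
have E n : (fun x => truncate n f x - f x) = (fun x => ((\1_(ball0 n) x)%:C - 1) * f x).
  by apply/funext => x; rewrite /truncate mulrBl mul1r.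
under [in X in _ -> X]eq_fun do rewrite E; apply => //.
- move=> n; apply: cmeasurableB; last exact: cmeasurable_cst.
  by apply: cmeasurableC; apply: measurable_indic; exact: measurable_ball0.
- move=> n x; rewrite indicE; case: (x \in _).
    by rewrite subrr Normc.normc0.
  by rewrite sub0r normc_N Normc.normc1.
- move=> x; apply: cvg_near_cst; apply: filterS (near_ball0 x) => n nx.
  by rewrite indicE mem_set// subrr Normc.normc0.
Qed.

(** With s = -1 from the space to the frequencies this is the Fourier transform,
    and with s = 1 in the other direction its inverse; one definition serves both
    so that every estimate is proved once. *)
Definition tf mu (s : R) (n : nat) f (xi : R) : R[i] :=
  ((Num.sqrt (2 * pi))^-1)%:C *
  cintegral mu (ball0 n) (fun x => f x * cis (s * (x * xi))).

Definition normalization : R := (Num.sqrt (2 * pi))^-1.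

Lemma normalization_gt0 : 0 < normalization.
Proof. by rewrite invr_gt0 sqrtr_gt0 mulr_gt0// pi_gt0. Qed.

Lemma normalization_sqr : normalization ^+ 2 = (2 * pi)^-1.
Proof. by rewrite exprVn sqr_sqrtr// mulr_ge0// pi_ge0. Qed.

Lemma tfE mu s n f xi : tf mu s n f xi = normalization%:C * tfun mu s (truncate n f) xi.
Proof.
rewrite /tf /tfun /cintegral; congr (_ * _); apply: complex_eqP => /=; rewrite Rintegral_mkcond;
  apply: eq_Rintegral => x _; rewrite patchE; case: ifPn => [/set_mem nx|/negP nx].
- by rewrite truncate_in.
- by rewrite truncate_notin ?mul0r// => /mem_set.
- by rewrite truncate_in.
- by rewrite truncate_notin ?mul0r// => /mem_set.
Qed.

Lemma cmeasurable_tf mu s n f : locally_finite mu -> cmeasurable f ->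
  cmeasurable (tf mu s n f).
Proof.
move=> lf mf; rewrite (_ : tf _ _ _ _ = fun xi => normalization%:C * tfun mu s (truncate n f) xi).
  apply: cmeasurableM; first exact: cmeasurable_cst.
  by apply: cmeasurable_tfun => //; exact: cmeasurable_truncate.
by apply/funext => xi; rewrite tfE.
Qed.

Lemma tf_le mu s n f xi : locally_finite mu -> L2 mu f ->
  normc (tf mu s n f xi) <=
  normalization * (2 * fine (\int[mu]_x (normc (truncate n f x))%:E)).
Proof.
move=> lf f2; rewrite tfE normc_M normc_C gtr0_norm ?normalization_gt0//.
apply: ler_wpM2l; first exact: ltW normalization_gt0.
have f1 := L1_truncate n lf f2.
rewrite (le_trans (normc_cintegral_le (L1_cis s xi f1)))//.
by under eq_integral do rewrite normc_M normc_cis mulr1.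
Qed.

Lemma tf_adjoint mu nu s n m f g : locally_finite mu -> locally_finite nu ->
  L2 mu f -> L2 nu g ->
  ip nu (tf mu s n f) (truncate m g) = ip mu (truncate n f) (tf nu (- s) m g).
Proof.
move=> lmu lnu f2 g2; rewrite /ip.
have f1 := L1_truncate n lmu f2; have g1 := L1_truncate m lnu g2.
have c0 := (@cmeasurable_cst R normalization%:C).
pose cf x := normalization%:C * truncate n f x.
have cf1 : L1 mu cf.
  have := @L1M _ mu _ (fun=> normalization%:C) (normc (normalization%:C : R[i])) f1 c0 (fun=> lexx _).
  by under eq_fun do rewrite mulrC.
transitivity (\int[nu]_xi Re (tfun mu s cf xi * (truncate m g xi)^*)).
  apply: eq_Rintegral => xi _; rewrite tfE; congr (Re (_ * _)).
  have c1 := L1_cis s xi f1; have cc1 := L1_cis s xi cf1.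
  apply: complex_eqP; rewrite !ReImE mul0r ?subr0 ?addr0 /tfun /=.
    rewrite -RintegralZl//; last exact: L1_Re c1.
    by apply: eq_Rintegral => x _; rewrite /cf !ReImE; ring.
  rewrite -RintegralZl//; last exact: L1_Im c1.
  by apply: eq_Rintegral => x _; rewrite /cf !ReImE; ring.
rewrite tfun_adjoint//; apply: eq_Rintegral => x _; rewrite tfE /cf.
rewrite !ReImE /=; ring.
Qed.

End FourierTransforms.

(** * Fourier transforms as limits in the mean *)

Section LimitsInL2.
Context {R : realType}.
Variable nu : {measure set (measurableTypeR R) -> \bar R}.
Implicit Types (a b : nat -> R -> R[i]) (f g h : R -> R[i]).

Definition L2_cvg a g := norm2 nu (fun x => a n x - g x)%R @[n --> \oo] --> 0%E.

Lemma L2_cvg_nrm a g : L2_cvg a g -> nrm nu (fun x => a n x - g x) @[n --> \oo] --> (0 : R).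
Proof. by move=> /fine_cvgP[]. Qed.

Lemma L2_cvg_ip a b g h : (forall n, L2 nu (a n)) -> (forall n, L2 nu (b n)) ->
  L2 nu g -> L2 nu h -> L2_cvg a g -> L2_cvg b h ->
  ip nu (a n) (b n) @[n --> \oo] --> ip nu g h.
Proof.
move=> a2 b2 g2 h2 /L2_cvg_nrm ag /L2_cvg_nrm bh.
apply/subr_cvg0.
pose A n := nrm nu (fun x => a n x - g x); pose B n := nrm nu (fun x => b n x - h x).
apply: norm_cvg0; apply: (@squeeze_cvgr _ _ _ _ (fun=> 0) (fun n => A n * (B n + nrm nu h) + nrm nu g * B n)).
- apply: nearW => n; rewrite normr_ge0 /=.
  have -> : ip nu (a n) (b n) - ip nu g h =
      ip nu (fun x => a n x - g x) (b n) + ip nu g (fun x => b n x - h x).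
    by rewrite ipBl// ipBr//; ring.
  rewrite (le_trans (ler_normD _ _))// lerD//.
    rewrite (le_trans (ip_CauchySchwarz (L2B (a2 n) g2) (b2 n)))// ler_wpM2l ?nrm_ge0//.
    have := nrmD (L2B (b2 n) h2) h2.
    by rewrite (_ : (fun x => b n x - h x + h x) = b n)//; apply/funext => x; exact: subrK.
  by rewrite (le_trans (ip_CauchySchwarz g2 (L2B (b2 n) h2))).
- exact: cvg_cst.
- rewrite (_ : (0 : R) = 0 * (0 + nrm nu h) + nrm nu g * 0); last by ring.
  apply: cvgD; apply: cvgM => //; first by apply: cvgD => //; exact: cvg_cst.
  exact: cvg_cst.
Qed.

Lemma L2_cvg_le a g (C : R) : (forall n, cmeasurable (a n)) -> cmeasurable g ->
  L2_cvg a g -> (\forall n \near \oo, (norm2 nu (a n) <= C%:E)%E) ->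
  (norm2 nu g <= C%:E)%E.
Proof.
move=> ma mg /cvge0P ag aC; apply/lee_addgt0Pr => e e0.
have {}ag : \forall n \near \oo, (norm2 nu (fun x => a n x - g x)%R < e%:E)%E.
  by apply: ag => // n; exact: norm2_ge0.
near \oo => n.
apply: (@le_trans _ _ (norm2 nu (a n) + norm2 nu (fun x => a n x - g x)%R)%E).
  rewrite -[leLHS](_ : norm2 nu (fun x => a n x - (a n x - g x))%R = _).
    by apply: norm2B => //; exact: cmeasurableB.
  by apply: eq_norm2_normc => x; rewrite subKr.
by apply: leeD; [near: n|apply: ltW; near: n].
Unshelve. all: by end_near. Qed.

Lemma L2_cvg_uniq a g h : (forall n, cmeasurable (a n)) -> cmeasurable g ->
  cmeasurable h -> L2_cvg a g -> L2_cvg a h -> {ae nu, forall x, g x = h x}.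
Proof.
move=> ma mg mh /cvge0P ag /cvge0P ah.
have n0 n (f : nat -> R -> R[i]) k : (0 <= norm2 nu (fun x => f n x - k x)%R)%E.
  exact: norm2_ge0.
have : norm2 nu (fun x => g x - h x)%R = 0%E.
  apply/eqP; rewrite eq_le norm2_ge0 andbT; apply/lee_addgt0Pr => e e0; rewrite add0e.
  have e2 : 0 < e / 2 by rewrite divr_gt0.
  have := ag (fun n => n0 n _ _) _ e2; have := ah (fun n => n0 n _ _) _ e2 => Ah Ag.
  near \oo => n; rewrite (le_trans (norm2_dist_trans _ mg (ma n) mh))//.
  rewrite (splitr e) EFinD norm2BC; apply: leeD; apply: ltW; near: n; [exact: Ag|exact: Ah].
move=> /norm2_eq0 H; have := H (cmeasurableB mg mh).
by apply: ae_imp => x /eqP; rewrite subr_eq0 => /eqP.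
Unshelve. all: by end_near. Qed.

End LimitsInL2.

Section FourierExtension.
Context {R : realType}.
Variables (mu nu : {measure set (measurableTypeR R) -> \bar R}) (s : R).
Implicit Types (f g : R -> R[i]).
Hypotheses (lmu : locally_finite mu) (lnu : locally_finite nu).

Definition contracts := forall n f, L2 mu f ->
  (norm2 nu (tf mu s n f) <= norm2 mu (truncate n f))%E.

Hypothesis ctr : contracts.

Definition is_ft f g := L2 nu g /\ L2_cvg nu (fun n => tf mu s n f) g.

Lemma tf_L2 n f : L2 mu f -> L2 nu (tf mu s n f).
Proof.
move=> f2; have [mf _] := f2; split; first exact: cmeasurable_tf.
by rewrite (le_lt_trans (ctr n f2))//; have [] := L2_truncate n f2.
Qed.

Lemma tfD n f g (xi : R) : L2 mu f -> L2 mu g ->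
  tf mu s n (fun x => f x + g x) xi = tf mu s n f xi + tf mu s n g xi.
Proof.
move=> f2 g2; rewrite !tfE -mulrDr; congr (_ * _).
have f1 := L1_cis s xi (L1_truncate n lmu f2).
have g1 := L1_cis s xi (L1_truncate n lmu g2).
rewrite /tfun; apply: complex_eqP; rewrite !ReImE /=.
  rewrite -RintegralD//; [|exact: L1_Re f1|exact: L1_Re g1].
  by apply: eq_Rintegral => x _; rewrite /truncate !ReImE; ring.
rewrite -RintegralD//; [|exact: L1_Im f1|exact: L1_Im g1].
by apply: eq_Rintegral => x _; rewrite /truncate !ReImE; ring.
Qed.

Lemma tfN n f (xi : R) : L2 mu f -> tf mu s n (fun x => - f x) xi = - tf mu s n f xi.
Proof.
move=> f2; have tf0 : tf mu s n (fun=> 0) xi = 0.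
  have := tfD n xi (L2_0 mu) (L2_0 mu); rewrite (_ : (fun=> 0 + 0) = (fun=> 0)).
    by move/eqP; rewrite -subr_eq0 opprD addNKr oppr_eq0 => /eqP.
  by apply/funext => x; rewrite addr0.
have := tfD n xi f2 (L2N f2); rewrite (_ : (fun x => f x - f x) = (fun=> 0)).
  by rewrite tf0 => /esym/eqP; rewrite addrC addr_eq0 => /eqP.
by apply/funext => x; rewrite subrr.
Qed.

Lemma tfB n f g (xi : R) : L2 mu f -> L2 mu g ->
  tf mu s n (fun x => f x - g x) xi = tf mu s n f xi - tf mu s n g xi.
Proof. by move=> f2 g2; rewrite tfD ?tfN//; exact: L2N. Qed.

Lemma truncate_truncate n m f : (n <= m)%N -> truncate m (truncate n f) = truncate n f.
Proof.
move=> nm; apply/funext => x; have [nx|nx] := pselect (ball0 n x).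
  rewrite truncate_in// /ball0 /=; move: nx; rewrite /ball0 /= !in_itv/= => /andP[a b].
  by apply/andP; split; rewrite ?(le_trans _ a) ?(le_trans b)// ?lerN2 ler_nat.
by rewrite [truncate n f]lock {1}/truncate -lock truncate_notin// mulr0.
Qed.

Lemma tf_truncate n m f : (n <= m)%N -> tf mu s m (truncate n f) = tf mu s n f.
Proof. by move=> nm; apply/funext => xi; rewrite !tfE truncate_truncate. Qed.

Lemma tf_ae_eq n f g (xi : R) : cmeasurable f -> cmeasurable g ->
  {ae mu, forall x, f x = g x} -> tf mu s n f xi = tf mu s n g xi.
Proof.
move=> mf mg fg; rewrite !tfE; congr (_ * _).
have mc : cmeasurable (fun x : R => cis (s * (x * xi)) : R[i]).
  by apply: cmeasurable_cis; exact: measurable_lin.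
have [mf1 mf2] := cmeasurableM (cmeasurable_truncate n mf) mc.
have [mg1 mg2] := cmeasurableM (cmeasurable_truncate n mg) mc.
apply: complex_eqP => /=; rewrite /Rintegral; congr fine; apply: ae_eq_integral => //.
- exact/measurable_EFinP.
- exact/measurable_EFinP.
- by apply: ae_imp fg => x fg _; rewrite /truncate fg.
- exact/measurable_EFinP.
- exact/measurable_EFinP.
- by apply: ae_imp fg => x fg _; rewrite /truncate fg.
Qed.

(** The truncated transforms form a Cauchy sequence, because the truncations of f
    converge and the operators are uniform contractions. *)
Lemma ft_exists f : L2 mu f -> exists g, is_ft f g /\
  forall x y, (forall n, tf mu s n f x = tf mu s n f y) -> g x = g y.
Proof.
move=> f2.
have [|g [g2 fg gxy]] := @L2_complete _ nu (fun n => tf mu s n f) (fun n => tf_L2 n f2).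
  move=> e e0; have /cvge0P H := truncate_cvg f2.
  have [N _ NH] := H (fun=> norm2_ge0 _ _) e e0.
  have mono m n : (N <= n)%N -> (n <= m)%N ->
      (norm2 nu (fun x => tf mu s m f x - tf mu s n f x)%R < e%:E)%E.
    move=> Nn nm; rewrite -(tf_truncate _ nm).
    have ft2 := L2_truncate n f2.
    under eq_fun do rewrite -tfB//.
    rewrite (le_lt_trans (ctr m (L2B f2 ft2)))//.
    rewrite (le_lt_trans (norm2_truncate mu m _))//; first by have [] := L2B f2 ft2.
    by rewrite norm2BC; exact: NH.
  exists N => m n Nm Nn; have [nm|/ltnW mn] := leqP n m; first exact: mono.
  by rewrite norm2BC; exact: mono.
by exists g; split.
Qed.

Lemma is_ft_uniq f g h : L2 mu f -> is_ft f g -> is_ft f h ->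
  {ae nu, forall x, g x = h x}.
Proof.
move=> f2 [[mg _] fg] [[mh _] fh]; apply: L2_cvg_uniq fg fh => // n.
by have [] := tf_L2 n f2.
Qed.

Lemma is_ft_ae f f' g g' : L2 mu f -> L2 mu f' -> cmeasurable g' ->
  {ae mu, forall x, f x = f' x} -> {ae nu, forall x, g x = g' x} ->
  is_ft f g -> is_ft f' g'.
Proof.
move=> [mf f2] [mf' f2'] mg' ff' gg' [[mg g2] fg]; split.
  by split => //; rewrite -(eq_norm2 mg mg' gg').
have mt (k : R -> R[i]) : cmeasurable k -> forall n, cmeasurable (tf mu s n k).
  by move=> mk n; exact: cmeasurable_tf.
rewrite /L2_cvg (_ : (fun n => _) = (fun n => norm2 nu (fun x => tf mu s n f x - g x)%R))//.
apply/funext => n; apply: eq_norm2; [by apply: cmeasurableB => //; exact: mt..|].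
by apply: ae_imp gg' => x ->; rewrite (tf_ae_eq n x mf mf' ff').
Qed.

Lemma is_ftB f f' g g' : L2 mu f -> L2 mu f' -> is_ft f g -> is_ft f' g' ->
  is_ft (fun x => f x - f' x) (fun x => g x - g' x).
Proof.
move=> f2 f2' [g2 fg] [g2' fg']; split; first exact: L2B.
have [mg _] := g2; have [mg' _] := g2'.
apply/cvge0P => [n|e e0]; first exact: norm2_ge0.
have e2 : 0 < e / 2 by rewrite divr_gt0.
have /cvge0P A := fg; have {}A := A (fun=> norm2_ge0 _ _) _ e2.
have /cvge0P B := fg'; have {}B := B (fun=> norm2_ge0 _ _) _ e2.
near=> n.
apply: (@le_lt_trans _ _ (norm2 nu (fun x => tf mu s n f x - g x)%R + norm2 nu (fun x => tf mu s n f' x - g' x)%R)%E).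
  have [mf _] := tf_L2 n f2; have [mf' _] := tf_L2 n f2'.
  apply: (le_trans _ (norm2B nu (cmeasurableB mf mg) (cmeasurableB mf' mg'))).
  rewrite le_eqVlt; apply/orP; left; apply/eqP.
  by apply: eq_norm2_normc => x; rewrite tfB//; congr normc; ring.
by rewrite (splitr e) EFinD; apply: lteD; near: n.
Unshelve. all: by end_near. Qed.

Lemma is_ft_le f g : L2 mu f -> is_ft f g -> (norm2 nu g <= norm2 mu f)%E.
Proof.
move=> f2 [[mg _] fg]; rewrite (nrmE f2); apply: L2_cvg_le fg _ => //.
  by move=> n; have [] := tf_L2 n f2.
apply: nearW => n; rewrite -nrmE// (le_trans (ctr n f2))// norm2_truncate//.
by have [] := f2.
Qed.

End FourierExtension.

(** The truncated operators are adjoint to each other, and both sides converge. *)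
Lemma is_ft_adjoint {R : realType} (mu nu : {measure set (measurableTypeR R) -> \bar R})
    (s : R) f F g G : locally_finite mu -> locally_finite nu ->
  contracts mu nu s -> contracts nu mu (- s) -> L2 mu f -> L2 nu g ->
  is_ft mu nu s f F -> is_ft nu mu (- s) g G -> ip nu F g = ip mu f G.
Proof.
move=> lmu lnu c1 c2 f2 g2 [F2 fF] [G2 gG].
have A : ip nu (tf mu s n f) (truncate n g) @[n --> \oo] --> ip nu F g.
  apply: L2_cvg_ip => //; [by move=> n; exact: tf_L2|by move=> n; exact: L2_truncate|].
  exact: truncate_cvg.
have B : ip mu (truncate n f) (tf nu (- s) n g) @[n --> \oo] --> ip mu f G.
  apply: L2_cvg_ip => //; [by move=> n; exact: L2_truncate|by move=> n; exact: tf_L2|].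
  exact: truncate_cvg.
move: A; under eq_fun do rewrite tf_adjoint//.
by move=> A; have := cvg_unique _ A B; apply.
Qed.

(** * Quadratic forms of integral operators, and integrals by primitives *)

Section KernelForm.
Context {R : realType}.
Implicit Types (mu nu : {measure set (measurableTypeR R) -> \bar R}) (f g h : R -> R[i]).

Lemma Im_ReNi (z : R[i]) : Im z = Re (z * (- 'i)).
Proof. by rewrite !ReImE /= oppr0 mulr0 mulrN1 sub0r opprK. Qed.

Lemma cintegralZ mu f (z : R[i]) : L1 mu f ->
  cintegral mu setT (fun x => f x * z) = cintegral mu setT f * z.
Proof.
move=> f1; apply: complex_eqP.
  by rewrite Re_cintegralM.
rewrite [RHS]Im_ReNi -mulrA Re_cintegralM//=.
by apply: eq_Rintegral => x _; rewrite Im_ReNi mulrA.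
Qed.

Lemma kernel_form mu nu (s : R) (w : R -> R) f h :
  locally_finite mu -> locally_finite nu -> L1 nu (fun xi => (w xi)%:C) ->
  L1 mu f -> L1 mu h ->
  \int[nu]_xi (w xi * Re (tfun mu s f xi * (tfun mu s h xi)^*)) =
  \int[mu]_x \int[mu]_y Re (f x * tfun nu s (fun xi => (w xi)%:C) (x - y) * (h y)^*).
Proof.
move=> lmu lnu w1 f1 h1.
have mh : cmeasurable (tfun mu s h) by apply: cmeasurable_tfun => //; have [] := h1.
have wh1 : L1 nu (fun xi => (w xi)%:C * tfun mu s h xi).
  apply: (L1M w1 mh) => xi.
  rewrite (le_trans (normc_cintegral_le (L1_cis s xi h1)))//.
  by under eq_integral do rewrite normc_M normc_cis mulr1.
transitivity (\int[nu]_xi Re (tfun mu s f xi * ((w xi)%:C * tfun mu s h xi)^*)).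
  by apply: eq_Rintegral => xi _; rewrite !ReImE; ring.
rewrite tfun_adjoint//; apply: eq_Rintegral => x _.
rewrite Re_mulJC Re_cintegralM; last exact: L1_cis.
pose g xi := (w xi)%:C * cis (s * (xi * x)).
have g1 : L1 nu g by exact: L1_cis.
have gf1 : L1 nu (fun xi => g xi * f x).
  apply: (@L1M _ nu _ (fun=> f x) (normc (f x))) => //; exact: cmeasurable_cst.
transitivity (\int[nu]_xi Re (tfun mu s h xi * (g xi * f x)^*)).
  apply: eq_Rintegral => xi _; rewrite /g mulNr cisN !ReImE /=; ring.
rewrite tfun_adjoint//; apply: eq_Rintegral => y _.
rewrite [LHS]Re_mulJC; congr (Re (_ * _)); rewrite [RHS]mulrC -cintegralZ; last exact: L1_cis.
rewrite /tfun; congr cintegral; apply/funext => xi.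
have -> : s * (xi * (x - y)) = s * (xi * x) + - s * (xi * y) by ring.
by rewrite cisD /g; ring.
Qed.

End KernelForm.

Section FTC.
Context {R : realType}.

Lemma FTC_everywhere (F f : R -> R) (a b : R) : a <= b ->
  (forall x : R, is_derive x (1 : R) F (f x)) -> continuous f ->
  (\int[lebesgue_measure]_(x in `[a, b]) (f x)%:E = (F b - F a)%:E)%E.
Proof.
rewrite le_eqVlt => /orP[/eqP <-|ab] dF cf.
  by rewrite set_itv1 integral_set1 subrr.
have cF : continuous F.
  move=> x; apply: differentiable_continuous; apply/derivable1_diffP.
  exact: (@ex_derive _ _ _ _ _ _ _ (dF x)).
rewrite (@continuous_FTC2 _ _ F)//.
- exact: continuous_subspaceT.
- split.
  + by move=> x _; exact: (@ex_derive _ _ _ _ _ _ _ (dF x)).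
  + by apply: cvg_at_right_filter; exact: cF.
  + by apply: cvg_at_left_filter; exact: cF.
- by move=> x _; rewrite derive1E; exact: (@derive_val _ _ _ _ _ _ _ (dF x)).
Qed.

Lemma FTC_everywhere_y (F f : R -> R) (a l : R) :
  (forall x, a <= x -> 0 <= f x) ->
  (forall x : R, is_derive x (1 : R) F (f x)) -> continuous f -> F x @[x --> +oo] --> l ->
  (\int[lebesgue_measure]_(x in `[a, +oo[) (f x)%:E = (l - F a)%:E)%E.
Proof.
move=> f0 dF cf Fl.
have cF : continuous F.
  move=> x; apply: differentiable_continuous; apply/derivable1_diffP.
  exact: (@ex_derive _ _ _ _ _ _ _ (dF x)).
rewrite (@ge0_continuous_FTC2y _ _ F _ l)//.
- exact: continuous_subspaceT.
- by apply: cvg_at_right_filter; exact: cF.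
- by move=> x _; rewrite derive1E; exact: (@derive_val _ _ _ _ _ _ _ (dF x)).
Qed.

End FTC.

Section LebesgueInvariance.
Context {R : realType}.
Notation leb := (@lebesgue_measure R).

Lemma lebesgue_measureD (a : R) (A : set R) : measurable A ->
  pushforward leb (fun x : measurableTypeR R => x + a : measurableTypeR R) A = leb A.
Proof.
have ma : measurable_fun [set: measurableTypeR R]
  (fun x : measurableTypeR R => x + a : measurableTypeR R) by exact: measurable_funD.
move=> mA; apply/esym/lebesgue_measure_unique => //= _ [[c d]] _ <-.
rewrite /pushforward (_ : _ @^-1` _ = `](c - a), (d - a)]%classic); last first.
  by apply/seteqP; split => x /=; rewrite !in_itv/= ltrBlDr lerBrDr.
by rewrite /= !lebesgue_measure_itv/= !lte_fin ltrD2r -!EFinD; case: ifP => // _; congr (_%:E); ring.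
Qed.

Lemma ge0_integral_translation (a : R) (f : R -> \bar R) (A : set R) :
  measurable A -> measurable_fun [set: measurableTypeR R] (f : measurableTypeR R -> \bar R) ->
  (forall x, 0 <= f x)%E ->
  (\int[leb]_(x in [set x | A (x + a)%R]) f (x + a)%R = \int[leb]_(x in A) f x)%E.
Proof.
have ma : measurable_fun [set: measurableTypeR R]
  (fun x : measurableTypeR R => x + a : measurableTypeR R) by exact: measurable_funD.
move=> mA mf f0.
rewrite -(@ge0_integral_pushforward _ _ _ _ _ _ ma leb A f)//; last exact: measurable_funS mf.
by apply: eq_measure_integral => B mB _; exact: lebesgue_measureD.
Qed.

Lemma Rintegral_lebesgue_odd (f : R -> R) :
  measurable_fun [set: measurableTypeR R] (f : measurableTypeR R -> R) ->
  leb.-integrable setT (EFin \o f) -> (forall x, f (- x) = - f x) ->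
  \int[leb]_x f x = 0.
Proof.
move=> mf fi fN.
have E : (\int[leb]_x (f x)%:E = \int[leb]_x (f (- x))%:E)%E.
  have mN : measurable_fun [set: measurableTypeR R]
    (-%R : measurableTypeR R -> measurableTypeR R).
    by apply: continuous_measurable_fun; exact: opp_continuous.
  transitivity (\int[pushforward leb (-%R : measurableTypeR R -> measurableTypeR R)]_x (f x)%:E)%E.
    by apply: eq_measure_integral => A mA _; apply/esym; exact: lebesgue_measureN.
  rewrite (integral_pushforward mN)//; first exact/measurable_EFinP.
  rewrite preimage_setT; apply: (@eq_integrable _ _ _ leb _ measurableT (-%E \o (EFin \o f))).
    by move=> x _ /=; rewrite fN EFinN.
  exact: integrableN.
have : \int[leb]_x f x = - \int[leb]_x f x.
  rewrite {1}/Rintegral E -[RHS]mulN1r -RintegralZl//.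
  by congr fine; apply: eq_integral => x _; rewrite fN mulN1r.
by move/eqP; rewrite -addr_eq0 -mulr2n mulrn_eq0/= => /eqP.
Qed.

End LebesgueInvariance.

(** * Abel weights and the Poisson kernel *)

Section PoissonKernel.
Context {R : realType}.
Notation leb := (@lebesgue_measure R).
Implicit Types d z : R.

Definition abel_weight d (xi : R) : R := expR (- (d * `|xi|)).

Definition poisson d z : R := 2 * d / (d ^+ 2 + z ^+ 2).

Lemma poisson_den_gt0 d z : 0 < d -> 0 < d ^+ 2 + z ^+ 2.
Proof. by move=> d0; rewrite ltr_wpDr ?sqr_ge0// exprn_gt0. Qed.

Lemma poisson_ge0 d z : 0 < d -> 0 <= poisson d z.
Proof.
by move=> d0; rewrite divr_ge0 ?mulr_ge0 ?(ltW d0)// ltW// poisson_den_gt0.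
Qed.

Lemma continuous_abel_weight d : continuous (abel_weight d).
Proof.
move=> x; apply: (@continuous_comp _ _ _ (fun x : R => - (d * `|x|)) expR); last exact: continuous_expR.
apply: continuousN; apply: continuousM; first exact: cst_continuous.
exact: norm_continuous.
Qed.

Lemma measurable_abel_weight d :
  measurable_fun [set: measurableTypeR R] (abel_weight d : measurableTypeR R -> R).
Proof. by apply: continuous_measurable_fun; exact: continuous_abel_weight. Qed.

Lemma abel_weight_ge0 d xi : 0 <= abel_weight d xi.
Proof. exact: expR_ge0. Qed.

Lemma abel_weight_le1 d xi : 0 < d -> abel_weight d xi <= 1.
Proof.
by move=> d0; rewrite -expR0 ler_expR oppr_le0 mulr_ge0// ltW.
Qed.

Lemma continuous_cosM z : continuous (fun x : R => cos (z * x)).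
Proof.
move=> x; apply: (@continuous_comp _ _ _ (fun x : R => z * x) cos); last exact: continuous_cos.
by apply: continuousM; [exact: cst_continuous|exact: cvg_id].
Qed.

Lemma continuous_sinM z : continuous (fun x : R => sin (z * x)).
Proof.
move=> x; apply: (@continuous_comp _ _ _ (fun x : R => z * x) sin); last exact: continuous_sin.
by apply: continuousM; [exact: cst_continuous|exact: cvg_id].
Qed.

Lemma cvg_expRNy d : 0 < d -> expR (- (d * x)) @[x --> +oo] --> (0 : R).
Proof.
move=> d0; rewrite (_ : (fun x => expR (- (d * x))) = (fun z => expR (- z)) \o (fun z => d * z))//.
apply: (@cvg_comp _ _ _ _ _ _ (pinfty_nbhs R)); last exact: cvgr_expR.
exact: gt0_cvgMry.
Qed.

Let antideriv d z (x : R) :=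
  expR (- (d * x)) * (- d^-1 + (z * sin (z * x) - d * cos (z * x)) / (d ^+ 2 + z ^+ 2)).

Let is_derive_antideriv d z (x : R) : 0 < d ->
  is_derive x (1 : R) (antideriv d z) (expR (- (d * x)) * (1 + cos (z * x))).
Proof.
move=> d0; rewrite /antideriv; apply: is_derive_eq.
rewrite /GRing.scale /=.
have den := lt0r_neq0 (poisson_den_gt0 z d0); have dn := lt0r_neq0 d0.
by field; rewrite dn den.
Qed.

Let cvg_antideriv d z : 0 < d -> antideriv d z x @[x --> +oo] --> (0 : R).
Proof.
move=> d0; apply: norm_cvg0.
pose C := d^-1 + (`|z| + d) / (d ^+ 2 + z ^+ 2).
have C_cvg : expR (- (d * x)) * C @[x --> +oo] --> (0 : R).
  by rewrite -[X in _ --> X](mul0r C); apply: cvgMl; exact: cvg_expRNy.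
apply: (squeeze_cvgr _ _ C_cvg); last exact: cvg_cst.
apply: nearW => x; rewrite normr_ge0/= normrM ger0_norm ?expR_ge0// ler_wpM2l ?expR_ge0//.
rewrite (le_trans (ler_normD _ _))// normrN gtr0_norm ?invr_gt0// lerD2l.
rewrite normrM normfV (gtr0_norm (poisson_den_gt0 z d0)) ler_wpM2r ?invr_ge0 ?(ltW (poisson_den_gt0 z d0))//.
rewrite (le_trans (ler_normB _ _))// !normrM (gtr0_norm d0).
have sl : `|sin (z * x)| <= 1 by rewrite ler_norml sin_geN1 sin_le1.
have cl : `|cos (z * x)| <= 1 by rewrite ler_norml cos_geN1 cos_le1.
by rewrite lerD// ?ler_piMr// ltW.
Qed.

Lemma integral_abel_weight_cos1 d z : 0 < d ->
  (\int[leb]_xi (abel_weight d xi * (1 + cos (z * xi)))%:E =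
   (2 / d + poisson d z)%:E)%E.
Proof.
move=> d0.
have c0 (x : R) : 0 <= 1 + cos (z * x) by rewrite -[1]opprK addrC subr_ge0 cos_geN1.
have cf : continuous (fun x : R => expR (- (d * x)) * (1 + cos (z * x))).
  move=> x; apply: cvgM.
      apply: (@continuous_comp _ _ _ (fun x : R => - (d * x)) expR); last exact: continuous_expR.
      by apply: cvgN; apply: cvgM; [exact: cvg_cst|exact: cvg_id].
    by apply: cvgD; [exact: cvg_cst|exact: continuous_cosM].
rewrite (@ge0_symfun_integralT _ (fun xi => abel_weight d xi * (1 + cos (z * xi)))).
- rewrite (_ : [set x : R | 0 <= x] = `[0, +oo[%classic); last first.
    by apply/seteqP; split => x /=; rewrite in_itv/= andbT.
  under eq_integral => x.
    rewrite inE/= in_itv/= andbT => x0; rewrite /abel_weight (ger0_norm x0); over.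
  rewrite -[X in (2 * X)%E](_ : (0 - antideriv d z 0)%:E = _).
  + rewrite /antideriv !mulr0 oppr0 expR0 sin0 cos0 mulr0 mul1r mulr1 sub0r -EFinM.
    rewrite /poisson; congr (_%:E).
    have den := lt0r_neq0 (poisson_den_gt0 z d0); have dn := lt0r_neq0 d0.
    by field; rewrite dn den.
  apply/esym; apply: (@FTC_everywhere_y _ (antideriv d z)
    (fun x : R => expR (- (d * x)) * (1 + cos (z * x)))).
  + by move=> x _; rewrite mulr_ge0// expR_ge0.
  + by move=> x; exact: is_derive_antideriv.
  + exact: cf.
  + exact: cvg_antideriv.
- by move=> x; rewrite mulr_ge0// abel_weight_ge0.
- move=> x; apply: cvgM; first exact: continuous_abel_weight.
  by apply: cvgD; [exact: cvg_cst|exact: continuous_cosM].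
- by move=> x /=; rewrite /abel_weight normrN mulrN cosN.
Qed.

Lemma integral_abel_weight d : 0 < d -> (\int[leb]_xi (abel_weight d xi)%:E = (2 / d)%:E)%E.
Proof.
move=> d0; have := integral_abel_weight_cos1 0 d0.
under eq_integral do rewrite mul0r cos0 mulrC EFinM.
rewrite ge0_integralZl//; last 2 first.
  by apply/measurable_EFinP; exact: measurable_abel_weight.
  by move=> x _; rewrite lee_fin abel_weight_ge0.
have -> : 2 / d + poisson d 0 = (1 + 1) * (2 / d).
  by rewrite /poisson expr0n/= addr0; field; rewrite lt0r_neq0.
have t0 : (0 < (1 + 1)%:E :> \bar R)%E by rewrite lte_fin.
case: (integral _ _ _) => [r||]; last 2 first.
- by rewrite gt0_muley.
- by rewrite gt0_muleNy.
by rewrite -EFinM => -[rE]; congr (_%:E); lra.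
Qed.

Lemma L1_abel_weight d : 0 < d -> L1 leb (fun xi => (abel_weight d xi)%:C).
Proof.
move=> d0; split; first by apply: cmeasurableC; exact: measurable_abel_weight.
under eq_integral do rewrite normc_C ger0_norm ?abel_weight_ge0//.
by rewrite integral_abel_weight// ltry.
Qed.

Lemma tfun_abel_weight (s : R) d y : 0 < d ->
  tfun leb s (fun xi => (abel_weight d xi)%:C) y = (poisson d (s * y))%:C.
Proof.
move=> d0; have w1 := L1_abel_weight d0; have wc1 := L1_cis s y w1.
have phase (xi : R) : s * (xi * y) = s * y * xi by ring.
have iw : leb.-integrable setT (fun xi => (abel_weight d xi)%:E).
  exact: (L1_Re w1).
have iwc : leb.-integrable setT (fun xi => (abel_weight d xi * cos (s * y * xi))%:E).
  rewrite -[X in _.-integrable _ X](_ : (fun xi => (Re ((abel_weight d xi)%:C * cis (s * (xi * y))))%:E) = _); first exact: L1_Re wc1.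
  by apply/funext => xi; rewrite !ReImE /= phase mul0r subr0.
have iws : leb.-integrable setT (fun xi => (abel_weight d xi * sin (s * y * xi))%:E).
  rewrite -[X in _.-integrable _ X](_ : (fun xi => (Im ((abel_weight d xi)%:C * cis (s * (xi * y))))%:E) = _); first exact: L1_Im wc1.
  by apply/funext => xi; rewrite !ReImE /= phase mul0r addr0.
apply: complex_eqP; rewrite /tfun /cintegral /=.
  transitivity (\int[leb]_xi (abel_weight d xi * cos (s * y * xi))).
    by apply: eq_Rintegral => xi _; rewrite mul0r subr0 phase.
  have E : \int[leb]_xi (abel_weight d xi * (1 + cos (s * y * xi))) = 2 / d + poisson d (s * y).
    by rewrite /Rintegral integral_abel_weight_cos1.
  move: E; under eq_Rintegral do rewrite mulrDr mulr1.
  rewrite RintegralD// (_ : \int[leb]_xi abel_weight d xi = 2 / d); last first.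
    by rewrite /Rintegral integral_abel_weight.
  by move/addrI.
transitivity (\int[leb]_xi (abel_weight d xi * sin (s * y * xi))).
  by apply: eq_Rintegral => xi _; rewrite mul0r addr0 phase.
apply: Rintegral_lebesgue_odd => //.
  by have /integrableP[/measurable_EFinP] := iws.
by move=> x; rewrite /abel_weight normrN mulrN sinN mulrN.
Qed.

Lemma integral_poisson d (a b y : R) : 0 < d -> a <= b ->
  (\int[leb]_(x in `[a, b]) (poisson d (x - y))%:E =
   (2 * atan ((b - y) / d) - 2 * atan ((a - y) / d))%:E)%E.
Proof.
move=> d0 ab; apply: (@FTC_everywhere _ (fun x => 2 * atan ((x - y) / d))) => //.
- move=> x; apply: is_derive_eq.
  rewrite /GRing.scale /=.
  have den := lt0r_neq0 (poisson_den_gt0 (x - y) d0); have dn := lt0r_neq0 d0.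
  rewrite /poisson; field.
  by rewrite den dn.
- move=> x; apply: cvgM; first exact: cvg_cst.
  apply: cvgV; first exact/lt0r_neq0/poisson_den_gt0.
  apply: cvgD; first exact: cvg_cst.
  apply: (@cvg_comp _ _ _ (fun x : R => x - y) (fun r : R => r ^+ 2)).
    by apply: cvgB; [exact: cvg_id|exact: cvg_cst].
  exact: exprn_continuous.
Qed.

Lemma integral_poisson_le d (a b y : R) : 0 < d -> a <= b ->
  (\int[leb]_(x in `[a, b]) (poisson d (x - y))%:E <= (2 * pi)%:E)%E.
Proof.
move=> d0 ab; rewrite integral_poisson// lee_fin.
have := atan_ltpi2 ((b - y) / d); have := atan_gtNpi2 ((a - y) / d); lra.
Qed.

End PoissonKernel.

(** * The Schur test *)

Section TonelliLocallyFinite.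
Context {R : realType}.
Implicit Types (mu nu : {measure set (measurableTypeR R) -> \bar R}) (k : R * R -> \bar R).

Lemma measurable_tonelli_F nu k : locally_finite nu ->
  measurable_fun [set: measurableTypeR R * measurableTypeR R]
    (k : measurableTypeR R * measurableTypeR R -> \bar R) ->
  (forall p, 0 <= k p)%E ->
  measurable_fun [set: measurableTypeR R]
    (fun x : measurableTypeR R => \int[nu]_y k (x, y))%E.
Proof.
by move=> /sigma_finite_measureP[m ->] mk k0; exact: measurable_fun_fubini_tonelli_F.
Qed.

Lemma measurable_tonelli_G mu k : locally_finite mu ->
  measurable_fun [set: measurableTypeR R * measurableTypeR R]
    (k : measurableTypeR R * measurableTypeR R -> \bar R) ->
  (forall p, 0 <= k p)%E ->
  measurable_fun [set: measurableTypeR R]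
    (fun y : measurableTypeR R => \int[mu]_x k (x, y))%E.
Proof.
by move=> /sigma_finite_measureP[m ->] mk k0; exact: measurable_fun_fubini_tonelli_G.
Qed.

Lemma tonelli mu nu k : locally_finite mu -> locally_finite nu ->
  measurable_fun [set: measurableTypeR R * measurableTypeR R]
    (k : measurableTypeR R * measurableTypeR R -> \bar R) ->
  (forall p, 0 <= k p)%E ->
  (\int[mu]_x \int[nu]_y k (x, y) = \int[nu]_y \int[mu]_x k (x, y))%E.
Proof.
move=> /sigma_finite_measureP[m ->] /sigma_finite_measureP[n ->] mk k0.
exact: fubini_tonelli.
Qed.

End TonelliLocallyFinite.

Section LineContraction.
Context {R : realType}.
Notation leb := (@lebesgue_measure R).
Implicit Types (f g h : R -> R[i]).

Lemma lebesgue_locally_finite : locally_finite leb.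
Proof.
move=> n; rewrite -[X in (X < _)%E]/(lebesgue_measure `[- n%:R, n%:R]%classic).
by rewrite lebesgue_measure_itv/=; case: ifP => _; rewrite -?EFinB ltry.
Qed.

Lemma poisson_even (d x y : R) : poisson d (x - y) = poisson d (y - x).
Proof. by rewrite /poisson -(opprB y x) sqrrN. Qed.

Lemma measurable_poisson (d y : R) : 0 < d ->
  measurable_fun [set: measurableTypeR R] (fun x : measurableTypeR R => poisson d (x - y) : R).
Proof.
move=> d0; apply: continuous_measurable_fun => x.
apply: cvgM; first exact: cvg_cst.
apply: cvgV; first exact/lt0r_neq0/poisson_den_gt0.
apply: cvgD; first exact: cvg_cst.
apply: (@cvg_comp _ _ _ (fun x : R => x - y) (fun r : R => r ^+ 2)).
  by apply: cvgB; [exact: cvg_id|exact: cvg_cst].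
exact: exprn_continuous.
Qed.

Lemma measurable_poisson2 (d : R) : 0 < d ->
  measurable_fun [set: measurableTypeR R * measurableTypeR R]
    (fun p : measurableTypeR R * measurableTypeR R => poisson d (p.1 - p.2) : R).
Proof.
move=> d0; apply: (measurableT_comp (f := fun x : measurableTypeR R => poisson d x : R)).
  by have := measurable_poisson 0 d0; under eq_fun do rewrite subr0.
apply: measurable_funB; first exact: (@measurable_fst_comp _ id).
exact: (@measurable_snd_comp _ id).
Qed.

(** The Poisson kernel is the transform of the Abel weight, so this is Fubini. *)
Lemma line_form (s d : R) f h : s ^+ 2 = 1 -> 0 < d -> L1 leb f -> L1 leb h ->
  \int[leb]_xi (abel_weight d xi * Re (tfun leb s f xi * (tfun leb s h xi)^*)) =
  \int[leb]_x \int[leb]_y (Re (f x * (h y)^*) * poisson d (x - y)).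
Proof.
move=> s2 d0 f1 h1; rewrite (kernel_form s lebesgue_locally_finite lebesgue_locally_finite (L1_abel_weight d0) f1 h1).
apply: eq_Rintegral => x _; apply: eq_Rintegral => y _.
rewrite tfun_abel_weight// (_ : poisson d (s * (x - y)) = poisson d (x - y)); last first.
  by rewrite /poisson exprMn s2 mul1r.
by rewrite !ReImE; ring.
Qed.

(** Schur's test: the Poisson kernel has mass at most 2 pi in each variable. *)
Lemma schur_poisson (d : R) n (f1 : R -> R[i]) : 0 < d -> cmeasurable f1 ->
  (forall x, ~ ball0 n x -> f1 x = 0) ->
  (\int[leb]_x \int[leb]_y (normc (f1 x) * normc (f1 y) * poisson d (x - y))%:E
   <= (2 * pi)%:E * energy leb f1)%E.
Proof.
move=> d0 mf1 supp.
have lf := lebesgue_locally_finite.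
pose A (x y : R) : \bar R := ((normc (f1 x) ^+ 2 / 2) * (\1_(ball0 n) y * poisson d (y - x)))%:E.
have A0 x y : (0 <= A x y)%E.
  rewrite lee_fin; apply: mulr_ge0; first by rewrite divr_ge0 ?sqr_ge0.
  by apply: mulr_ge0; [rewrite indicE|exact: poisson_ge0].
have mD : measurable_fun [set: measurableTypeR R] (\1_(ball0 n) : measurableTypeR R -> R).
  by apply: measurable_indic; exact: measurable_ball0.
have mf1sq : measurable_fun [set: measurableTypeR R]
    (fun x : measurableTypeR R => normc (f1 x) ^+ 2 / 2 : R).
  by apply: measurable_funM => //; apply: measurable_funX; exact: measurable_normc.
have mA : measurable_fun [set: measurableTypeR R * measurableTypeR R]
    (fun p : measurableTypeR R * measurableTypeR R => A p.1 p.2).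
  apply/measurable_EFinP; apply: measurable_funM; first exact: measurable_fst_comp mf1sq.
  apply: measurable_funM; first exact: measurable_snd_comp mD.
  by have := measurable_poisson2 d0; under eq_fun do rewrite poisson_even.
have mAx x : measurable_fun [set: measurableTypeR R] (A x : measurableTypeR R -> \bar R).
  apply/measurable_EFinP; apply: measurable_funM => //; apply: measurable_funM => //.
  exact: measurable_poisson.
have mAy y : measurable_fun [set: measurableTypeR R]
    (fun x : measurableTypeR R => A x y : \bar R).
  apply/measurable_EFinP; apply: measurable_funM => //; apply: measurable_funM => //.
  by under eq_fun do rewrite poisson_even; exact: measurable_poisson.
have inner x : (\int[leb]_y A x y <= ((normc (f1 x) ^+ 2) * pi)%:E)%E.
  rewrite /A; under eq_integral do rewrite EFinM.
  rewrite ge0_integralZl//; last 3 first.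
  - apply/measurable_EFinP; apply: measurable_funM => //; exact: measurable_poisson.
  - by move=> y _; rewrite lee_fin mulr_ge0// poisson_ge0.
  - by rewrite lee_fin divr_ge0// sqr_ge0.
  have -> : (\int[leb]_y (\1_(ball0 n) y * poisson d (y - x))%:E =
             \int[leb]_(y in ball0 n) (poisson d (y - x))%:E)%E.
    rewrite [RHS]integral_mkcond; apply: eq_integral => y _.
    rewrite patchE indicE; case: ifP => _; first by rewrite mul1r.
    by rewrite mul0r.
  have nn : (- n%:R <= n%:R :> R) by rewrite (@le_trans _ _ 0)// oppr_le0.
  apply: (@le_trans _ _ ((normc (f1 x) ^+ 2 / 2)%:E * (2 * pi)%:E)%E).
    apply: lee_wpmul2l; first by rewrite lee_fin divr_ge0// sqr_ge0.
    exact: integral_poisson_le.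
  rewrite -EFinM lee_fin; lra.
have AA : (\int[leb]_x \int[leb]_y A x y <= pi%:E * energy leb f1)%E.
  apply: (@le_trans _ _ (\int[leb]_x (pi%:E * (normc (f1 x) ^+ 2)%:E))%E).
    apply: ge0_le_integral => //.
    - by move=> x _; exact: integral_ge0.
    - exact: (measurable_tonelli_F lf mA (fun p => A0 p.1 p.2)).
    - by apply: emeasurable_funM => //; exact: measurable_sqr_normc.
    - by move=> x _; rewrite -EFinM mulrC.
  rewrite ge0_integralZl//.
  - exact: measurable_sqr_normc.
  - by move=> x _; rewrite lee_fin sqr_ge0.
  - by rewrite lee_fin pi_ge0.
have AAC : (\int[leb]_x \int[leb]_y A y x = \int[leb]_x \int[leb]_y A x y)%E.
  by have := tonelli lf lf mA (fun p => A0 p.1 p.2) => /= ->.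
have mAA : measurable_fun [set: measurableTypeR R]
   (fun x : measurableTypeR R => \int[leb]_y A x y)%E.
  exact: (measurable_tonelli_F lf mA (fun p => A0 p.1 p.2)).
have mAA' : measurable_fun [set: measurableTypeR R]
   (fun x : measurableTypeR R => \int[leb]_y A y x)%E.
  exact: (measurable_tonelli_G lf mA (fun p => A0 p.1 p.2)).
have mB : measurable_fun [set: measurableTypeR R * measurableTypeR R]
    (fun p : measurableTypeR R * measurableTypeR R =>
       (normc (f1 p.1) * normc (f1 p.2) * poisson d (p.1 - p.2))%:E).
  have mn := measurable_normc mf1.
  apply/measurable_EFinP; apply: measurable_funM; last exact: measurable_poisson2.
  by apply: measurable_funM; [exact: measurable_fst_comp mn|exact: measurable_snd_comp mn].
have B0 (p : R * R) : (0 <= (normc (f1 p.1) * normc (f1 p.2) * poisson d (p.1 - p.2))%:E)%E.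
  rewrite lee_fin; apply: mulr_ge0; last exact: poisson_ge0.
  by apply: mulr_ge0; exact: normc_ge0.
apply: (@le_trans _ _ (\int[leb]_x ((\int[leb]_y A x y) + (\int[leb]_y A y x)))%E).
  apply: ge0_le_integral; first exact: measurableT.
  - by move=> x _; apply: integral_ge0 => y _; exact: (B0 (x, y)).
  - exact: (measurable_tonelli_F lf mB B0).
  - by apply: emeasurable_funD.
  - move=> x _; rewrite -(ge0_integralD leb measurableT (fun y _ => A0 x y) (mAx x) (fun y _ => A0 y x) (mAy x)).
    apply: ge0_le_integral; first exact: measurableT.
    + by move=> y _; exact: (B0 (x, y)).
    + by have := measurableT_comp mB (measurable_pair1 x).
    + by apply: emeasurable_funD.
    + move=> y _; rewrite -EFinD lee_fin poisson_even.
      have p0 := poisson_ge0 (y - x) d0.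
      rewrite !indicE.
      have f0 z : (z \in ball0 n) = false -> normc (f1 z) = 0.
        move=> /negP zD; rewrite supp ?Normc.normc0//.
        by move=> /mem_set.
      case yD : (y \in ball0 n); last first.
        by rewrite (f0 _ yD) mulr0 !mul0r mulr0 expr0n/= !mul0r addr0.
      case xD : (x \in ball0 n); last first.
        by rewrite (f0 _ xD) expr0n/= !mul0r mulr0 addr0.
      have := mulr_ge0 (sqr_ge0 (normc (f1 x) - normc (f1 y))) p0; rewrite /=; nra.
have iA0 x : (0 <= \int[leb]_y A x y)%E by exact: integral_ge0.
have iA0' x : (0 <= \int[leb]_y A y x)%E by exact: integral_ge0.
rewrite (ge0_integralD leb measurableT (fun x _ => iA0 x) mAA (fun x _ => iA0' x) mAA').
rewrite AAC; apply: (le_trans (leeD AA AA)).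
by rewrite -ge0_muleDl ?lee_fin ?pi_ge0// -EFinD mulr_natl mulr2n.
Qed.

End LineContraction.

(** * Boundedness of the Fourier transform on the line *)

Section LineTransform.
Context {R : realType}.
Notation leb := (@lebesgue_measure R).
Implicit Types (f g h : R -> R[i]).

Lemma abel_weight_sqr (d xi : R) : abel_weight d xi ^+ 2 = abel_weight (2 * d) xi.
Proof. by rewrite /abel_weight -expRM_natl; congr expR; ring. Qed.

Lemma cvg_abel_weight (xi : R) : abel_weight k.+1%:R^-1 xi @[k --> \oo] --> (1 : R).
Proof.
rewrite -[X in _ --> X](expR0 R); apply: continuous_cvg; first exact: continuous_expR.
rewrite -[X in _ --> X]oppr0; apply: cvgN; rewrite -[X in _ --> X](mul0r `|xi|).
by apply: cvgMl; exact: cvg_harmonic.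
Qed.

Lemma abse_fine_le (X : \bar R) : ((`|fine X|)%:E <= `|X|)%E.
Proof. by case: X => [r| |] /=; rewrite ?normr0 ?leey. Qed.

Lemma line_contraction_weighted (s d : R) n f : s ^+ 2 = 1 -> 0 < d -> L2 leb f ->
  (norm2 leb (fun xi => (abel_weight d xi)%:C * tf leb s n f xi)%R <=
   norm2 leb (truncate n f))%E.
Proof.
move=> s2 d0 f2; have lf := @lebesgue_locally_finite R.
have d2 : 0 < 2 * d by rewrite mulr_gt0.
set f1 := truncate n f; have f1L2 : L2 leb f1 by exact: L2_truncate.
have f1L1 : L1 leb f1 by exact: L1_truncate.
have [mf1 _] := f1L2; have [mf _] := f2.
pose K := normalization * (2 * fine (\int[leb]_x (normc (f1 x))%:E)).
have gK xi : normc (tf leb s n f xi) <= K by exact: tf_le.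
have mg : cmeasurable (tf leb s n f) by exact: cmeasurable_tf.
pose w := @abel_weight R (2 * d).
pose r xi := w xi * Re (tfun leb s f1 xi * (tfun leb s f1 xi)^*).
have mt : cmeasurable (tfun leb s f1) by exact: cmeasurable_tfun.
have rE xi : normc ((abel_weight d xi)%:C * tf leb s n f xi) ^+ 2 = normalization ^+ 2 * r xi.
  rewrite normc_M exprMn normc_C real_normK ?num_real// abel_weight_sqr tfE normc_M exprMn normc_C real_normK ?num_real//.
  by rewrite /r Re_mulJ /w; ring.
have w1 : L1 leb (fun xi => (w xi)%:C) by exact: L1_abel_weight.
have ri : leb.-integrable setT (fun xi => (r xi)%:E).
  pose B := 2 * fine (\int[leb]_x (normc (f1 x))%:E).
  have tB xi : normc (tfun leb s f1 xi) <= B.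
    rewrite (le_trans (normc_cintegral_le (L1_cis s xi f1L1)))//.
    by under eq_integral do rewrite normc_M normc_cis mulr1.
  have h1 : L1 leb (fun xi => (w xi)%:C * (tfun leb s f1 xi * (tfun leb s f1 xi)^*)).
    apply: (@L1M _ _ _ _ (B * B)) => //; first by apply: cmeasurableM => //; exact: cmeasurableJ.
    by move=> xi; rewrite normc_M normc_J ler_pM ?normc_ge0.
  have := L1_Re h1; congr (leb.-integrable _ _); apply/funext => xi.
  by rewrite /r !ReImE; congr (_%:E); ring.
have EE : energy leb (fun xi => (abel_weight d xi)%:C * tf leb s n f xi) =
    (normalization ^+ 2 * \int[leb]_xi r xi)%:E.
  rewrite /energy; under eq_integral do rewrite rE.
  rewrite -RintegralZl// /Rintegral fineK//.
  exact: (integrable_fin_num measurableT (integrableZl measurableT (normalization ^+ 2) ri)).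
have schur := schur_poisson d2 mf1 (fun x => @truncate_notin _ n f x).
pose phi x := \int[leb]_y (Re (f1 x * (f1 y)^*) * poisson (2 * d) (x - y)).
have mphi : measurable_fun [set: measurableTypeR R] (phi : measurableTypeR R -> R).
  pose k (p : R * R) := Re (f1 p.2 * (f1 p.1)^*) * poisson (2 * d) (p.2 - p.1).
  apply: (@measurable_Rintegral_param _ leb k) => //.
  have [mR mI] := mf1; have [mJR mJI] := cmeasurableJ mf1.
  rewrite /k; under eq_fun do rewrite Re_M.
  have := measurable_fst_comp mJR; have := measurable_fst_comp mJI.
  have := measurable_snd_comp mR; have := measurable_snd_comp mI.
  move=> sI sR fI fR; apply: measurable_funM; last first.
    by have := measurable_poisson2 d2; under eq_fun do rewrite poisson_even.
  by apply: measurable_funB; exact: measurable_funM.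
have phi_le x : ((`|phi x|)%:E <=
    \int[leb]_y (normc (f1 x) * normc (f1 y) * poisson (2 * d) (x - y))%:E)%E.
  have mk : measurable_fun [set: measurableTypeR R]
      (fun y : measurableTypeR R => Re (f1 x * (f1 y)^*) * poisson (2 * d) (x - y) : R).
    apply: measurable_funM; last first.
      by under eq_fun do rewrite poisson_even; exact: measurable_poisson.
    by apply: measurable_ReJ => //; exact: cmeasurable_cst.
  apply: (le_trans (abse_fine_le _)); apply: (le_trans (le_abse_integral _ measurableT _)).
    exact/measurable_EFinP.
  apply: ge0_le_integral; first exact: measurableT.
  - by move=> y _; rewrite lee_fin.
  - by apply/measurable_EFinP; apply: measurableT_comp.
  - apply/measurable_EFinP; apply: measurable_funM; last first.
      by under eq_fun do rewrite poisson_even; exact: measurable_poisson.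
    by apply: measurable_funM => //; exact: measurable_normc.
  - move=> y _; rewrite lee_fin normrM (ger0_norm (poisson_ge0 _ d2)).
    by rewrite ler_wpM2r ?poisson_ge0// Re_mulJ_le.
have m2 : measurable_fun [set: measurableTypeR R] (fun x : measurableTypeR R =>
    \int[leb]_y (normc (f1 x) * normc (f1 y) * poisson (2 * d) (x - y))%:E)%E.
  have mn := measurable_normc mf1.
  apply: (@measurable_tonelli_F _ leb (fun p => (normc (f1 p.1) * normc (f1 p.2) * poisson (2 * d) (p.1 - p.2))%:E)) => //.
    apply/measurable_EFinP; apply: measurable_funM; last exact: measurable_poisson2.
    by apply: measurable_funM; [exact: measurable_fst_comp mn|exact: measurable_snd_comp mn].
  by move=> p; rewrite lee_fin; apply: mulr_ge0; [apply: mulr_ge0; exact: normc_ge0|exact: poisson_ge0].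
have phi_int : (\int[leb]_x (`|phi x|)%:E <= (2 * pi)%:E * energy leb f1)%E.
  apply: le_trans schur; apply: ge0_le_integral; first exact: measurableT.
  - by move=> y _; rewrite lee_fin.
  - by apply/measurable_EFinP; apply: measurableT_comp.
  - exact: m2.
  - by move=> x _; exact: phi_le.
have iphi : leb.-integrable setT (EFin \o phi).
  apply/integrableP; split; first exact/measurable_EFinP.
  by rewrite (le_lt_trans phi_int)// sqr_nrm// -EFinM ltry.
apply: le_norm2_energy; rewrite EE sqr_nrm// lee_fin.
rewrite /r line_form// -/phi normalization_sqr ler_pdivrMl; last by rewrite mulr_gt0// pi_gt0.
rewrite (le_trans (ler_norm _))// (le_trans (le_normr_Rintegral measurableT iphi))//.
rewrite -lee_fin fineK; first by rewrite EFinM -sqr_nrm.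
rewrite ge0_fin_numE; last by apply: integral_ge0 => x _; rewrite lee_fin.
by rewrite (le_lt_trans phi_int)// sqr_nrm// -EFinM ltry.
Qed.

(** The Abel weights increase to 1 as their parameter tends to 0, so the bound on
    the weighted norm given by Schur's test passes to the limit. *)
Lemma line_contracts (s : R) : s ^+ 2 = 1 -> contracts leb leb s.
Proof.
move=> s2 n f f2; have lf := @lebesgue_locally_finite R.
have [mf _] := f2; have f12 := L2_truncate n f2.
have mg : cmeasurable (tf leb s n f) by exact: cmeasurable_tf.
have mw d : cmeasurable (fun xi => (@abel_weight R d xi)%:C * tf leb s n f xi).
  by apply: cmeasurableM => //; apply: cmeasurableC; exact: measurable_abel_weight.
rewrite (nrmE f12).
apply: (@fatou_norm2 _ leb (fun k xi => (abel_weight k.+1%:R^-1 xi)%:C * tf leb s n f xi)) => //.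
- apply: aeW => xi.
  have -> : (fun k => normc ((abel_weight k.+1%:R^-1 xi)%:C * tf leb s n f xi - tf leb s n f xi)) =
      (fun k => `|abel_weight k.+1%:R^-1 xi - 1| * normc (tf leb s n f xi)).
    apply/funext => k; rewrite -normc_C -normc_M; congr normc.
    by rewrite rmorphB/= mulrBl mul1r.
  rewrite -[X in _ --> X](mul0r (normc (tf leb s n f xi))); apply: cvgMl.
  apply/norm_cvg0P/subr_cvg0; exact: cvg_abel_weight.
- exact: nrm_ge0.
- apply: nearW => k; rewrite -nrmE//; apply: line_contraction_weighted => //.
Qed.

End LineTransform.

(** * Pairing with the indicator function of an interval *)

Section LineInversion.
Context {R : realType}.
Notation leb := (@lebesgue_measure R).
Implicit Types (f g h : R -> R[i]).

Lemma Re_CM (a : R) (x : R[i]) : Re (a%:C * x) = a * Re x.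
Proof. by rewrite Re_M Re_C Im_C mul0r subr0. Qed.

Definition window (a b : R) (z : R[i]) (x : R) : R[i] :=
  (\1_(`[a, b]%classic : set (measurableTypeR R)) x)%:C * z.

Lemma cmeasurable_window a b z : cmeasurable (window a b z).
Proof.
apply: cmeasurableM; last exact: cmeasurable_cst.
by apply: cmeasurableC; apply: measurable_indic.
Qed.

Lemma L2_window a b z : L2 leb (window a b z).
Proof.
split; first exact: cmeasurable_window.
have : (energy leb (window a b z) < +oo)%E.
  rewrite /energy (_ : (fun x => _) = (fun x => (normc z ^+ 2)%:E *
      (\1_(`[a, b]%classic : set (measurableTypeR R)) x)%:E)%E); last first.
    apply/funext => x; rewrite /window normc_M normc_C exprMn real_normK ?num_real//.
    by rewrite -EFinM mulrC indicE; case: (x \in _); rewrite ?expr1n ?expr0n.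
  rewrite ge0_integralZl//; last 2 first.
    by apply/measurable_EFinP; apply: measurable_indic.
    by rewrite lee_fin sqr_ge0.
  rewrite integral_indic// setIT lte_mul_pinfty ?lee_fin ?sqr_ge0//.
  rewrite -[X in (X < _)%E]/(lebesgue_measure `[a, b]%classic).
  by rewrite lebesgue_measure_itv/=; case: ifP => _; rewrite -?EFinB ltry.
rewrite energyE; case: (norm2 leb (window a b z)) (norm2_ge0 leb (window a b z)) => [r _ _|_|//].
  exact: ltry.
by rewrite mulyy.
Qed.

Lemma cvg_atan_harmonic (t : R) : 0 < t -> atan (t / k.+1%:R^-1) @[k --> \oo] --> pi / 2.
Proof.
move=> t0.
apply: (@cvg_comp _ _ _ (fun k : nat => t / k.+1%:R^-1) (@atan R) _ (pinfty_nbhs R)); last first.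
  exact: cvgy_atan.
apply/cvgryPge => A; near=> k; rewrite invrK -ler_pdivrMl//.
rewrite (le_trans (ler_norm _))// (@le_trans _ _ k%:R) ?ler_nat//.
by near: k; exact: nbhs_infty_ger.
Unshelve. all: by end_near. Qed.

Definition atan_jump (a b x : R) (k : nat) : R :=
  2 * atan ((b - x) / k.+1%:R^-1) - 2 * atan ((a - x) / k.+1%:R^-1).

Lemma cvg_atan_jump (a b x : R) : a <= b -> x != a -> x != b ->
  atan_jump a b x k @[k --> \oo] -->
    2 * pi * \1_(`[a, b]%classic : set (measurableTypeR R)) x.
Proof.
move=> ab xa xb; rewrite /atan_jump indicE.
have cvg_neg (t : R) : t < 0 -> atan (t / k.+1%:R^-1) @[k --> \oo] --> - (pi / 2).
  move=> t0; have -> : (fun k => atan (t / k.+1%:R^-1)) = (fun k => - atan (- t / k.+1%:R^-1)).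
    by apply/funext => k; rewrite mulNr atanN opprK.
  by apply: cvgN; apply: cvg_atan_harmonic; rewrite oppr_gt0.
have cvg2 (t l : R) : atan (t / k.+1%:R^-1) @[k --> \oo] --> l ->
    2 * atan (t / k.+1%:R^-1) @[k --> \oo] --> 2 * l.
  by move=> H; apply: cvgMr.
have [xla|xga] := ltP x a.
  rewrite memNset; last by rewrite /= in_itv/= => /andP[]; rewrite leNgt xla.
  rewrite mulr0 -[X in _ --> X](subrr (2 * (pi / 2))); apply: cvgB; apply: cvg2.
    by apply: cvg_atan_harmonic; rewrite subr_gt0 (lt_le_trans xla).
  by apply: cvg_atan_harmonic; rewrite subr_gt0.
have {}xga : a < x by rewrite lt_neqAle eq_sym xa.
have [xlb|xgb] := leP x b.
  have {}xlb : x < b by rewrite lt_neqAle xb.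
  rewrite mem_set; last by rewrite /= in_itv/= !ltW.
  rewrite (_ : 2 * pi * true%:R = 2 * (pi / 2) - 2 * (- (pi / 2))); last by rewrite /=; lra.
  apply: cvgB; apply: cvg2.
    by apply: cvg_atan_harmonic; rewrite subr_gt0.
  by apply: cvg_neg; rewrite subr_lt0.
rewrite memNset; last by rewrite /= in_itv/= => /andP[_]; rewrite leNgt xgb.
rewrite mulr0 -[X in _ --> X](subrr (2 * - (pi / 2))); apply: cvgB; apply: cvg2; apply: cvg_neg.
  by rewrite subr_lt0.
by rewrite subr_lt0.
Qed.

Lemma atan_jump_le (a b x : R) k : `|atan_jump a b x k| <= 2 * pi.
Proof.
rewrite /atan_jump ler_norml.
have := atan_ltpi2 ((b - x) / k.+1%:R^-1); have := atan_gtNpi2 ((b - x) / k.+1%:R^-1).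
have := atan_ltpi2 ((a - x) / k.+1%:R^-1); have := atan_gtNpi2 ((a - x) / k.+1%:R^-1).
lra.
Qed.

Lemma truncate_window m a b z : - m%:R <= a -> b <= m%:R ->
  truncate m (window a b z) = window a b z.
Proof.
move=> ma bm; apply/funext => x; have [mx|mx] := pselect (ball0 m x).
  by rewrite truncate_in.
rewrite truncate_notin// /window indicE memNset ?mul0r// /= => xab; apply: mx.
move: xab; rewrite /ball0 /= !in_itv/= => /andP[ax xb].
by rewrite (le_trans ma ax) (le_trans xb bm).
Qed.

Lemma Rintegral_window_poisson (a b x d : R) (z w : R[i]) : 0 < d -> a <= b ->
  \int[leb]_y (Re (w * (window a b z y)^*) * poisson d (x - y)) =
  Re (w * z^*) * (2 * atan ((b - x) / d) - 2 * atan ((a - x) / d)).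
Proof.
move=> d0 ab.
have E : (\int[leb]_(y in `[a, b]) (poisson d (y - x))%:E)%E =
   (2 * atan ((b - x) / d) - 2 * atan ((a - x) / d))%:E by exact: integral_poisson.
have mp : measurable_fun [set: measurableTypeR R]
   (fun y : measurableTypeR R => poisson d (y - x) : R) by exact: measurable_poisson.
have ip_ : leb.-integrable `[a, b] (fun y => (poisson d (y - x))%:E).
  apply/integrableP; split; first by apply/measurable_EFinP; exact: measurable_funTS.
  under eq_integral do rewrite gee0_abs ?lee_fin ?poisson_ge0//.
  by rewrite E ltry.
transitivity (\int[leb]_(y in `[a, b]) (Re (w * z^*) * poisson d (y - x))).
  rewrite [RHS]Rintegral_mkcond; apply: eq_Rintegral => y _.
  rewrite patchE poisson_even /window indicE.
  case: ifPn => [/set_mem yab|/negP nyab].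
    by rewrite !ReImE /=; ring.
  by transitivity (0 : R) => //; rewrite !ReImE /=; ring.
by rewrite RintegralZl// /Rintegral E.
Qed.

(** The pairing with an interval, regularized with Abel weights, involves the
    primitive of the Poisson kernel, a difference of two arctangents, which tends
    to a multiple of the indicator function of the interval. *)
Lemma line_pairing_window (s : R) n m f a b z : s ^+ 2 = 1 -> L2 leb f ->
  a <= b -> - m%:R <= a -> b <= m%:R ->
  ip leb (tf leb s n f) (tf leb s m (window a b z)) =
  ip leb (truncate n f) (window a b z).
Proof.
move=> s2 f2 ab ma bm; have lf := @lebesgue_locally_finite R.
have ctr := line_contracts s2.
have chi2 := L2_window a b z.
set f1 := truncate n f; set chi := window a b z.
have f1L1 : L1 leb f1 by exact: L1_truncate.
have chi1 : L1 leb chi by rewrite /chi -(truncate_window z ma bm); exact: L1_truncate.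
have A2 : L2 leb (tf leb s n f) by exact: (tf_L2 lf ctr).
have B2 : L2 leb (tf leb s m chi) by exact: (tf_L2 lf ctr).
pose w (k : nat) : R -> R := abel_weight k.+1%:R^-1.
pose wA k xi := (w k xi)%:C * tf leb s n f xi.
have mw k : cmeasurable (fun xi => (w k xi)%:C).
  by apply: cmeasurableC; exact: measurable_abel_weight.
have k0 k : 0 < (k.+1%:R^-1 : R) by [].
have w_le k xi : normc ((w k xi)%:C : R[i]) <= 1.
  by rewrite normc_C ger0_norm ?abel_weight_ge0// abel_weight_le1.
have wA2 k : L2 leb (wA k).
  by apply: (@L2_bounded _ leb 1) => //; apply: aeW => xi; exact: w_le.
have wA_cvg : L2_cvg leb wA (tf leb s n f).
  have := @norm2_mul_cvg0 _ leb (fun k xi => (w k xi)%:C - 1) (tf leb s n f) 2.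
  rewrite /L2_cvg; have -> : (fun k => norm2 leb (fun x => ((w k x)%:C - 1) * tf leb s n f x)%R) =
      (fun k => norm2 leb (fun x => wA k x - tf leb s n f x)%R).
    by apply/funext => k; congr norm2; apply/funext => x; rewrite mulrBl mul1r.
  apply => //.
  - by move=> k; apply: cmeasurableB => //; exact: cmeasurable_cst.
  - by move=> k xi; rewrite (le_trans (normcB _ _))// Normc.normc1 lerD.
  - move=> xi.
    have -> : (fun k => normc ((w k xi)%:C - 1 : R[i])) = (fun k => `|w k xi - 1|).
      by apply/funext => k; rewrite -normc_C; congr normc; rewrite rmorphB.
    by apply/norm_cvg0P/subr_cvg0; exact: cvg_abel_weight.
have lhs : ip leb (wA k) (tf leb s m chi) @[k --> \oo] --> ip leb (tf leb s n f) (tf leb s m chi).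
  apply: (@L2_cvg_ip _ leb wA (fun=> tf leb s m chi)) => //.
  rewrite /L2_cvg; under eq_fun do under [X in norm2 _ X]eq_fun do rewrite subrr.
  by rewrite norm2_0; exact: cvg_cst.
have E k : ip leb (wA k) (tf leb s m chi) =
    (2 * pi)^-1 * \int[leb]_x (Re (f1 x * z^*) * atan_jump a b x k).
  rewrite -normalization_sqr.
  have -> : \int[leb]_x (Re (f1 x * z^*) * atan_jump a b x k) =
      \int[leb]_x \int[leb]_y (Re (f1 x * (chi y)^*) * poisson k.+1%:R^-1 (x - y)).
    by apply: eq_Rintegral => x _; rewrite Rintegral_window_poisson.
  rewrite -(line_form s2 (k0 k) f1L1 chi1) -RintegralZl//; last first.
    have mt : cmeasurable (tfun leb s f1) by apply: cmeasurable_tfun => //; have [] := f1L1.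
    have mt' : cmeasurable (tfun leb s chi) by exact: cmeasurable_tfun lf (cmeasurable_window _ _ _).
    pose B h := 2 * fine (\int[leb]_x (normc (h x))%:E).
    have tB (h : R -> R[i]) xi : L1 leb h -> normc (tfun leb s h xi) <= B h.
      move=> h1; rewrite (le_trans (normc_cintegral_le (L1_cis s xi h1)))//.
      by under eq_integral do rewrite normc_M normc_cis mulr1.
    have h1 : L1 leb (fun xi => (w k xi)%:C * (tfun leb s f1 xi * (tfun leb s chi xi)^*)).
      apply: (@L1M _ _ _ _ (B f1 * B chi)); first exact: L1_abel_weight.
        by apply: cmeasurableM => //; exact: cmeasurableJ.
      by move=> xi; rewrite normc_M normc_J ler_pM ?normc_ge0// tB.
    have := L1_Re h1; congr (leb.-integrable _ _); apply/funext => xi.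
    by rewrite Re_CM.
  apply: eq_Rintegral => xi _; rewrite /wA !tfE -/f1 /chi (truncate_window z ma bm).
  rewrite (_ : forall u v : R[i], (w k xi)%:C * (normalization%:C * u) * (normalization%:C * v)^* =
    (normalization ^+ 2 * w k xi)%:C * (u * v^*)); last first.
    by move=> u v; apply: complex_eqP; rewrite !ReImE; ring.
  by rewrite Re_CM mulrA.
have rhs : \int[leb]_x (Re (f1 x * z^*) * atan_jump a b x k) @[k --> \oo] -->
    \int[leb]_x (Re (f1 x * z^*) * (2 * pi * \1_(`[a, b]%classic : set (measurableTypeR R)) x)).
  have [mf1 _] := f1L1.
  have mfz : measurable_fun [set: measurableTypeR R] (fun x : measurableTypeR R => Re (f1 x * z^*) : R).
    by have [] := cmeasurableM mf1 (cmeasurable_cst z^*).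
  have mj k : measurable_fun [set: measurableTypeR R] (fun x : measurableTypeR R => atan_jump a b x k : R).
    apply: measurable_funB; apply: measurable_funM => //;
      apply: (measurableT_comp (f := @atan R)); try (by apply: continuous_measurable_fun => ?; exact: continuous_atan);
      by apply: measurable_funM => //; apply: measurable_funB.
  have mI : measurable_fun [set: measurableTypeR R]
      (\1_(`[a, b]%classic : set (measurableTypeR R)) : measurableTypeR R -> R).
    by apply: measurable_indic.
  pose F k (x : measurableTypeR R) := (Re (f1 x * z^*) * atan_jump a b x k)%:E.
  pose G (x : measurableTypeR R) :=
    (Re (f1 x * z^*) * (2 * pi * \1_(`[a, b]%classic : set (measurableTypeR R)) x))%:E.
  pose H (x : measurableTypeR R) := ((2 * pi * normc z)%:E * (normc (f1 x))%:E)%E.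
  have mF k : measurable_fun setT (F k) by apply/measurable_EFinP; exact: measurable_funM.
  have mG : measurable_fun setT G.
    by apply/measurable_EFinP; apply: measurable_funM => //; exact: measurable_funM.
  have FG : {ae leb, forall x, setT x -> F k x @[k --> \oo] --> G x}.
    exists [set a; b]; split.
    - by apply: measurableU; exact: measurable_set1.
    - by apply: countable_lebesgue_measure0; apply: finite_set_countable; exact: finite_set2.
    - move=> x /= /not_implyP[_ nx]; apply: contrapT => /not_orP[xa xb]; apply: nx.
      apply: cvg_EFin; first exact: nearW.
      by apply: cvgMr; apply: cvg_atan_jump => //; apply/eqP.
  have iH : leb.-integrable setT H.
    have [_ f1fin] := f1L1.
    have i1 : leb.-integrable setT (fun x : measurableTypeR R => (normc (f1 x))%:E).
      apply/integrableP; split.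
        by apply/measurable_EFinP; apply: measurable_normc.
      by under eq_integral do rewrite gee0_abs ?lee_fin ?normc_ge0//.
    exact: (integrableZl measurableT (2 * pi * normc z) i1).
  have FH : {ae leb, forall x, forall k, setT x -> (`|F k x| <= H x)%E}.
    apply: aeW => x k _; rewrite /F /H -EFinM lee_fin normrM [leRHS]mulrAC mulrC.
    rewrite -[leRHS]mulrA; apply: ler_pM; [exact: normr_ge0|exact: normr_ge0|exact: atan_jump_le|].
    by rewrite (le_trans (Re_mulJ_le _ _))// mulrC.
  have [iG _ lim] := dominated_convergence measurableT mF mG FG iH FH.
  rewrite /Rintegral; apply: fine_cvg; rewrite fineK; first exact: lim.
  exact: integrable_fin_num iG.
have : ip leb (tf leb s n f) (tf leb s m chi) = (2 * pi)^-1 *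
    \int[leb]_x (Re (f1 x * z^*) * (2 * pi * \1_(`[a, b]%classic : set (measurableTypeR R)) x)).
  have rhs' : ip leb (wA k) (tf leb s m chi) @[k --> \oo] --> (2 * pi)^-1 *
      \int[leb]_x (Re (f1 x * z^*) * (2 * pi * \1_(`[a, b]%classic : set (measurableTypeR R)) x)).
    by under eq_fun do rewrite E; apply: cvgMr.
  by have := cvg_unique _ lhs rhs'; apply.
move=> ->; rewrite /ip.
have pi0 : (2 * pi)^-1 * (2 * pi) = 1 :> R by rewrite mulVf// gt_eqF// mulr_gt0// pi_gt0.
have E2 x : Re (f1 x * (chi x)^*) = Re (f1 x * z^*) * \1_(`[a, b]%classic : set (measurableTypeR R)) x.
  by rewrite /chi /window !ReImE; ring.
under [RHS]eq_Rintegral do rewrite E2.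
under eq_Rintegral do rewrite mulrCA.
rewrite RintegralZl//; first by rewrite mulrA pi0 mul1r.
have := ip_integrable (L2_truncate n f2) chi2.
by under eq_fun do rewrite E2.
Qed.

End LineInversion.

(** * Fourier inversion on the line *)

Section WindowsTotal.
Context {R : realType}.
Notation leb := (@lebesgue_measure R).

(** By Lebesgue's differentiation theorem. *)
Lemma ae_eq0_of_integrals (r : R -> R) :
  measurable_fun [set: measurableTypeR R] (r : measurableTypeR R -> R) ->
  (forall n, leb.-integrable (ball0 n) (EFin \o r)) ->
  (forall a b : R, a <= b -> \int[leb]_(x in `[a, b]) r x = 0) ->
  {ae leb, forall x, r x = 0}.
Proof.
move=> mr ir r0.
have H n : {ae leb, forall x, `]- n%:R, n%:R[%classic x -> r x = 0}.
  pose f := r \_ (ball0 n : set R).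
  have fi : leb.-integrable setT (EFin \o f).
    rewrite (_ : EFin \o f = (EFin \o r) \_ (ball0 n : set R)); last first.
      by apply/funext => x /=; rewrite /f !patchE; case: ifP.
    by rewrite -integrable_mkcond//; exact: measurable_ball0.
  have lf : locally_integrable setT f.
    by apply: open_integrable_locally => //; exact: openT.
  have intf (y : R) : leb.-integrable [set` Interval (BLeft (- n%:R)) (BRight y)] (EFin \o f).
    by apply: integrableS fi => //; exact: subsetT.
  have := FTC1 intf lf; apply: ae_imp => x Fx; rewrite /= in_itv/= => /andP[nx xn].
  have F0 : (fun y => \int[leb]_(t in [set` Interval (BLeft (- n%:R)) (BRight y)]) f t) = (fun=> 0).
    apply/funext => y; rewrite /f -Rintegral_mkcondr.
    have [yn|ny] := ltP y (- n%:R).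
      rewrite (_ : _ `&` _ = set0) ?Rintegral_set0//; apply/seteqP; split => // t [] /=.
      by rewrite in_itv/= => /andP[a b]; have := le_lt_trans (le_trans a b) yn; rewrite ltxx.
    rewrite (_ : _ `&` _ = `[- n%:R, Num.min y n%:R]%classic); first apply: r0.
      by rewrite le_min ny/= (@le_trans _ _ 0)// oppr_le0.
    apply/seteqP; split => t; rewrite /ball0 /= !in_itv/= le_min.
      by move=> [/andP[-> ->] /andP[_ ->]].
    by move=> /and3P[-> -> ->].
  have [|_] := Fx; first by rewrite /= lte_fin.
  rewrite F0 derive1_cst /f patchE mem_set//.
  by rewrite /ball0 /= in_itv/= !ltW.
have : {ae leb, forall x, forall n : nat, `]- n%:R, n%:R[%classic x -> r x = 0}.
  exact/ae_foralln.
apply: ae_imp => x /(_ (Num.bound x)); apply.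
rewrite /= in_itv/= -ltr_norml.
by have := archi_boundP (normr_ge0 x); rewrite /Num.bound normr_id.
Qed.

Lemma windows_total (h : R -> R[i]) : L2 leb h ->
  (forall a b z, a <= b -> ip leb h (window a b z) = 0) -> {ae leb, forall x, h x = 0}.
Proof.
move=> h2 h0; have [[mR mI] _] := h2.
have lf := @lebesgue_locally_finite R.
have int (r : R -> R) :
    measurable_fun [set: measurableTypeR R] (r : measurableTypeR R -> R) ->
    (forall x, `|r x| <= normc (h x)) ->
    forall n, leb.-integrable (ball0 n) (EFin \o r).
  move=> mr rh n; rewrite integrable_mkcond; last exact: measurable_ball0.
  rewrite (_ : _ \_ _ = (fun x => (\1_(ball0 n) x * r x)%:E)); last first.
    apply/funext => x; rewrite patchE indicE.
    by case: ifPn => _; rewrite ?mul1r// mul0r.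
  apply: (L1_dominated _ (L1_truncate n lf h2)).
    apply: measurable_funM => //; apply: measurable_indic; exact: measurable_ball0.
  by move=> x; rewrite normrM /truncate normc_M normc_C ler_wpM2l.
have ipE a b z : ip leb h (window a b z) = \int[leb]_(x in `[a, b]) Re (h x * z^*).
  rewrite [RHS]Rintegral_mkcond /ip; apply: eq_Rintegral => x _.
  rewrite patchE /window indicE; case: ifPn => _; first by rewrite mul1r.
  by transitivity (0 : R) => //; rewrite !ReImE /=; ring.
have aR : {ae leb, forall x, Re (h x) = 0}.
  apply: ae_eq0_of_integrals => //; first by apply: int => // x; exact: ler_Re.
  move=> a b ab; rewrite -(h0 a b 1 ab) ipE; apply: eq_Rintegral => x _.
  by rewrite !ReImE /=; ring.
have aI : {ae leb, forall x, Im (h x) = 0}.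
  apply: ae_eq0_of_integrals => //; first by apply: int => // x; exact: ler_Im.
  move=> a b ab; rewrite -(h0 a b 'i%C ab) ipE; apply: eq_Rintegral => x _.
  by rewrite Re_M Re_J Im_J -[Re 'i%C]/(0 : R) -[Im 'i%C]/(1 : R); ring.
by apply: ae_imp2 aR aI => x hR hI; apply: complex_eqP.
Qed.

(** The adjoint relation moves the pairing of h with an interval to a pairing of
    transforms, which was computed; intervals determine a function. *)
Lemma line_inversion (s : R) f g h : s ^+ 2 = 1 -> L2 leb f ->
  is_ft leb leb s f g -> is_ft leb leb (- s) g h -> {ae leb, forall x, h x = f x}.
Proof.
move=> s2 f2 fg gh; have lf := @lebesgue_locally_finite R.
have ctr := line_contracts s2; have Ns2 : (- s) ^+ 2 = 1 by rewrite sqrrN.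
have ctrN := line_contracts Ns2.
have [g2 fg'] := fg; have [h2 gh'] := gh.
have hf2 : L2 leb (fun x => h x - f x) by exact: L2B.
suff : {ae leb, forall x, h x - f x = 0}.
  by apply: ae_imp => x /eqP; rewrite subr_eq0 => /eqP.
apply: windows_total => // a b z ab.
have chi2 := L2_window a b z; set chi := window a b z in chi2 *.
have [k [chik _]] := ft_exists lf ctr chi2.
have [k2 chik'] := chik.
rewrite ipBl// ipC.
have Ns : - - s = s by rewrite opprK.
rewrite -(@is_ft_adjoint _ leb leb s chi k g h lf lf ctr ctrN)// ipC.
apply/eqP; rewrite subr_eq0; apply/eqP.
have A : ip leb (tf leb s n f) (tf leb s n chi) @[n --> \oo] --> ip leb g k.
  by apply: L2_cvg_ip => // n; exact: (tf_L2 lf ctr).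
have B : ip leb (truncate n f) chi @[n --> \oo] --> ip leb f chi.
  apply: (@L2_cvg_ip _ leb (fun n => truncate n f) (fun=> chi)) => //.
  - by move=> n; exact: L2_truncate.
  - exact: truncate_cvg.
  - rewrite /L2_cvg; under eq_fun do under [X in norm2 _ X]eq_fun do rewrite subrr.
    by rewrite norm2_0; exact: cvg_cst.
have AB : \forall n \near \oo, ip leb (tf leb s n f) (tf leb s n chi) = ip leb (truncate n f) chi.
  near=> n; apply: line_pairing_window => //.
  - by rewrite lerNl; near: n; exact: nbhs_infty_ger.
  - by near: n; exact: nbhs_infty_ger.
have A' : ip leb (truncate n f) chi @[n --> \oo] --> ip leb g k.
  by apply: cvg_trans A; apply: near_eq_cvg.
by have := cvg_unique _ A' B; apply.
Unshelve. all: by end_near. Qed.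

End WindowsTotal.

(** * Restricted measures and integer frequencies *)

Section Restriction.
Context {d : measure_display} {T : measurableType d} {R : realType}.
Variables (mu : {measure set T -> \bar R}) (D : set T) (mD : measurable D).

Lemma ge0_integral_mrestr (f : T -> \bar R) : measurable_fun setT f ->
  (forall x, 0 <= f x)%E ->
  (\int[mrestr mu mD]_x f x = \int[mu]_(x in D) f x)%E.
Proof.
move=> mf f0; have mDC := measurableC mD.
have UT : D `|` ~` D = setT by exact: setUv.
have mf' : measurable_fun (D `|` ~` D) f by rewrite UT.
have dis : [disjoint D & ~` D] by apply/disj_setPCl.
rewrite -[in LHS]UT (ge0_integral_setU _ mD mDC mf' (fun x _ => f0 x) dis).
rewrite [X in (_ + X)%E](_ : _ = 0%E) ?adde0.
  by apply: eq_measure_integral => A mA AD; rewrite /= /mrestr setIidl.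
rewrite -(integral_measure_zero (~` D) f); apply: eq_measure_integral => A mA AD.
rewrite [LHS]/= /mrestr (_ : A `&` D = set0) ?measure0//.
by apply/seteqP; split => // x [/AD].
Qed.

Lemma integral_mrestr (f : T -> \bar R) : measurable_fun setT f ->
  (\int[mrestr mu mD]_x f x = \int[mu]_(x in D) f x)%E.
Proof.
move=> mf; rewrite [LHS]integralE [RHS]integralE; congr (_ - _)%E;
  apply: ge0_integral_mrestr.
- exact: measurable_funepos.
- exact: funepos_ge0.
- exact: measurable_funeneg.
- exact: funeneg_ge0.
Qed.

Lemma Rintegral_mrestr (f : T -> R) : measurable_fun setT f ->
  \int[mrestr mu mD]_x f x = \int[mu]_(x in D) f x.
Proof.
move=> mf; rewrite /Rintegral integral_mrestr//; exact/measurable_EFinP.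
Qed.

Lemma ae_mrestr : {ae mrestr mu mD, forall x, D x}.
Proof.
exists (~` D); split => //; first exact: measurableC.
by rewrite /mrestr/= setICl measure0.
Qed.

End Restriction.

Section TorusMeasures.
Context {R : realType}.
Notation leb := (@lebesgue_measure R).
Notation muT := (@space_measure R Torus).
Notation nuT := (@freq_measure R Torus).

Definition isint (x : R) := exists k : int, x = k%:~R.

Lemma muT_finite : (muT setT < +oo)%E.
Proof.
rewrite /= /mrestr setTI -[X in (X < _)%E]/(lebesgue_measure `[(- pi : R), pi[%classic).
by rewrite lebesgue_measure_itv/=; case: ifP => _; rewrite -?EFinB ltry.
Qed.

Lemma locally_finite_muT : locally_finite muT.
Proof.
move=> n; apply: le_lt_trans muT_finite; apply: le_measure; rewrite ?inE//.
exact: measurable_ball0.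
Qed.

Lemma ae_nuT : {ae nuT, forall x, isint x}.
Proof.
by apply: ae_imp (ae_mrestr _ _) => x /= [k _ <-]; exists k.
Qed.

Lemma nuT_set1 (k : int) : nuT [set k%:~R] = 1%E.
Proof.
rewrite /= /mrestr (_ : _ `&` _ = [set k%:~R]); last first.
  by apply/seteqP; split => x /=; [case|move=> ->; split => //; exists k].
have fin : finite_set [set k%:~R : R] by exact: finite_set1.
by rewrite /counting asboolT// fset_set1 finmap.cardfs1.
Qed.

Lemma locally_finite_nuT : locally_finite nuT.
Proof.
move=> n; rewrite /= /mrestr.
have fin : finite_set (ball0 n `&` range (fun k : int => k%:~R : R)).
  apply: (@sub_finite_set _ _ ((fun k : nat => k%:~R) @` `I_n.+1 `|` (fun k : nat => - (k%:~R)) @` `I_n.+1)).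
    move=> x [+ [k _ kx]]; rewrite -kx /ball0 /= in_itv/= => /andP[lo hi].
    case: k {kx} lo hi => k lo hi.
      by left; exists k => //=; move: hi; rewrite ler_nat ltnS.
    right; exists k.+1; last by rewrite NegzE mulrNz.
    move: lo; rewrite NegzE mulrNz lerN2 -[(k.+1)%:~R]/(k.+1%:R) ler_nat.
    by rewrite /= ltnS.
  by rewrite finite_setU; split; apply: finite_image; exact: finite_II.
by rewrite /counting asboolT// ltry.
Qed.

Lemma sin_intpi (k : int) : sin (k%:~R * pi) = 0 :> R.
Proof.
have nat_case (n : nat) : sin (n%:R * pi) = 0 :> R.
  elim: n => [|n IH]; first by rewrite mul0r sin0.
  by rewrite -natr1 mulrDl mul1r sinDpi IH oppr0.
case: k => n; first exact: nat_case.
by rewrite NegzE mulrNz mulNr sinN nat_case oppr0.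
Qed.

(** The sine vanishes at the integer multiples of pi; the exponentials are
    therefore orthogonal. *)
Lemma tfun_muT_1 (s : R) (k : int) : s ^+ 2 = 1 ->
  tfun muT s (fun=> 1) k%:~R = (if k == 0 then 2 * pi else 0)%:C.
Proof.
move=> s2; have s0 : s != 0 by apply: contra_eq_neq s2 => ->; rewrite expr0n/= eq_sym oner_eq0.
have npi : - pi <= pi :> R by rewrite (@le_trans _ _ 0) ?oppr_le0 ?pi_ge0.
have red (a : R -> R) : continuous a ->
    \int[muT]_x a x = \int[leb]_(x in `[- pi, pi]) a x.
  move=> ca; have ma : measurable_fun [set: measurableTypeR R] (a : measurableTypeR R -> R).
    exact: continuous_measurable_fun.
  rewrite [LHS]Rintegral_mrestr//= /Rintegral integral_itv_bndo_bndc//.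
  by apply/measurable_EFinP; exact: measurable_funTS.
have ftc (F a : R -> R) : (forall x : R, is_derive x (1 : R) F (a x)) -> continuous a ->
    \int[muT]_x a x = F pi - F (- pi).
  by move=> dF ca; rewrite red// /Rintegral (FTC_everywhere npi dF ca).
have cosE : Re (tfun muT s (fun=> 1) k%:~R) = \int[muT]_x cos (s * k%:~R * x).
  by apply: eq_Rintegral => x _; rewrite mul1r /=; congr cos; ring.
have sinE : Im (tfun muT s (fun=> 1) k%:~R) = \int[muT]_x sin (s * k%:~R * x).
  by apply: eq_Rintegral => x _; rewrite mul1r /=; congr sin; ring.
apply: complex_eqP; rewrite ?cosE ?sinE; have [k0|k0] := eqVneq k 0.
- have -> : \int[muT]_x cos (s * k%:~R * x) = \int[muT]_x (1 : R).
    by apply: eq_Rintegral => x _; rewrite k0 mulr0z mulr0 mul0r cos0.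
  rewrite (@ftc id (fun=> 1)).
  + by rewrite opprK /=; ring.
  + exact: cst_continuous.
- have sk0 : s * k%:~R != 0 :> R by rewrite mulf_neq0// intr_eq0.
  pose F (x : R) := (s * k%:~R)^-1 * sin (s * k%:~R * x).
  transitivity (F pi - F (- pi)).
    apply: ftc; last exact: continuous_cosM.
    move=> x; rewrite /F; move: (s * k%:~R) sk0 => c c0.
    by apply: is_derive_eq; rewrite /GRing.scale /=; field.
  + have sinpi0 : sin (s * k%:~R * pi) = 0 :> R.
      have /eqP := s2; rewrite sqrf_eq1 => /orP[] /eqP ->; first by rewrite mul1r sin_intpi.
      by rewrite mulN1r mulNr sinN sin_intpi oppr0.
    by rewrite /F mulrN sinN sinpi0 oppr0 mulr0 subrr.
- have -> : \int[muT]_x sin (s * k%:~R * x) = \int[muT]_x (0 : R).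
    by apply: eq_Rintegral => x _; rewrite k0 mulr0z mulr0 mul0r sin0.
  by rewrite (@ftc (fun=> 0) (fun=> 0)) ?subrr//; exact: cst_continuous.
- have sk0 : s * k%:~R != 0 :> R by rewrite mulf_neq0// intr_eq0.
  pose F (x : R) := - (s * k%:~R)^-1 * cos (s * k%:~R * x).
  transitivity (F pi - F (- pi)); last by rewrite /F mulrN cosN subrr.
  apply: ftc; last exact: continuous_sinM.
  move=> x; rewrite /F; move: (s * k%:~R) sk0 => c c0.
  by apply: is_derive_eq; rewrite /GRing.scale /=; field.
Qed.

End TorusMeasures.

(** * Fourier series as an isometry *)

Section L2Extra.
Context {R : realType}.
Implicit Types (mu : {measure set (measurableTypeR R) -> \bar R}) (f g : R -> R[i]).

Lemma energy_lty_L2 mu f : cmeasurable f -> (energy mu f < +oo)%E -> L2 mu f.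
Proof.
move=> mf; rewrite energyE => H; split => //.
case: (norm2 mu f) (norm2_ge0 mu f) H => [r _ _|_|//]; first exact: ltry.
by rewrite mulyy.
Qed.

Lemma L2_bounded_on mu (D : set (measurableTypeR R)) f (K : R) : measurable D ->
  (mu D < +oo)%E -> cmeasurable f -> (forall x, normc (f x) <= K) ->
  (forall x, ~ D x -> f x = 0) -> L2 mu f.
Proof.
move=> mD muD mf fK fD; apply: energy_lty_L2 => //.
apply: (@le_lt_trans _ _ (\int[mu]_x ((K ^+ 2)%:E * (\1_D x)%:E))%E).
  apply: ge0_le_integral; first exact: measurableT.
  - by move=> x _; rewrite lee_fin sqr_ge0.
  - exact: measurable_sqr_normc.
  - by apply: emeasurable_funM => //; apply/measurable_EFinP; exact: measurable_indic.
  - move=> x _; rewrite -EFinM lee_fin indicE; have [Dx|Dx] := pselect (D x).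
      by rewrite mem_set// mulr1 lerXn2r ?nnegrE ?normc_ge0// (le_trans _ (fK x))// normc_ge0.
    by rewrite fD// Normc.normc0 expr0n mulr_ge0 ?sqr_ge0.
rewrite ge0_integralZl//; last 2 first.
- by apply/measurable_EFinP; exact: measurable_indic.
- by rewrite lee_fin sqr_ge0.
by rewrite integral_indic// setIT lte_mul_pinfty ?lee_fin ?sqr_ge0.
Qed.

Lemma nrm_eq0 mu f : L2 mu f -> nrm mu f = 0 -> {ae mu, forall x, f x = 0}.
Proof.
by move=> f2 f0; apply: norm2_eq0; [have [] := f2|rewrite nrmE// f0].
Qed.

Lemma ip_eq0_ae mu f : L2 mu f -> (forall g, L2 mu g -> ip mu f g = 0) ->
  {ae mu, forall x, f x = 0}.
Proof.
move=> f2 f0; apply: nrm_eq0 => //; apply/eqP.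
by have /eqP := f0 f f2; rewrite ipff// sqrf_eq0.
Qed.

Lemma nrm_le_norm2 mu nu f g : L2 mu f -> L2 nu g -> nrm mu f <= nrm nu g ->
  (norm2 mu f <= norm2 nu g)%E.
Proof. by move=> f2 g2; rewrite !nrmE// lee_fin. Qed.

Lemma norm2_le_nrm mu nu f g : L2 mu f -> L2 nu g -> (norm2 mu f <= norm2 nu g)%E ->
  nrm mu f <= nrm nu g.
Proof. by move=> f2 g2; rewrite !nrmE// lee_fin. Qed.

Lemma ae_eq_Rintegral mu (a b : R -> R) :
  measurable_fun [set: measurableTypeR R] (a : measurableTypeR R -> R) ->
  measurable_fun [set: measurableTypeR R] (b : measurableTypeR R -> R) ->
  {ae mu, forall x, a x = b x} -> \int[mu]_x a x = \int[mu]_x b x.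
Proof.
move=> ma mb ab; rewrite /Rintegral; congr fine; apply: ae_eq_integral => //.
- exact/measurable_EFinP.
- exact/measurable_EFinP.
- by apply: ae_imp ab => x ->.
Qed.

End L2Extra.

Section TorusTransforms.
Context {R : realType}.
Notation muT := (@space_measure R Torus).
Notation nuT := (@freq_measure R Torus).
Implicit Types (f g h k : R -> R[i]).

Lemma L1_muT_cst (z : R[i]) : L1 muT (fun=> z).
Proof.
split; first exact: cmeasurable_cst.
by rewrite integral_cst//; apply: lte_mul_pinfty; [rewrite lee_fin normc_ge0| |exact: muT_finite].
Qed.

Lemma L2_muT_bounded f (K : R) : cmeasurable f -> (forall x, normc (f x) <= K) -> L2 muT f.
Proof.
move=> mf fK; exact: (@L2_bounded_on R muT setT f K measurableT muT_finite mf fK (fun x nT => False_ind _ (nT I))).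
Qed.

(** The integral over a period of the product of two exponentials leaves only the
    diagonal, where the counting measure has mass 1. *)
Lemma torus_form (s : R) f h : s ^+ 2 = 1 -> L1 nuT f -> L1 nuT h ->
  L2 nuT f -> L2 nuT h ->
  \int[muT]_x Re (tfun nuT s f x * (tfun nuT s h x)^*) =
  2 * pi * \int[nuT]_xi Re (f xi * (h xi)^*).
Proof.
move=> s2 f1 h1 f2 h2; have lmu := @locally_finite_muT R; have lnu := @locally_finite_nuT R.
have [[mfR mfI] _] := f1; have [mh _] := h1.
have [mhR mhI] := cmeasurableJ mh.
transitivity (\int[muT]_x (1 * Re (tfun nuT s f x * (tfun nuT s h x)^*))).
  by apply: eq_Rintegral => x _; rewrite mul1r.
rewrite (@kernel_form _ nuT muT s (fun=> 1) f h lnu lmu (L1_muT_cst 1) f1 h1).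
pose W := tfun muT s (fun=> 1%:C : R[i]).
have [mWR mWI] : cmeasurable W by apply: cmeasurable_tfun => //; exact: cmeasurable_cst.
have msub : measurable_fun [set: measurableTypeR R * measurableTypeR R]
    (fun p : measurableTypeR R * measurableTypeR R => p.2 - p.1 : measurableTypeR R).
  by apply: measurable_funB; [exact: (@measurable_snd_comp _ id)|exact: (@measurable_fst_comp _ id)].
have mi : measurable_fun [set: measurableTypeR R] (fun x : measurableTypeR R =>
    \int[nuT]_y Re (f x * W (x - y) * (h y)^*)).
  pose q (p : R * R) := Re (f p.2 * W (p.2 - p.1) * (h p.1)^*).
  apply: (@measurable_Rintegral_param _ nuT q) => //; rewrite /q.
  have a1 := measurable_snd_comp mfR; have a2 := measurable_snd_comp mfI.
  have a3 := measurable_fst_comp mhR; have a4 := measurable_fst_comp mhI.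
  have a5 := measurableT_comp mWR msub; have a6 := measurableT_comp mWI msub.
  under eq_fun do rewrite Re_M Re_M Im_M.
  apply: measurable_funB; apply: measurable_funM => //.
    by apply: measurable_funB; exact: measurable_funM.
  by apply: measurable_funD; exact: measurable_funM.
have mfh : measurable_fun [set: measurableTypeR R] (fun x : measurableTypeR R =>
    Re (f x * (h x)^*) : R) by apply: measurable_ReJ => //; have [] := f1.
transitivity (\int[nuT]_x (2 * pi * Re (f x * (h x)^*))); last first.
  by rewrite RintegralZl//; exact: ip_integrable.
apply: ae_eq_Rintegral => //; first exact: measurable_funM.
apply: ae_imp (@ae_nuT R) => x [k xk].
transitivity (\int[nuT]_y (2 * pi * Re (f x * (h x)^*) * \1_([set k%:~R] : set (measurableTypeR R)) y)).
  apply: ae_eq_Rintegral.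
  - have mWx : cmeasurable (fun y => W (x - y)).
      have mx : measurable_fun [set: measurableTypeR R] (fun y : measurableTypeR R => x - y : measurableTypeR R).
        exact: measurable_funB.
      by split; [exact: (measurableT_comp mWR mx)|exact: (measurableT_comp mWI mx)].
    by have [] := cmeasurableM (cmeasurableM (cmeasurable_cst (f x)) mWx) (cmeasurableJ mh).
  - by apply: measurable_funM => //; apply: measurable_indic.
  - apply: ae_imp (@ae_nuT R) => y [j yj].
    have -> : x - y = (k - j)%:~R by rewrite xk yj rmorphB.
    rewrite /W (tfun_muT_1 (k - j) s2) subr_eq0 indicE.
    have [kj|kj] := eqVneq k j.
      have -> : y = x by rewrite xk kj yj.
      rewrite mem_set ?mulr1; last by rewrite /= xk.
      by move: (f x) (h x) => u v; rewrite !ReImE; ring.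
    rewrite memNset; last by rewrite /= yj => /eqP; rewrite eqr_int eq_sym; apply/negP.
    by transitivity (0 : R); [rewrite mulr0 mul0r|rewrite mulr0].
have i1 : (\int[nuT]_y (\1_([set k%:~R] : set (measurableTypeR R)) y)%:E = 1)%E.
  by rewrite integral_indic// setIT nuT_set1.
rewrite RintegralZl//; last first.
  apply/integrableP; split; first by apply/measurable_EFinP; exact: measurable_indic.
  by under eq_integral do rewrite gee0_abs ?lee_fin//; rewrite i1 ltry.
by rewrite /Rintegral i1 /= mulr1.
Qed.

Lemma tf_nuT_L2 s n g : L2 nuT g -> L2 muT (tf nuT s n g).
Proof.
move=> g2; have lnu := @locally_finite_nuT R; have [mg _] := g2.
apply: (L2_muT_bounded (cmeasurable_tf s n lnu mg)) => xi; exact: (tf_le s n xi lnu g2).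
Qed.

Lemma torus_isometry (s : R) n m g k : s ^+ 2 = 1 -> L2 nuT g -> L2 nuT k ->
  ip muT (tf nuT s n g) (tf nuT s m k) = ip nuT (truncate n g) (truncate m k).
Proof.
move=> s2 g2 k2; have lnu := @locally_finite_nuT R.
have g1 := L1_truncate n lnu g2; have k1 := L1_truncate m lnu k2.
have E := torus_form s2 g1 k1 (L2_truncate n g2) (L2_truncate m k2).
have [mg _] := g2; have [mk _] := k2.
have mtg : cmeasurable (tfun nuT s (truncate n g)).
  by apply: cmeasurable_tfun => //; exact: cmeasurable_truncate.
have mtk : cmeasurable (tfun nuT s (truncate m k)).
  by apply: cmeasurable_tfun => //; exact: cmeasurable_truncate.
have bnd (h : R -> R[i]) : L1 nuT h -> forall xi,
    normc (tfun nuT s h xi) <= 2 * fine (\int[nuT]_x (normc (h x))%:E).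
  move=> h1 xi; rewrite (le_trans (normc_cintegral_le (L1_cis s xi h1)))//.
  by under eq_integral do rewrite normc_M normc_cis mulr1.
have tg2 := L2_muT_bounded mtg (bnd _ g1); have tk2 := L2_muT_bounded mtk (bnd _ k1).
transitivity (\int[muT]_x (normalization ^+ 2 *
    Re (tfun nuT s (truncate n g) x * (tfun nuT s (truncate m k) x)^*))).
  apply: eq_Rintegral => x _; rewrite !tfE.
  move: (tfun _ _ _ x) (tfun _ _ _ x) => u v.
  by rewrite !ReImE; ring.
rewrite RintegralZl//; last exact: ip_integrable.
have p0 : 2 * pi != 0 :> R by rewrite gt_eqF// mulr_gt0// pi_gt0.
by rewrite E normalization_sqr mulrA mulVf// mul1r.
Qed.

Lemma contracts_nuT (s : R) : s ^+ 2 = 1 -> contracts nuT muT s.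
Proof.
move=> s2 n g g2; apply: nrm_le_norm2; [exact: tf_nuT_L2|exact: L2_truncate|].
rewrite -(ler_pXn2r (ltn0Sn 1)) ?nnegrE ?nrm_ge0// -!ipff ?torus_isometry//.
- exact: L2_truncate.
- exact: tf_nuT_L2.
Qed.

(** By duality with the isometry above: F being the transform of f, the square
    of its norm is a pairing of f with the inverse transform of F, cut off so
    that all integrals converge. *)
Lemma contracts_muT (s : R) : s ^+ 2 = 1 -> contracts muT nuT s.
Proof.
move=> s2 n f f2; have lmu := @locally_finite_muT R; have lnu := @locally_finite_nuT R.
have [mf _] := f2; have f12 := L2_truncate n f2.
pose F := tf muT s n f; have mF : cmeasurable F by exact: cmeasurable_tf.
have FK xi : normc (F xi) <= _ := tf_le s n xi lmu f2.
have F2 m : L2 nuT (truncate m F).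
  apply: (@L2_bounded_on _ nuT (ball0 m)).
  - exact: measurable_ball0.
  - exact: lnu.
  - exact: cmeasurable_truncate.
  - by move=> x; apply: (le_trans (normc_truncate m F x)); exact: FK.
  - exact: truncate_notin.
have Ns2 : (- s) ^+ 2 = 1 by rewrite sqrrN.
have bound m : nrm nuT (truncate m F) <= nrm muT (truncate n f).
  have sq : nrm nuT (truncate m F) ^+ 2 <= nrm muT (truncate n f) * nrm nuT (truncate m F).
    rewrite -ipff//.
    have -> : ip nuT (truncate m F) (truncate m F) =
        ip nuT F (truncate m (truncate m F)).
      apply: eq_Rintegral => x _; rewrite truncate_truncate//.
      have [mx|mx] := pselect (ball0 m x); first by rewrite truncate_in.
      by rewrite truncate_notin// !ReImE /=; ring.
    rewrite (tf_adjoint s n m lmu lnu f2 (F2 m)).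
    rewrite (le_trans (ler_norm _))// (le_trans (ip_CauchySchwarz f12 (tf_nuT_L2 _ _ (F2 m))))//.
    rewrite ler_wpM2l ?nrm_ge0//.
    have := contracts_nuT Ns2 m (F2 m); rewrite truncate_truncate//.
    by apply: norm2_le_nrm => //; exact: tf_nuT_L2.
  have := nrm_ge0 nuT (truncate m F); rewrite le_eqVlt => /orP[/eqP <-|m0].
    exact: nrm_ge0.
  by move: sq; rewrite expr2 ler_pM2r.
rewrite (nrmE f12).
apply: (@fatou_norm2 _ nuT (fun m => truncate m F)) => //.
- by move=> m; exact: cmeasurable_truncate.
- apply: aeW => x; apply: cvg_near_cst; apply: filterS (near_ball0 x) => m mx.
  by rewrite truncate_in// subrr Normc.normc0.
- exact: nrm_ge0.
- by apply: nearW => m; rewrite (nrmE (F2 m)) lee_fin.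
Qed.

(** The exponentials are orthonormal, so that the coefficients of a Fourier series
    are those it was built from. *)
Lemma torus_coefficients (s : R) g f h : s ^+ 2 = 1 -> L2 nuT g ->
  is_ft nuT muT s g f -> is_ft muT nuT (- s) f h -> {ae nuT, forall x, h x = g x}.
Proof.
move=> s2 g2 gf fh; have lmu := @locally_finite_muT R; have lnu := @locally_finite_nuT R.
have Ns2 : (- s) ^+ 2 = 1 by rewrite sqrrN.
have [f2 gf'] := gf; have [h2 _] := fh.
have ctr := contracts_nuT s2; have ctrN := contracts_muT Ns2.
suff : {ae nuT, forall x, h x - g x = 0}.
  by apply: ae_imp => x /eqP; rewrite subr_eq0 => /eqP.
apply: ip_eq0_ae => [|k k2]; first exact: L2B.
have [F [kF _]] := ft_exists lnu ctr k2; have [F2 kF'] := kF.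
rewrite ipBl// ipC (_ : ip nuT k h = ip muT F f); last first.
  apply/esym.
  have := @is_ft_adjoint _ nuT muT s k F f h lnu lmu ctr ctrN k2 f2 kF fh.
  by rewrite ipC => ->; rewrite ipC.
apply/eqP; rewrite subr_eq0; apply/eqP; rewrite ipC.
have A : ip muT (tf nuT s n g) (tf nuT s n k) @[n --> \oo] --> ip muT f F.
  by apply: L2_cvg_ip => // n; exact: tf_nuT_L2.
have B : ip nuT (truncate n g) (truncate n k) @[n --> \oo] --> ip nuT g k.
  by apply: L2_cvg_ip => //; [move=> n; exact: L2_truncate|move=> n; exact: L2_truncate|exact: truncate_cvg|exact: truncate_cvg].
move: A; under eq_fun do rewrite torus_isometry//.
by move=> A; have := cvg_unique _ A B; apply.
Qed.

End TorusTransforms.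

(** * Completeness of the exponentials on the torus *)

Section CisBounds.
Context {R : realType}.

Lemma ler_sin (x : R) : `|sin x| <= `|x|.
Proof.
wlog x0 : x / 0 <= x.
  move=> H; have [x0|x0] := leP 0 x; first exact: H.
  by rewrite -normrN -sinN -(normrN x); apply: H; rewrite oppr_ge0 ltW.
move: x0; rewrite le_eqVlt => /orP[/eqP <-|x0]; first by rewrite sin0 normr0.
have csin : {within `[0, x], continuous (@sin R)}.
  by apply: continuous_subspaceT; exact: continuous_sin.
have [c _] := MVT x0 (fun y _ => is_derive_sin y) csin.
rewrite sin0 !subr0 => ->; rewrite normrM ler_piMl//.
by rewrite ler_norml cos_geN1 cos_le1.
Qed.

Lemma normc_cisB1_half (t : R) : normc (cis t - 1 : R[i]) = 2 * `|sin (t / 2)|.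
Proof.
apply/eqP; rewrite -(@eqrXn2 _ 2) ?normc_ge0 ?mulr_ge0//; apply/eqP.
rewrite normc_cisB1 exprMn real_normK ?num_real//.
have -> : cos t = cos (t / 2 + t / 2) by congr cos; lra.
by rewrite cosD -!expr2; have /(canRL (addrK _)) -> := cos2Dsin2 (t / 2); ring.
Qed.

Lemma normc_cisB1_le (t : R) : normc (cis t - 1 : R[i]) <= `|t|.
Proof.
rewrite normc_cisB1_half; have := ler_sin (t / 2); by rewrite [`|t / 2|]normrM (@gtr0_norm _ 2^-1) ?invr_gt0//; lra.
Qed.

Lemma normc_cisB_le (a b : R) : normc (cis a - cis b : R[i]) <= `|a - b|.
Proof.
have -> : cis a - cis b = cis b * (cis (a - b) - 1) :> R[i].
  by rewrite mulrBr mulr1 -cisD; congr (cis _ - _); ring.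
by rewrite normc_M normc_cis mul1r normc_cisB1_le.
Qed.

End CisBounds.

Section TorusInjectivity.
Context {R : realType}.
Notation leb := (@lebesgue_measure R).
Notation muT := (@space_measure R Torus).
Notation nuT := (@freq_measure R Torus).
Implicit Types (f g h k : R -> R[i]).

Lemma pi_lt4 : pi < 4 :> R.
Proof. have := @pihalf_lt2 R; lra. Qed.

Lemma truncate_muT n f : (4 <= n)%N -> {ae muT, forall x, truncate n f x = f x}.
Proof.
move=> n4; apply: ae_imp (ae_mrestr _ _) => x; rewrite /= in_itv/= => /andP[a b].
rewrite truncate_in// /ball0 /= in_itv/=.
have n4' : (4 <= n%:R :> R) by rewrite ler_nat.
by have := pi_lt4; move=> ?; apply/andP; split; lra.
Qed.

Lemma tf_muT_stationary s n f : (4 <= n)%N -> cmeasurable f -> tf muT s n f = tf muT s 4 f.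
Proof.
move=> n4 mf; rewrite -(tf_truncate muT s f n4); apply/funext => x; apply: tf_ae_eq => //.
  exact: cmeasurable_truncate.
by apply: ae_imp (truncate_muT f (leqnn 4)) => y ->.
Qed.

Definition one_period f (x : R) : R[i] :=
  (\1_(`[- pi, pi[%classic : set (measurableTypeR R)) x)%:C * f x.

Lemma one_period_in f x : x \in (`[- pi, pi[%classic : set R) -> one_period f x = f x.
Proof. by move=> H; rewrite /one_period indicE H mul1r. Qed.

Lemma one_period_notin f x : x \notin (`[- pi, pi[%classic : set R) -> one_period f x = 0.
Proof. by move=> H; rewrite /one_period indicE (negbTE H) mul0r. Qed.

Lemma cmeasurable_one_period f : cmeasurable f -> cmeasurable (one_period f).
Proof. by move=> mf; apply: cmeasurable_indic. Qed.

Lemma energy_one_period f : cmeasurable f -> energy leb (one_period f) = energy muT f.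
Proof.
move=> mf; rewrite /energy integral_mrestr; last exact: measurable_sqr_normc.
rewrite [RHS]integral_mkcond; apply: eq_integral => x _.
rewrite patchE; case: ifPn => H; first by rewrite one_period_in.
by rewrite one_period_notin// Normc.normc0 expr0n.
Qed.

Lemma tf_one_period s n f xi : cmeasurable f -> tf leb s n (one_period f) xi = tf muT s n f xi.
Proof.
move=> mf; rewrite !tfE; congr (_ * _).
have mt := cmeasurable_truncate n mf.
have mc : cmeasurable (fun x : R => cis (s * (x * xi)) : R[i]).
  by apply: cmeasurable_cis; exact: measurable_lin.
have [mR mI] := cmeasurableM mt mc.
rewrite /tfun; apply: complex_eqP; rewrite /cintegral.
  rewrite -[LHS]/(\int[leb]_x Re (truncate n (one_period f) x * cis (s * (x * xi)))).
  rewrite -[RHS]/(\int[muT]_x Re (truncate n f x * cis (s * (x * xi)))).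
  rewrite [RHS]Rintegral_mrestr// [RHS]Rintegral_mkcond; apply: eq_Rintegral => x _.
  rewrite patchE /truncate; case: ifPn => H; first by rewrite one_period_in.
  by rewrite one_period_notin// mulr0 mul0r.
rewrite -[LHS]/(\int[leb]_x Im (truncate n (one_period f) x * cis (s * (x * xi)))).
rewrite -[RHS]/(\int[muT]_x Im (truncate n f x * cis (s * (x * xi)))).
rewrite [RHS]Rintegral_mrestr// [RHS]Rintegral_mkcond; apply: eq_Rintegral => x _.
rewrite patchE /truncate; case: ifPn => H; first by rewrite one_period_in.
by rewrite one_period_notin// mulr0 mul0r.
Qed.

Lemma L2_one_period f : L2 muT f -> L2 leb (one_period f).
Proof.
move=> f2; have [mf _] := f2; apply: energy_lty_L2; first exact: cmeasurable_one_period.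
by rewrite energy_one_period// sqr_nrm// ltry.
Qed.

Lemma truncate_one_period n f : (4 <= n)%N -> truncate n (one_period f) = one_period f.
Proof.
move=> n4; apply/funext => x; have [nx|nx] := pselect (ball0 n x); first by rewrite truncate_in.
rewrite truncate_notin// /one_period indicE memNset ?mul0r// /= in_itv/= => /andP[a b]; apply: nx.
have n4' : (4 <= n%:R :> R) by rewrite ler_nat.
by rewrite /ball0 /= in_itv/=; have := pi_lt4; move=> ?; apply/andP; split; lra.
Qed.

(** Cut off to one period, f is a function on the line; there the inverse transform
    is a contraction which recovers it. *)
Lemma energy_le_line_transform (s : R) f : s ^+ 2 = 1 -> L2 muT f ->
  (energy muT f <= energy leb (tf muT s 4 f))%E.
Proof.
move=> s2 f2; have lf := @lebesgue_locally_finite R; have [mf _] := f2.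
have h2 := L2_one_period f2; set h := one_period f in h2 *.
have ctr := line_contracts s2; have Ns2 : (- s) ^+ 2 = 1 by rewrite sqrrN.
have ctrN := line_contracts Ns2.
have EH : tf leb s 4 h = tf muT s 4 f by apply/funext => xi; rewrite tf_one_period.
have hH : is_ft leb leb s h (tf leb s 4 h).
  split; first exact: (tf_L2 lf ctr).
  rewrite /L2_cvg; apply: cvg_near_cst; near=> n.
  have n4 : (4 <= n)%N by near: n; exact: nbhs_infty_ge.
  rewrite -(tf_truncate leb s h n4) (truncate_one_period _ (leqnn 4)).
  by rewrite (_ : (fun x => _) = (fun=> 0)) ?norm2_0//; apply/funext => x; rewrite subrr.
have [h' [Hh' _]] := ft_exists lf ctrN (tf_L2 lf ctr 4 h2).
have h'h := line_inversion s2 h2 hH Hh'.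
have [[mh' _] _] := Hh'; have [mh _] := h2.
have := is_ft_le lf ctrN (tf_L2 lf ctr 4 h2) Hh'.
rewrite (eq_norm2 mh' mh h'h) EH => le; rewrite -energy_one_period// -/h !energyE.
by apply: lee_pmul; rewrite ?norm2_ge0.
Unshelve. all: by end_near. Qed.

(** By Tonelli, for the kernel which is 1 when xi - k lies in [0, 1[: each xi is
    counted for exactly one integer k. *)
Lemma integral_unit_intervals (G : R -> \bar R) :
  measurable_fun [set: measurableTypeR R] (G : measurableTypeR R -> \bar R) ->
  (forall x, 0 <= G x)%E ->
  (\int[leb]_xi G xi = \int[leb]_(th in `[0%R, 1%R[) \int[nuT]_k G (th + k)%R)%E.
Proof.
move=> mG G0; have lleb := @lebesgue_locally_finite R; have lnu := @locally_finite_nuT R.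
pose I : set (measurableTypeR R) := `[0%R, 1%R[%classic.
have mI : measurable I by exact: measurable_itv.
have mI1 : measurable_fun [set: measurableTypeR R] (\1_I : measurableTypeR R -> R).
  exact: measurable_indic.
have one (xi : R) : (\int[nuT]_k (\1_I (xi - k))%:E = 1)%E.
  rewrite -(nuT_set1 (Num.floor xi)) -[in RHS](setIT [set _]) -integral_indic//.
  apply: ae_eq_integral => //.
  - apply/measurable_EFinP; apply: (measurableT_comp mI1); exact: measurable_funB.
  - by apply/measurable_EFinP; exact: measurable_indic.
  - apply: ae_imp (@ae_nuT R) => k [j ->] _; rewrite !indicE; congr ((nat_of_bool _)%:R%:E).
    apply/idP/idP => [/set_mem|/set_mem /= ->].
      rewrite /I /= in_itv/= subr_ge0 ltrBlDr => /andP[a b]; apply/mem_set => /=.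
      congr (_%:~R); apply/esym/floor_def; rewrite a/= intrD addrC//.
    by apply/mem_set; rewrite /I /= in_itv/= subr_ge0 floor_le ltrBlDr addrC -intrD1 floorD1_gt.
pose K (p : R * R) : \bar R := (G p.1 * (\1_I (p.1 - p.2))%:E)%E.
have mK : measurable_fun [set: measurableTypeR R * measurableTypeR R]
    (K : measurableTypeR R * measurableTypeR R -> \bar R).
  apply: emeasurable_funM; first exact: (measurableT_comp mG measurable_fst).
  apply/measurable_EFinP; apply: (measurableT_comp mI1).
  by apply: measurable_funB; [exact: (@measurable_fst_comp _ id)|exact: (@measurable_snd_comp _ id)].
have K0 p : (0 <= K p)%E by rewrite mule_ge0// lee_fin.
pose K' (p : R * R) : \bar R := (G (p.1 + p.2)%R * (\1_I p.1)%:E)%E.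
have mK' : measurable_fun [set: measurableTypeR R * measurableTypeR R]
    (K' : measurableTypeR R * measurableTypeR R -> \bar R).
  apply: emeasurable_funM.
    apply: (measurableT_comp mG).
    by apply: measurable_funD; [exact: (@measurable_fst_comp _ id)|exact: (@measurable_snd_comp _ id)].
  by apply/measurable_EFinP; exact: (measurableT_comp mI1 measurable_fst).
have K'0 p : (0 <= K' p)%E by rewrite mule_ge0// lee_fin.
transitivity (\int[leb]_xi \int[nuT]_k K (xi, k))%E.
  apply: eq_integral => xi _; rewrite /K /= ge0_integralZl ?one ?mule1//.
  by apply/measurable_EFinP; apply: (measurableT_comp mI1); exact: measurable_funB.
rewrite (tonelli lleb lnu mK K0).
transitivity (\int[nuT]_k \int[leb]_th K' (th, k))%E.
  apply: eq_integral => k _.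
  have mKk : measurable_fun [set: measurableTypeR R] (fun xi : measurableTypeR R => K (xi, k)).
    by have := measurableT_comp mK (measurable_pair2 k).
  rewrite -(ge0_integral_translation k measurableT mKk (fun x => K0 (x, k))).
  by apply: eq_integral => th _; rewrite /K /K' /= addrK.
rewrite -(tonelli lleb lnu mK' K'0) [RHS]integral_mkcond; apply: eq_integral => th _.
rewrite patchE /K' /=; have [thI|thI] := boolP (th \in `[0%R, 1%R[%classic).
  by apply: eq_integral => k _; rewrite indicE thI mule1.
apply: integral0_eq => k _; by rewrite indicE (negbTE thI) mule0.
Qed.

Lemma integral_itv_le (S : R -> \bar R) (a b C : R) : a <= b -> 0 <= C ->
  measurable_fun [set: measurableTypeR R] (S : measurableTypeR R -> \bar R) ->
  (forall x, 0 <= S x)%E -> (forall x, a <= x < b -> (S x <= C%:E)%E) ->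
  (\int[leb]_(x in `[a, b[) S x <= (C * (b - a))%:E)%E.
Proof.
move=> ab C0 mS S0 SC.
apply: (@le_trans _ _ (\int[leb]_(x in `[a, b[) C%:E)%E).
  apply: ge0_le_integral => //; first exact: measurable_funS mS.
rewrite integral_cst//= lebesgue_measure_itv/= lte_fin.
move: ab; rewrite le_eqVlt => /orP[/eqP ->|ab].
  by rewrite ltxx mule0 subrr mulr0.
by rewrite ab -EFinB -EFinM.
Qed.

(** If all the integer frequencies of d vanish, then the transform of d over
    the line is small near the integers, since shifting the frequency by theta
    multiplies d by a factor at distance at most |x theta| from 1.  Its total
    energy, which is that of d, would therefore be at most 29/32 of it. *)
Lemma torus_injective (s : R) d : s ^+ 2 = 1 -> L2 muT d -> is_ft muT nuT s d (fun=> 0) ->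
  {ae muT, forall x, d x = 0}.
Proof.
move=> s2 d2 [_ d0]; have lmu := @locally_finite_muT R; have lnu := @locally_finite_nuT R.
have ctr := contracts_muT s2; have [md _] := d2.
pose F := tf muT s 4 d; have F2 : L2 nuT F := tf_L2 lmu ctr 4 d2.
have mF : cmeasurable F by have [] := F2.
have F0 : {ae nuT, forall x, F x = 0}.
  apply: norm2_eq0 => //; apply/eqP; rewrite eq_le norm2_ge0 andbT; apply/lee_addgt0Pr => e e0.
  have /cvge0P := d0 => /(_ (fun n => norm2_ge0 _ _) e e0)[N _ HN].
  rewrite add0e; apply: ltW; have := HN (maxn N 4) (leq_maxl _ _).
  rewrite /= (tf_muT_stationary s (leq_maxr N 4) md).
  by rewrite (_ : (fun x => _) = F)//; apply/funext => x; rewrite subr0.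
have mphase (th : R) : cmeasurable (fun x => cis (s * (x * th)) : R[i]).
  by apply: cmeasurable_cis; exact: measurable_lin.
pose dm (th x : R) : R[i] := d x * cis (s * (x * th)).
have dm2 th : L2 muT (dm th).
  apply: L2_normc_le d2; first exact: cmeasurableM.
  by apply: aeW => x; rewrite normc_M normc_cis mulr1.
have shift (th k : R) : F (th + k) = tf muT s 4 (dm th) k.
  rewrite /F /tf; congr (_ * _); congr cintegral; apply/funext => x.
  by rewrite /dm -mulrA -cisD; congr (_ * cis _); ring.
pose G (xi : R) : \bar R := (normc (F xi) ^+ 2)%:E.
have mG : measurable_fun [set: measurableTypeR R] (G : measurableTypeR R -> \bar R).
  exact: measurable_sqr_normc.
have G0 xi : (0 <= G xi)%E by rewrite lee_fin sqr_ge0.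
pose S (th : R) := (\int[nuT]_k G (th + k)%R)%E.
have SE th : S th = energy nuT (tf muT s 4 (dm th)).
  by apply: eq_integral => k _; rewrite /G shift.
have S0 th : (0 <= S th)%E by apply: integral_ge0.
have mS : measurable_fun [set: measurableTypeR R] (S : measurableTypeR R -> \bar R).
  apply: (measurable_tonelli_F lnu (k := fun p => G (p.1 + p.2))) => [|p]; last exact: G0.
  apply: (measurableT_comp mG).
  by apply: measurable_funD; [exact: (@measurable_fst_comp _ id)|exact: (@measurable_snd_comp _ id)].
pose E := nrm muT d; have E0 : 0 <= E by exact: nrm_ge0.
have Sle th (C : R) : 0 <= C -> (norm2 nuT (tf muT s 4 (dm th)) <= C%:E)%E -> (S th <= (C ^+ 2)%:E)%E.
  move=> C0 H; rewrite SE energyE expr2 EFinM; apply: lee_pmul => //; exact: norm2_ge0.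
have S1 th : (S th <= (E ^+ 2)%:E)%E.
  apply: Sle => //; rewrite /E -nrmE//; apply: (le_trans (ctr 4 _ (dm2 th))).
  have [mdm _] := dm2 th; apply: (le_trans (norm2_truncate muT 4 mdm)).
  rewrite (@eq_norm2_normc _ muT _ d)//.
  by move=> x; rewrite normc_M normc_cis mulr1.
have S2 th : 0 <= th < 8^-1 -> (S th <= ((2^-1 * E) ^+ 2)%:E)%E.
  move=> /andP[th0 th1]; apply: Sle; first by rewrite mulr_ge0.
  have w2 := L2B (dm2 th) d2; have [mw _] := w2.
  have -> : norm2 nuT (tf muT s 4 (dm th)) = norm2 nuT (tf muT s 4 (fun x => dm th x - d x)).
    apply: eq_norm2; [by have [] := tf_L2 lmu ctr 4 (dm2 th)|by have [] := tf_L2 lmu ctr 4 w2|].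
    apply: ae_imp F0 => xi Fxi; rewrite (tfB s lmu 4 xi (dm2 th) d2).
    by move: Fxi; rewrite /F => ->; rewrite subr0.
  apply: (le_trans (ctr 4 _ w2)).
  pose q x : R[i] := (\1_(ball0 4) x)%:C * (cis (s * (x * th)) - 1).
  have mq : cmeasurable q.
    apply: cmeasurable_indic; first exact: measurable_ball0.
    by apply: cmeasurableB => //; exact: cmeasurable_cst.
  have -> : truncate 4 (fun x => dm th x - d x) = (fun x => q x * d x).
    by apply/funext => x; rewrite /truncate /dm /q; ring.
  rewrite EFinM /E -nrmE//; apply: norm2_bounded => //; apply: aeW => x.
  have [xb|xb] := pselect (ball0 4 x); last first.
    by rewrite /q indicE memNset// mul0r Normc.normc0.
  rewrite /q indicE mem_set// mul1r; apply: (le_trans (normc_cisB1_le _)).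
  have s1 : `|s| = 1 by apply/eqP; rewrite -sqrp_eq1// real_normK ?num_real ?s2.
  rewrite !normrM s1 mul1r (ger0_norm th0).
  have x4 : `|x| <= 4 by move: xb; rewrite /ball0 /= in_itv/= -ler_norml.
  have := ler_pM (normr_ge0 x) th0 x4 (ltW th1); lra.
have tot : (energy muT d <= ((2^-1 * E) ^+ 2 * (8^-1 - 0))%:E + (E ^+ 2 * (1 - 8^-1))%:E)%E.
  apply: (le_trans (energy_le_line_transform s2 d2)).
  rewrite /energy -/(F) (integral_unit_intervals mG G0).
  have -> : `[0%R, 1%R[%classic = `[0%R, 8^-1[%classic `|` `[8^-1, 1%R[%classic :> set R.
    apply/seteqP; split => x /=; rewrite !in_itv/=.
      by move=> /andP[a b]; have [c|c] := ltP x 8^-1; [left|right]; rewrite ?a ?b ?c.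
    by case=> /andP[a b]; apply/andP; split; lra.
  have mSU : measurable_fun (`[0%R, 8^-1[%classic `|` `[8^-1, 1[%classic : set (measurableTypeR R)) S.
    by apply: measurable_funS mS.
  have disj : [disjoint `[0%R, 8^-1[%classic & `[8^-1, 1[%classic : set R].
    rewrite disj_set2E; apply/eqP/seteqP; split => x //=; rewrite !in_itv/= => -[/andP[a b] /andP[c e]].
    by move: b; rewrite ltNge c.
  rewrite (ge0_integral_setU _ _ _ mSU _ disj)//.
  have h8 : 0 <= 8^-1 :> R by rewrite invr_ge0.
  have h8' : 8^-1 <= 1 :> R by lra.
  apply: leeD; first by apply: integral_itv_le => //; exact: sqr_ge0.
  by apply: integral_itv_le => //; exact: sqr_ge0.
apply: nrm_eq0 => //; rewrite -/E; move: tot; rewrite sqr_nrm// -/E -EFinD lee_fin => tot.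
apply/eqP; rewrite -sqrf_eq0 eq_le sqr_ge0 andbT; move: tot.
by rewrite exprMn; lra.
Qed.

(** The function h - f has vanishing coefficients, since those of a Fourier series
    are the ones it was built from. *)
Lemma torus_inversion (s : R) f g h : s ^+ 2 = 1 -> L2 muT f ->
  is_ft muT nuT s f g -> is_ft nuT muT (- s) g h -> {ae muT, forall x, h x = f x}.
Proof.
move=> s2 f2 fg gh; have lmu := @locally_finite_muT R; have lnu := @locally_finite_nuT R.
have Ns2 : (- s) ^+ 2 = 1 by rewrite sqrrN.
have ctr := contracts_muT s2; have [g2 _] := fg; have [h2 _] := gh.
have [k [hk _]] := ft_exists lmu ctr h2.
have := torus_coefficients Ns2 g2 gh; rewrite opprK => /(_ _ hk) kg.
have H := is_ftB lmu ctr h2 f2 hk fg.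
have : {ae muT, forall x, h x - f x = 0}.
  apply: (torus_injective s2); first exact: L2B.
  apply: (is_ft_ae lmu (L2B h2 f2) (L2B h2 f2) _ _ _ H).
  - exact: cmeasurable_cst.
  - exact: aeW.
  - by apply: ae_imp kg => xi ->; rewrite subrr.
by apply: ae_imp => x /eqP; rewrite subr_eq0 => /eqP.
Qed.

End TorusInjectivity.

(** * Plancherel theorem and multipliers *)

Section ScaledTransform.
Context {R : realType}.
Variables (mu nu : {measure set (measurableTypeR R) -> \bar R}) (s : R).
Hypotheses (lmu : locally_finite mu) (ctr : contracts mu nu s).
Implicit Types (f g : R -> R[i]).

Lemma L2Z nu' (c : R[i]) f : @L2 R nu' f -> L2 nu' (fun x => c * f x).
Proof.
apply: (@L2_bounded _ nu' (normc c)); first exact: normc_ge0.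
  exact: cmeasurable_cst.
exact: aeW.
Qed.

Lemma is_ftZ (c : R[i]) f g : L2 mu f -> is_ft mu nu s f g ->
  is_ft mu nu s (fun x => c * f x) (fun x => c * g x).
Proof.
move=> f2 [g2 fg]; split; first exact: L2Z.
have [mg _] := g2.
have E n : norm2 nu (fun x => tf mu s n (fun x => c * f x) x - c * g x)%R =
    ((normc c)%:E * norm2 nu (fun x => tf mu s n f x - g x)%R)%E.
  rewrite -norm2Z; last by have [] := L2B (tf_L2 lmu ctr n f2) g2.
  congr norm2; apply/funext => x; rewrite mulrBr; congr (_ - _).
  rewrite !tfE mulrCA; congr (_ * _).
  have f1 := L1_cis s x (L1_truncate n lmu f2).
  rewrite /tfun [RHS]mulrC -(cintegralZ c f1); congr cintegral; apply/funext => y.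
  by rewrite /truncate; ring.
rewrite /L2_cvg; under eq_fun do rewrite E.
rewrite -(mule0 (normc c)%:E); apply: cvgeZl => //.
Qed.

Lemma is_ftD f f' g g' : L2 mu f -> L2 mu f' -> is_ft mu nu s f g -> is_ft mu nu s f' g' ->
  is_ft mu nu s (fun x => f x + f' x) (fun x => g x + g' x).
Proof.
move=> f2 f2' fg fg'.
have fN := is_ftZ (- 1) f2' fg'; have := is_ftB lmu ctr f2 (L2Z (-1) f2') fg fN.
by rewrite (_ : (fun x => f x - _) = (fun x => f x + f' x)) 1?(_ : (fun x => g x - _) = (fun x => g x + g' x))//;
  apply/funext => x; rewrite mulN1r opprK.
Qed.

End ScaledTransform.

Section Plancherel.
Context {R : realType}.
Variable M : domain.
Notation mu := (@space_measure R M).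
Notation nu := (@freq_measure R M).
Notation wd := (@well_defined_on_domain R M).
Notation fourier := (@fourier R M).
Notation L2_space := (@L2_space R M).
Implicit Types (f g h k : R -> R[i]).

Lemma locally_finite_space : locally_finite mu.
Proof. by case: M; [exact: lebesgue_locally_finite|exact: locally_finite_muT]. Qed.

Lemma locally_finite_freq : locally_finite nu.
Proof. by case: M; [exact: lebesgue_locally_finite|exact: locally_finite_nuT]. Qed.

Lemma sqrN1 : (- 1 : R) ^+ 2 = 1. Proof. by rewrite sqrrN expr1n. Qed.

Lemma contracts_fourier : contracts mu nu (- 1).
Proof. by case: M; [apply: line_contracts|apply: contracts_muT]; exact: sqrN1. Qed.

Lemma contracts_inverse : contracts nu mu 1.
Proof. by case: M; [apply: line_contracts|apply: contracts_nuT]; exact: expr1n. Qed.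

Lemma fourier_inversion f g h : L2 mu f -> is_ft mu nu (- 1) f g -> is_ft nu mu 1 g h ->
  {ae mu, forall x, h x = f x}.
Proof.
case: M => f2 fg gh.
  by apply: (line_inversion sqrN1 f2 fg); rewrite opprK.
by apply: (torus_inversion sqrN1 f2 fg); rewrite opprK.
Qed.

Lemma inverse_fourier g f h : L2 nu g -> is_ft nu mu 1 g f -> is_ft mu nu (- 1) f h ->
  {ae nu, forall x, h x = g x}.
Proof.
case: M => g2 gf fh; first exact: (line_inversion (expr1n _ 2) g2 gf).
exact: (torus_coefficients (expr1n _ 2) g2 gf).
Qed.

Lemma truncated_fourierE n f : truncated_fourier M n f = tf mu (- 1) n f.
Proof.
apply/funext => xi; rewrite /truncated_fourier /tf; congr (_ * cintegral _ _ _).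
by apply/funext => x; rewrite mulN1r.
Qed.

Lemma is_fourierP f g : is_fourier M f g <-> is_ft mu nu (- 1) f g.
Proof.
have E : (fun n => norm2 nu (fun xi => truncated_fourier M n f xi - g xi)%R) =
    (fun n => norm2 nu (fun xi => tf mu (- 1) n f xi - g xi)%R).
  by apply/funext => n; rewrite truncated_fourierE.
by rewrite /is_fourier /is_ft /L2_cvg E.
Qed.

Lemma fourierP f : L2 mu f -> is_ft mu nu (- 1) f (fourier f).
Proof.
move=> f2; have [g [fg _]] := ft_exists locally_finite_space contracts_fourier f2.
have H : exists g', [set g' | is_fourier M f g'] g' by exists g; exact: ((is_fourierP f g).2 fg).
exact: ((is_fourierP f _).1 (@xgetPex _ (fun=> 0) _ H)).
Qed.

Lemma L2_fourier f : L2 mu f -> L2 nu (fourier f).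
Proof. by case/fourierP. Qed.

Lemma inverseP f : L2 mu f -> is_ft nu mu 1 (fourier f) f.
Proof.
move=> f2; have fF := fourierP f2; have [F2 _] := fF.
have [h [hF _]] := ft_exists locally_finite_freq contracts_inverse F2.
have [[mf _] [h2 _]] := (f2, hF).
apply: (is_ft_ae locally_finite_freq F2 F2 mf _ _ hF); first exact: aeW.
exact: (fourier_inversion f2 fF hF).
Qed.

Lemma fourier_of_inverse g f : L2 nu g -> is_ft nu mu 1 g f ->
  {ae nu, forall xi, fourier f xi = g xi}.
Proof. by move=> g2 gf; have [f2 _] := gf; exact: (inverse_fourier g2 gf (fourierP f2)). Qed.

Lemma fourier_unique f g : L2 mu f -> is_ft mu nu (- 1) f g ->
  {ae nu, forall xi, fourier f xi = g xi}.
Proof. by move=> f2; exact: (is_ft_uniq locally_finite_space contracts_fourier f2 (fourierP f2)). Qed.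

(** The transform and its inverse are both contractions, and they are inverse to
    each other. *)
Lemma norm2_fourier f : L2 mu f -> norm2 nu (fourier f) = norm2 mu f.
Proof.
move=> f2; apply/eqP; rewrite eq_le.
rewrite (is_ft_le locally_finite_space contracts_fourier f2 (fourierP f2))/=.
exact: (is_ft_le locally_finite_freq contracts_inverse (L2_fourier f2) (inverseP f2)).
Qed.

Lemma norm2_inverse g f : L2 nu g -> is_ft nu mu 1 g f -> norm2 mu f = norm2 nu g.
Proof.
move=> g2 gf; have [f2 _] := gf; have [mF _] := L2_fourier f2; have [mg _] := g2.
by rewrite -norm2_fourier//; apply: eq_norm2 => //; exact: fourier_of_inverse.
Qed.

Lemma fourierB f g : L2 mu f -> L2 mu g ->
  {ae nu, forall xi, fourier (fun x => f x - g x) xi = fourier f xi - fourier g xi}.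
Proof.
move=> f2 g2; apply: fourier_unique; first exact: L2B.
by apply: (is_ftB locally_finite_space contracts_fourier f2 g2); exact: fourierP.
Qed.

Lemma fourierD f g : L2 mu f -> L2 mu g ->
  {ae nu, forall xi, fourier (fun x => f x + g x) xi = fourier f xi + fourier g xi}.
Proof.
move=> f2 g2; apply: fourier_unique; first exact: L2D.
by apply: (is_ftD locally_finite_space contracts_fourier f2 g2); exact: fourierP.
Qed.

Lemma fourierZ c f : L2 mu f ->
  {ae nu, forall xi, fourier (fun x => c * f x) xi = c * fourier f xi}.
Proof.
move=> f2; apply: fourier_unique; first exact: L2Z.
by apply: (is_ftZ locally_finite_space contracts_fourier c f2); exact: fourierP.
Qed.

Lemma wd2 (op : R[i] -> R[i] -> R[i]) f g : wd f -> wd g -> wd (fun x => op (f x) (g x)).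
Proof. by case: M => //= pf pg x; rewrite pf pg. Qed.

Lemma wd1 (op : R[i] -> R[i]) f : wd f -> wd (fun x => op (f x)).
Proof. by case: M => //= pf x; rewrite pf. Qed.

Lemma L2_spaceP f : L2_space f <-> wd f /\ L2 mu f.
Proof. by split=> [[? ? ?]|[? [? ?]]]; split. Qed.

Lemma L2_space_L2 f : L2_space f -> L2 mu f.
Proof. by move=> /L2_spaceP[]. Qed.

Lemma L2_spaceD f g : L2_space f -> L2_space g -> L2_space (fun x => f x + g x).
Proof.
by move=> /L2_spaceP[pf f2] /L2_spaceP[pg g2]; apply/L2_spaceP; split; [exact: wd2|exact: L2D].
Qed.

Lemma L2_spaceB f g : L2_space f -> L2_space g -> L2_space (fun x => f x - g x).
Proof.
move=> /L2_spaceP[pf f2] /L2_spaceP[pg g2]; apply/L2_spaceP; split; last exact: L2B.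
exact: (wd2 (fun a b => a - b)).
Qed.

Lemma L2_spaceZ (c : R[i]) f : L2_space f -> L2_space (fun x => c * f x).
Proof.
move=> /L2_spaceP[pf f2]; apply/L2_spaceP; split; last exact: L2Z.
exact: (wd1 (fun a => c * a)).
Qed.

(** The characters of the domain are periodic on the torus because its
    frequencies are integers. *)
Lemma tf_freq_wd n g : cmeasurable g -> wd (tf nu 1 n g).
Proof.
case: M => //= mg x; rewrite !tfE; congr (_ * _).
have mt := cmeasurable_truncate n mg.
have mc y : cmeasurable (fun xi : R => cis (1 * (xi * y)) : R[i]).
  by apply: cmeasurable_cis; exact: measurable_lin.
have per : {ae (@freq_measure R Torus), forall xi : R,
    truncate n g xi * cis (1 * (xi * (x + 2 * pi))) = truncate n g xi * cis (1 * (xi * x))}.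
  apply: ae_imp (@ae_nuT R) => xi [k ->]; congr (_ * _); rewrite !mul1r mulrDr cisD.
  rewrite (_ : cis (_ * (2 * pi)) = 1) ?mulr1//.
  have s0 := @sin_intpi R k; rewrite /cis (_ : k%:~R * (2 * pi) = k%:~R * pi + k%:~R * pi); last by ring.
  rewrite cosD sinD s0 !mulr0 !mul0r subr0 addr0 -expr2.
  by have := cos2Dsin2 (k%:~R * pi : R); rewrite s0 expr0n/= addr0 => ->.
have [mR mI] := cmeasurableM mt (mc (x + 2 * pi)).
have [mR' mI'] := cmeasurableM mt (mc x).
apply: complex_eqP; apply: ae_eq_Rintegral => //; by apply: ae_imp per => xi ->.
Qed.

(** On the torus the limit is periodic because the partial sums are, and the
    limit in L^2 was built from pointwise limits. *)
Lemma inverse_exists g : L2 nu g -> exists f, L2_space f /\ is_ft nu mu 1 g f.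
Proof.
move=> g2; have [f [gf fxy]] := ft_exists locally_finite_freq contracts_inverse g2.
exists f; split => //; apply/L2_spaceP; have [mg _] := g2; split; last by case: gf.
have H n := tf_freq_wd n mg; move: fxy H; rewrite /well_defined_on_domain; case: M => //= fxy H x.
by apply: fxy => n; exact: H.
Qed.

(** The inverse transform of m times the transform of f satisfies the conditions
    by which a multiplier is chosen. *)
Lemma multiplierP (m : R -> R[i]) f (C : R) : 0 <= C -> cmeasurable m ->
  (forall xi, normc (m xi) <= C) -> L2 mu f ->
  L2_space (multiplier M m f) /\
  {ae nu, forall xi, fourier (multiplier M m f) xi = m xi * fourier f xi}.
Proof.
move=> C0 mm mC f2.
have g2 : L2 nu (fun xi => m xi * fourier f xi).
  by apply: (L2_bounded C0 mm) (L2_fourier f2); exact: aeW.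
have [h [h2 gh]] := inverse_exists g2.
have H : exists h', [set g | L2_space g /\
    {ae nu, forall xi, fourier g xi = m xi * fourier f xi}] h'.
  by exists h; split => //; exact: (fourier_of_inverse g2 gh).
exact: (@xgetPex _ (fun=> 0) _ H).
Qed.

End Plancherel.

(** * Sobolev norms *)

Section InverseWeight.
Context {R : realType}.
Notation leb := (@lebesgue_measure R).
Implicit Types (f g : R -> R[i]).

Lemma norm2_le_of_energy (mu : {measure set (measurableTypeR R) -> \bar R}) f (C : R) :
  0 <= C -> (energy mu f <= (C ^+ 2)%:E)%E -> (norm2 mu f <= C%:E)%E.
Proof.
move=> C0 fC; rewrite norm2E -[C%:E]gee0_abs// -sqrte_sqr lee_sqrt ?expe2 -?EFinM ?lee_fin ?mulr_ge0//.
Qed.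

Definition japanese (xi : R) : R := Num.sqrt (1 + xi ^+ 2).

Lemma japanese_sqr xi : japanese xi ^+ 2 = 1 + xi ^+ 2.
Proof. by rewrite sqr_sqrtr// addr_ge0// sqr_ge0. Qed.

Lemma japanese_ge1 xi : 1 <= japanese xi.
Proof. by rewrite -{1}(sqrtr1 R) ler_wsqrtr// lerDl sqr_ge0. Qed.

Lemma japanese_gt0 xi : 0 < japanese xi.
Proof. exact: lt_le_trans ltr01 (japanese_ge1 xi). Qed.

Lemma abs_le_japanese xi : `|xi| <= japanese xi.
Proof. by rewrite -sqrtr_sqr ler_wsqrtr// lerDr. Qed.

Lemma japanese_le xi : japanese xi <= 1 + `|xi|.
Proof.
have x0 := normr_ge0 xi; rewrite -[leRHS]ger0_norm ?addr_ge0// -sqrtr_sqr ler_wsqrtr//.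
by rewrite -[xi ^+ 2]real_normK ?num_real//; nra.
Qed.

Lemma measurable_japanese :
  measurable_fun [set: measurableTypeR R] (japanese : measurableTypeR R -> R).
Proof.
apply: continuous_measurable_fun => x; apply: continuous_comp; last exact: sqrt_continuous.
by apply: cvgD; [exact: cvg_cst|exact: exprn_continuous].
Qed.

Definition inverse_japanese xi : R[i] := ((japanese xi)^-1)%:C.

Lemma cmeasurable_inverse_japanese : cmeasurable inverse_japanese.
Proof.
apply: cmeasurableC; apply: continuous_measurable_fun => x.
apply: cvgV; first by rewrite gt_eqF// japanese_gt0.
apply: continuous_comp; last exact: sqrt_continuous.
by apply: cvgD; [exact: cvg_cst|exact: exprn_continuous].
Qed.

Lemma sqr_inverse_japanese xi : normc (inverse_japanese xi) ^+ 2 = 2^-1 * poisson 1 xi.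
Proof.
rewrite normc_C gtr0_norm ?invr_gt0 ?japanese_gt0// exprVn japanese_sqr /poisson expr1n.
by rewrite mulr1 mulrA mulVf ?mul1r// pnatr_eq0.
Qed.

Lemma L2_inverse_japanese_line : L2 leb inverse_japanese.
Proof.
have mw := cmeasurable_inverse_japanese; split => //.
apply: (@le_lt_trans _ _ 3%:E); last exact: ltry.
apply: (@fatou_norm2 _ leb (fun n => truncate n inverse_japanese)) => //.
- by move=> n; exact: cmeasurable_truncate.
- apply: aeW => x; apply: cvg_near_cst; near=> n.
  by rewrite truncate_in ?subrr ?Normc.normc0//; near: n; exact: near_ball0.
apply: nearW => n; apply: norm2_le_of_energy => //.
have n0 : (- n%:R <= n%:R :> R) by rewrite ge0_cp.
have E : (\int[leb]_(x in ball0 n) (poisson 1 (x - 0)%R)%:E =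
    2%:E * energy leb (truncate n inverse_japanese))%E.
  rewrite /energy -ge0_integralZl//; last 2 first.
  - by apply: measurable_sqr_normc; exact: cmeasurable_truncate.
  - by move=> x _; rewrite lee_fin sqr_ge0.
  rewrite [LHS]integral_mkcond; apply: eq_integral => x _; rewrite patchE -EFinM.
  case: ifPn => [/set_mem nx|/negP nx].
    by rewrite truncate_in// sqr_inverse_japanese subr0 mulrA divff ?mul1r ?pnatr_eq0.
  by rewrite truncate_notin ?Normc.normc0 ?expr0n ?mulr0// => /mem_set.
apply: (@le_trans _ _ (2%:E * energy leb (truncate n inverse_japanese))%E).
  by rewrite lee_pemull ?energy_ge0// lee_fin ler1n.
rewrite -E /ball0; apply: (le_trans (integral_poisson_le 0 ltr01 n0)).
by rewrite lee_fin expr2; have := @pi_lt4 R; lra.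
Unshelve. all: by end_near. Qed.

(** On each unit interval the line integral dominates, up to a factor 3, the
    value at the integer end point. *)
Lemma L2_inverse_japanese_torus : L2 (@freq_measure R Torus) inverse_japanese.
Proof.
have mw := cmeasurable_inverse_japanese; apply: energy_lty_L2 => //.
pose G (xi : R) := (normc (inverse_japanese xi) ^+ 2)%:E.
have mG : measurable_fun [set: measurableTypeR R] (G : measurableTypeR R -> \bar R).
  exact: measurable_sqr_normc.
have G0 xi : (0 <= G xi)%E by rewrite lee_fin sqr_ge0.
have GE xi : G xi = ((1 + xi ^+ 2)^-1)%:E.
  by rewrite /G sqr_inverse_japanese /poisson expr1n mulr1 mulrA mulVf ?mul1r// pnatr_eq0.
have mGs th : measurable_fun [set: measurableTypeR R]
    (fun k : measurableTypeR R => G (th + k) : \bar R).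
  by apply: (measurableT_comp mG); exact: measurable_funD.
have step th : 0 <= th < 1 ->
    (energy (@freq_measure R Torus) inverse_japanese <=
     3%:E * \int[@freq_measure R Torus]_k G (th + k)%R)%E.
  move=> /andP[th0 th1]; rewrite -ge0_integralZl//; apply: ge0_le_integral => //.
  - by move=> k _; rewrite lee_fin sqr_ge0.
  - exact: measurable_funeM.
  - move=> k _; rewrite -[leLHS]/(G k) !GE -EFinM lee_fin.
    have p1 : 0 < 1 + k ^+ 2 by rewrite ltr_pwDl// sqr_ge0.
    have p2 : 0 < 1 + (th + k) ^+ 2 by rewrite ltr_pwDl// sqr_ge0.
    rewrite ler_pdivlMr// mulrC ler_pdivrMr//.
    have := sqr_ge0 (th - k); have : th * th <= 1 by rewrite mulr_ile1// ltW.
    by rewrite !expr2; nra.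
have := L2_inverse_japanese_line => -[_ fin].
have : (energy leb inverse_japanese < +oo)%E by rewrite energyE lte_mul_pinfty ?norm2_ge0 ?ge0_fin_numE ?norm2_ge0.
rewrite /energy (integral_unit_intervals mG G0) => fin'.
apply: (@le_lt_trans _ _ (3%:E * \int[leb]_(th in `[0%R, 1%R[) \int[@freq_measure R Torus]_k G (th + k)%R)%E); last first.
  by rewrite lte_mul_pinfty.
have mS : measurable_fun [set: measurableTypeR R]
    (fun th : measurableTypeR R => (\int[@freq_measure R Torus]_k G (th + k)%R)%E).
  apply: (measurable_tonelli_F (@locally_finite_nuT R) (k := fun p => G (p.1 + p.2))) => [|p]; last exact: G0.
  apply: (measurableT_comp mG).
  by apply: measurable_funD; [exact: (@measurable_fst_comp _ id)|exact: (@measurable_snd_comp _ id)].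
rewrite -ge0_integralZl//; last 2 first.
- exact: measurable_funS mS.
- by move=> th _; apply: integral_ge0.
rewrite -[leLHS]mule1 (_ : 1%E = leb `[0%R, 1%R[%classic); last first.
  by rewrite lebesgue_measure_itv/= lte_fin ltr01 oppr0 adde0.
rewrite -integral_cst//; apply: ge0_le_integral => //.
- by move=> th _; exact: energy_ge0.
- by apply: measurable_funeM; exact: measurable_funS mS.
Qed.

Lemma L2_inverse_japanese (M : domain) : L2 (@freq_measure R M) inverse_japanese.
Proof. by case: M; [exact: L2_inverse_japanese_line|exact: L2_inverse_japanese_torus]. Qed.

End InverseWeight.

Section SobolevNorms.
Context {R : realType}.
Variable M : domain.
#[local] Opaque Defs.fourier Defs.multiplier norm2.
Notation mu := (@space_measure R M).
Notation nu := (@freq_measure R M).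
Notation wd := (@well_defined_on_domain R M).
Notation fourier := (@fourier R M).
Notation L2_space := (@L2_space R M).
Implicit Types (f g h k : R -> R[i]).

Lemma nrmZ (c : R[i]) f : L2 nu f -> nrm nu (fun x => c * f x) = normc c * nrm nu f.
Proof. by move=> f2; rewrite /nrm (norm2Z nu c f2.1) (nrmE f2) -EFinM. Qed.

Definition weight (s : nat) (xi : R) : R[i] := (japanese xi ^+ s)%:C.

Lemma cmeasurable_weight s : cmeasurable (weight s).
Proof. apply: cmeasurableC; apply: measurable_funX; exact: measurable_japanese. Qed.

Lemma normc_weight s xi : normc (weight s xi) = japanese xi ^+ s.
Proof. by rewrite normc_C ger0_norm// exprn_ge0// ltW// japanese_gt0. Qed.

Definition weighted s f (xi : R) : R[i] := weight s xi * fourier f xi.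

Definition Hs s f := L2_space f /\ L2 nu (weighted s f).

Definition hnorm s f : R := nrm nu (weighted s f).

Lemma cmeasurable_weighted s f : L2 mu f -> cmeasurable (weighted s f).
Proof. by move=> /L2_fourier[mF _]; apply: cmeasurableM => //; exact: cmeasurable_weight. Qed.

Lemma sobolevP s f : sobolev M s f <-> Hs s f.
Proof.
rewrite /sobolev /sobolev_norm; case: ifPn => [/asboolP f2|/asboolP f2].
  split=> [fin|[_ []]//]; split => //; split => //.
  exact: cmeasurable_weighted (L2_space_L2 f2).
by split => // -[].
Qed.

Lemma sobolev_normE s f : Hs s f -> sobolev_norm M s f = (hnorm s f)%:E.
Proof. by move=> [f2 fs]; rewrite /sobolev_norm asboolT//; exact: nrmE. Qed.

Lemma hnorm_ge0 s f : 0 <= hnorm s f. Proof. exact: nrm_ge0. Qed.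

Lemma sobolev_norm_ge0 s f : (0 <= sobolev_norm M s f)%E.
Proof. by rewrite /sobolev_norm; case: ifP => // _; exact: norm2_ge0. Qed.

Lemma sobolev_norm_lt s f (e : R) : (sobolev_norm M s f < e%:E)%E -> Hs s f /\ hnorm s f < e.
Proof.
move=> fe; have fs : Hs s f by apply/sobolevP; apply: lt_trans fe _; exact: ltry.
by split => //; rewrite -lte_fin -sobolev_normE.
Qed.

Lemma sobolev_norm_le s t f : (s <= t)%N -> (sobolev_norm M s f <= sobolev_norm M t f)%E.
Proof.
move=> st; rewrite /sobolev_norm; case: ifPn => // /asboolP /L2_space_L2 f2.
apply: le_norm2; [exact: cmeasurable_weighted|exact: cmeasurable_weighted|].
apply: aeW => xi; rewrite !normc_M !normc_weight ler_wpM2r ?normc_ge0//.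
by rewrite ler_weXn2l// japanese_ge1.
Qed.

Lemma normc_mulCA_le (a x y : R[i]) (C : R) : 0 <= C -> normc x <= C * normc y ->
  normc (a * x) <= normc (C%:C * (a * y)).
Proof.
by move=> C0 xy; rewrite !normc_M normc_C (ger0_norm C0) mulrCA ler_wpM2l// normc_ge0.
Qed.

(** The estimates for multipliers, scalings and translations are instances of this
    one. *)
Lemma Hs_dominated s f g (C : R) : 0 <= C -> L2_space f ->
  {ae nu, forall xi, normc (fourier f xi) <= C * normc (fourier g xi)} -> Hs s g ->
  Hs s f /\ hnorm s f <= C * hnorm s g.
Proof.
move=> C0 f2 fg [_ gs]; have mf := cmeasurable_weighted s (L2_space_L2 f2).
have Cg := L2Z C%:C gs; have [mCg _] := Cg.
have le : {ae nu, forall xi, normc (weighted s f xi) <= normc (C%:C * weighted s g xi)}.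
  by apply: ae_imp fg => xi le; exact: normc_mulCA_le.
have fs : L2 nu (weighted s f) by exact: L2_normc_le Cg.
split => //; have [mfs _] := fs.
have := norm2_le_nrm fs Cg (le_norm2 mfs mCg le).
by rewrite (nrmZ C%:C gs) normc_C (ger0_norm C0).
Qed.

Lemma HsB s f g : Hs s f -> Hs s g -> Hs s (fun x => f x - g x).
Proof.
move=> [f2 fs] [g2 gs]; have d2 := L2_spaceB f2 g2; split; first exact: d2.
have md := cmeasurable_weighted s (L2_space_L2 d2).
apply: (L2_normc_le md _ (L2B fs gs)).
apply: ae_imp (fourierB (L2_space_L2 f2) (L2_space_L2 g2)) => xi E.
by rewrite /weighted E mulrBr.
Qed.

Lemma HsD s f g : Hs s f -> Hs s g -> Hs s (fun x => f x + g x).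
Proof.
move=> [f2 fs] [g2 gs]; have d2 := L2_spaceD f2 g2; split; first exact: d2.
have md := cmeasurable_weighted s (L2_space_L2 d2).
apply: (L2_normc_le md _ (L2D fs gs)).
apply: ae_imp (fourierD (L2_space_L2 f2) (L2_space_L2 g2)) => xi E.
by rewrite /weighted E mulrDr.
Qed.

Lemma HsZ s c f : Hs s f -> Hs s (fun x => c * f x) /\ hnorm s (fun x => c * f x) <= normc c * hnorm s f.
Proof.
move=> fs; have [f2 _] := fs; apply: Hs_dominated => //; first exact: normc_ge0.
  exact: L2_spaceZ.
by apply: ae_imp (fourierZ c (L2_space_L2 f2)) => xi ->; rewrite normc_M.
Qed.

Lemma hnormD s f g : Hs s f -> Hs s g -> hnorm s (fun x => f x + g x) <= hnorm s f + hnorm s g.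
Proof.
move=> fs gs; have [f2 fs'] := fs; have [g2 gs'] := gs; have [_ [md _]] := HsD fs gs.
apply: le_trans (nrmD fs' gs'); rewrite /hnorm /nrm.
have D2 := L2D fs' gs'; have [mD _] := D2.
rewrite (@eq_norm2 _ nu _ (fun xi => weighted s f xi + weighted s g xi))//.
apply: ae_imp (fourierD (L2_space_L2 f2) (L2_space_L2 g2)) => xi E.
by rewrite /weighted E mulrDr.
Qed.

Lemma hnormN s f : Hs s f -> hnorm s (fun x => - f x) <= hnorm s f.
Proof.
move=> fs; have [_] := HsZ (- 1) fs; rewrite normc_N Normc.normc1 mul1r.
by rewrite (_ : (fun x => -1 * f x) = (fun x => - f x))//; apply/funext => x; rewrite mulN1r.
Qed.

Lemma HsN s f : Hs s f -> Hs s (fun x => - f x).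
Proof.
move=> fs; have [+ _] := HsZ (- 1) fs.
by rewrite (_ : (fun x => -1 * f x) = (fun x => - f x))//; apply/funext => x; rewrite mulN1r.
Qed.

Lemma hnormB s f g : Hs s f -> Hs s g -> hnorm s (fun x => f x - g x) <= hnorm s f + hnorm s g.
Proof.
move=> fs gs; apply: (le_trans (hnormD fs (HsN gs))).
by rewrite lerD2l hnormN.
Qed.

Lemma nrm_le_hnorm s f : Hs s f -> nrm mu f <= hnorm s f.
Proof.
move=> [f2 fs]; have L2f := L2_space_L2 f2; have Ff := L2_fourier L2f.
rewrite /nrm -(norm2_fourier L2f); apply: norm2_le_nrm => //.
have [mF _] := Ff; have [mw _] := fs; apply: le_norm2 => //.
apply: aeW => xi; rewrite normc_M normc_weight ler_peMl ?normc_ge0//.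
by rewrite exprn_ege1// japanese_ge1.
Qed.

Lemma Hs_multiplier s m f (C : R) : 0 <= C -> cmeasurable m ->
  (forall xi, normc (m xi) <= C) -> Hs s f ->
  Hs s (multiplier M m f) /\ hnorm s (multiplier M m f) <= C * hnorm s f.
Proof.
move=> C0 mm mC fs; have [f2 _] := fs.
have [h2 hE] := multiplierP C0 mm mC (L2_space_L2 f2).
apply: Hs_dominated => //; apply: ae_imp hE => xi ->.
by rewrite normc_M ler_wpM2r ?normc_ge0.
Qed.

End SobolevNorms.

(** * Difference quotients *)

Section Translation.
Context {R : realType}.
Notation leb := (@lebesgue_measure R).
Implicit Types (f g h k : R -> R[i]).

Lemma cmeasurable_translate (a : R) f : cmeasurable f -> cmeasurable (fun x => f (x + a)).
Proof.
have ma : measurable_fun [set: measurableTypeR R] (fun x : measurableTypeR R => x + a : measurableTypeR R).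
  exact: measurable_funD.
by move=> [mR mI]; split; [exact: (measurableT_comp mR ma)|exact: (measurableT_comp mI ma)].
Qed.

Lemma integral_itv_split (F : R -> \bar R) (a b c : R) : a <= b -> b <= c ->
  measurable_fun [set: measurableTypeR R] (F : measurableTypeR R -> \bar R) ->
  (forall x, 0 <= F x)%E ->
  (\int[leb]_(x in `[a, c[) F x = \int[leb]_(x in `[a, b[) F x + \int[leb]_(x in `[b, c[) F x)%E.
Proof.
move=> ab bc mF F0.
have -> : `[a, c[%classic = `[a, b[%classic `|` `[b, c[%classic :> set R.
  apply/seteqP; split => x /=; rewrite !in_itv/=.
    by move=> /andP[xa xc]; have [xb|xb] := ltP x b; [left|right]; rewrite ?xa ?xc.
  by case=> /andP[u v]; apply/andP; split; lra.
have mFU : measurable_fun (`[a, b[%classic `|` `[b, c[%classic : set (measurableTypeR R)) F.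
  by apply: measurable_funS mF.
have disj : [disjoint `[a, b[%classic & `[b, c[%classic : set R].
  rewrite disj_set2E; apply/eqP/seteqP; split => x //=; rewrite !in_itv/= => -[/andP[u v] /andP[w z]].
  by move: v; rewrite ltNge w.
by rewrite (ge0_integral_setU _ _ _ mFU _ disj)//.
Qed.

(** The part of the shifted period which sticks out is moved back by one period. *)
Lemma integral_period (F : R -> \bar R) (h : R) : 0 <= h <= 1 ->
  measurable_fun [set: measurableTypeR R] (F : measurableTypeR R -> \bar R) ->
  (forall x, 0 <= F x)%E -> (forall x, F (x + 2 * pi) = F x) ->
  (\int[leb]_(x in `[(- pi)%R, pi[) F (x + h)%R = \int[leb]_(x in `[(- pi)%R, pi[) F x)%E.
Proof.
move=> /andP[h0 h1] mF F0 per; have pi2 := @pi_ge2 R.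
have tr (a b c : R) : (\int[leb]_(x in `[a, b[) F (x + c)%R = \int[leb]_(x in `[(a + c)%R, (b + c)%R[) F x)%E.
  rewrite -(ge0_integral_translation c (measurable_itv _) mF F0); congr (integral _ _ _).
  by apply/seteqP; split => x /=; rewrite !in_itv/= lerD2r ltrD2r.
rewrite tr (@integral_itv_split F (- pi + h) pi (pi + h))//; [|lra|lra].
rewrite (@integral_itv_split F (- pi) (- pi + h) pi)//; [|lra|lra].
rewrite addeC; congr (_ + _)%E; have := tr (- pi) (- pi + h) (2 * pi).
rewrite (_ : - pi + 2 * pi = pi); last by ring.
rewrite (_ : - pi + h + 2 * pi = pi + h); last by ring.
by move=> <-; apply: eq_integral => x _; rewrite per.
Qed.

Lemma energy_translate (M : domain) (h : R) f : 0 <= h <= 1 -> cmeasurable f ->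
  well_defined_on_domain M f ->
  energy (space_measure R M) (fun x => f (x + h)) = energy (space_measure R M) f.
Proof.
move=> h01 mf; have mE := measurable_sqr_normc mf.
have E0 x : (0 <= (normc (f x) ^+ 2)%:E)%E by rewrite lee_fin sqr_ge0.
case: M => /= [_|pf].
  exact: (ge0_integral_translation h measurableT mE E0).
rewrite /energy integral_mrestr; last first.
  by apply: measurable_sqr_normc; exact: cmeasurable_translate.
rewrite integral_mrestr//.
by apply: (integral_period h01 mE E0) => x; rewrite pf.
Qed.

Lemma norm2_translate (M : domain) (h : R) f : 0 <= h <= 1 -> cmeasurable f ->
  well_defined_on_domain M f ->
  norm2 (space_measure R M) (fun x => f (x + h)) = norm2 (space_measure R M) f.
Proof. by move=> h01 mf pf; rewrite !norm2E energy_translate. Qed.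

Lemma wd_translate (M : domain) (h : R) f :
  well_defined_on_domain M f -> well_defined_on_domain M (fun x => f (x + h)).
Proof. by case: M => //= pf x; rewrite -[RHS]pf; congr f; ring. Qed.

Lemma L2_space_translate (M : domain) (h : R) f : 0 <= h <= 1 -> L2_space M f ->
  L2_space M (fun x => f (x + h)).
Proof.
move=> h01 [mf pf f2]; split; first exact: cmeasurable_translate.
  exact: wd_translate.
by rewrite norm2_translate.
Qed.

End Translation.

Section DifferenceQuotients.
Context {R : realType}.
Variable M : domain.
Notation mu := (@space_measure R M).
Notation nu := (@freq_measure R M).
Notation fourier := (@fourier R M).
Notation L2_space := (@L2_space R M).
Notation Hs := (@Hs R M).
Notation hnorm := (@hnorm R M).
#[local] Opaque Defs.fourier Defs.multiplier norm2.
Implicit Types (f g k : R -> R[i]).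

Lemma cmeasurable_character (h : R) : cmeasurable (fun xi : R => cis (h * xi) : R[i]).
Proof.
have := cmeasurable_cis (@measurable_lin R h 1).
by rewrite (_ : (fun x => _) = (fun xi => cis (h * xi)))//; apply/funext => x; rewrite mulr1.
Qed.

Lemma tf_translate n g (x h : R) :
  tf nu 1 n g (x + h) = tf nu 1 n (fun xi => cis (h * xi) * g xi) x.
Proof.
rewrite /tf; congr (_ * cintegral _ _ _); apply/funext => xi.
by rewrite [cis (h * xi) * g xi]mulrC -mulrA -cisD; congr (_ * cis _); ring.
Qed.

(** The identity is exact for truncated integrals, and translation is an isometry
    of L^2, so it passes to the limit. *)
Lemma is_ft_translate f (h : R) : 0 <= h <= 1 -> L2_space f ->
  is_ft nu mu 1 (fun xi => cis (h * xi) * fourier f xi) (fun x => f (x + h)).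
Proof.
move=> h01 fL; have f2 := L2_space_L2 fL; have [[mf pf _] F2] := (fL, L2_fourier f2).
split; first exact: L2_space_L2 (L2_space_translate h01 fL).
have [_ Ff] := inverseP f2; have [mF _] := F2.
have E n : norm2 mu (fun x => tf nu 1 n (fun xi => cis (h * xi) * fourier f xi) x - f (x + h))%R =
    norm2 mu (fun x => tf nu 1 n (fourier f) x - f x)%R.
  have mT : cmeasurable (tf nu 1 n (fourier f)).
    by apply: cmeasurable_tf => //; exact: locally_finite_freq.
  have mD := cmeasurableB mT mf.
  rewrite -(norm2_translate h01 mD); last first.
    by apply: (@wd2 _ _ (fun a b => a - b)) => //; exact: tf_freq_wd.
  by congr norm2; apply/funext => x; rewrite tf_translate.
rewrite /L2_cvg (_ : (fun n => _) = (fun n => norm2 mu (fun x => tf nu 1 n (fourier f) x - f x)%R)) //.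
by apply/funext => n; exact: E.
Qed.

Lemma L2_character (h : R) g : L2 nu g -> L2 nu (fun xi => cis (h * xi) * g xi).
Proof.
apply: (@L2_bounded _ _ 1) => //; first exact: cmeasurable_character.
by apply: aeW => xi; rewrite normc_cis.
Qed.

(** On the frequency side the increment of step h is multiplication by
    e^{i h xi} - 1. *)
Lemma norm2_increment f (h : R) : 0 <= h <= 1 -> L2_space f ->
  norm2 mu (fun x => f (x + h) - f x)%R = norm2 nu (fun xi => (cis (h * xi) - 1) * fourier f xi)%R.
Proof.
move=> h01 fL; have f2 := L2_space_L2 fL; have F2 := L2_fourier f2.
have C2 := L2_character h F2.
have H := is_ftB (@locally_finite_freq R M) (@contracts_inverse R M) C2 F2
  (is_ft_translate h01 fL) (inverseP f2).
rewrite (norm2_inverse (L2B C2 F2) H); congr norm2; apply/funext => xi.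
by rewrite mulrBl mul1r.
Qed.

Lemma Hs_translate s f (h : R) : 0 <= h <= 1 -> Hs s f ->
  Hs s (fun x => f (x + h)) /\ hnorm s (fun x => f (x + h)) <= hnorm s f.
Proof.
move=> h01 fs; have [fL _] := fs; have F2 := L2_fourier (L2_space_L2 fL).
have L2t := L2_space_translate h01 fL; rewrite -[hnorm s f]mul1r.
apply: (Hs_dominated ler01 L2t _ fs).
apply: ae_imp (fourier_of_inverse (L2_character h F2) (is_ft_translate h01 fL)) => xi ->.
by rewrite normc_M normc_cis.
Qed.

Lemma nrm_increment_le f (h : R) : 0 <= h <= 1 -> Hs 1 f ->
  nrm mu (fun x => f (x + h) - f x) <= h * hnorm 1 f.
Proof.
move=> h01 fs; have [fL f1] := fs; have F2 := L2_fourier (L2_space_L2 fL).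
have [h0 _] := andP h01; have [mF _] := F2; have [mw _] := f1.
have mc : cmeasurable (fun xi : R => cis (h * xi) - 1 : R[i]).
  by apply: cmeasurableB; [exact: cmeasurable_character|exact: cmeasurable_cst].
have hf := nrmZ h%:C f1; rewrite normc_C (ger0_norm h0) in hf.
rewrite /hnorm -hf; have C2 := L2_character h F2.
have [mhf _] := L2Z h%:C f1.
rewrite {1}/nrm norm2_increment//.
apply: norm2_le_nrm; last apply: le_norm2.
- have := L2B C2 F2; rewrite (_ : (fun x => _ - _) = (fun xi => (cis (h * xi) - 1) * fourier f xi))//.
  by apply/funext => xi; rewrite mulrBl mul1r.
- exact: L2Z.
- exact: cmeasurableM.
- exact: mhf.
- apply: aeW => xi; rewrite /weighted.
  rewrite (normc_M h%:C) normc_C (ger0_norm h0) (normc_M (weight 1 xi) (fourier f xi)) mulrA.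
  rewrite (normc_M (cis (h * xi) - 1) (fourier f xi)) ler_wpM2r ?normc_ge0//.
  rewrite normc_weight expr1; apply: (le_trans (normc_cisB1_le _)).
  by rewrite normrM (ger0_norm h0) ler_wpM2l ?abs_le_japanese.
Qed.

(** The mean value theorem, with cos c >= 1/2 for |c| <= 1. *)
Lemma half_le_abs_sin (x : R) : `|x| <= 1 -> `|x| / 2 <= `|sin x|.
Proof.
wlog x0 : x / 0 <= x.
  move=> H; have [x0|x0] := leP 0 x; first exact: H.
  by rewrite -[`|sin x|]normrN -sinN -(normrN x); apply: H; rewrite oppr_ge0 ltW.
rewrite (ger0_norm x0); move: x0; rewrite le_eqVlt => /orP[/eqP <-|x0 x1].
  by rewrite sin0 normr0 mul0r.
have csin : {within `[0, x], continuous (@sin R)}.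
  by apply: continuous_subspaceT; exact: continuous_sin.
have [c] := MVT x0 (fun y _ => is_derive_sin y) csin.
rewrite in_itv/= sin0 !subr0 => /andP[c0 cx] ->.
have : 1 - 2 * sin (c / 2) ^+ 2 = cos c.
  have -> : cos c = cos (c / 2 + c / 2) by congr cos; lra.
  by rewrite cosD -!expr2; have /(canRL (addrK _)) -> := cos2Dsin2 (c / 2); ring.
have sc : sin (c / 2) ^+ 2 <= 2^-1 ^+ 2.
  rewrite -[sin _ ^+ 2]real_normK ?num_real// lerXn2r ?nnegrE//.
  by apply: (le_trans (ler_sin _)); rewrite ger0_norm; lra.
move=> cE; have ch : 2^-1 <= cos c by rewrite -cE; move: sc; rewrite !expr2; lra.
rewrite normrM (gtr0_norm x0) mulrC ler_wpM2r ?(ltW x0)//.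
by rewrite ger0_norm//; lra.
Qed.

(** Conversely, bounded difference quotients put a function in H^1: at
    frequencies below 1/h the increment of step h sees at least half of the
    derivative. *)
Lemma Hs1_of_increments f (K : R) : 0 <= K -> L2_space f ->
  (forall h, 0 <= h <= 1 -> (norm2 mu (fun x => f (x + h) - f x)%R <= (h * K)%:E)%E) ->
  Hs 1 f /\ hnorm 1 f <= nrm mu f + 2 * K.
Proof.
move=> K0 fL fK; have f2 := L2_space_L2 fL; have F2 := L2_fourier f2; have [mF _] := F2.
have mX : cmeasurable (fun xi : R => xi%:C) by apply: cmeasurableC.
have mXF := cmeasurableM mX mF.
have D2 : (norm2 nu (fun xi => xi%:C * fourier f xi)%R <= (2 * K)%:E)%E.
  apply: (@fatou_norm2 _ nu (fun n => truncate n (fun xi => xi%:C * fourier f xi))) => //.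
  - by move=> n; exact: cmeasurable_truncate.
  - apply: aeW => x; apply: cvg_near_cst; near=> n.
    by rewrite truncate_in ?subrr ?Normc.normc0//; near: n; exact: near_ball0.
  - by rewrite mulr_ge0.
  - near=> n.
    have n0 : (0 : R) < n%:R by rewrite ltr0n; near: n; exists 1%N.
    pose h : R := n%:R^-1; have h0 : 0 < h by rewrite invr_gt0.
    have h1 : h <= 1 by rewrite invf_le1// ler1n; near: n; exists 1%N.
    have h01 : 0 <= h <= 1 by rewrite ltW.
    have mc : cmeasurable (fun xi : R => cis (h * xi) - 1 : R[i]).
      by apply: cmeasurableB; [exact: cmeasurable_character|exact: cmeasurable_cst].
    have mI := cmeasurableM mc mF.
    apply: (@le_trans _ _ (norm2 nu (fun xi => (2 * h^-1)%:C * ((cis (h * xi) - 1) * fourier f xi))%R)).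
      apply: le_norm2.
      - exact: cmeasurable_truncate.
      - by apply: cmeasurableM => //; exact: cmeasurable_cst.
      - apply: aeW => xi; have [nx|nx] := pselect (ball0 n xi); last first.
          by rewrite truncate_notin// Normc.normc0 normc_ge0.
        rewrite truncate_in// (normc_M xi%:C) (normc_M (2 * h^-1)%:C) (normc_M (_ - 1) (fourier f xi)).
        rewrite mulrA ler_wpM2r ?normc_ge0// !normc_C normc_cisB1_half.
        have h20 : 0 < 2 * h^-1 by rewrite mulr_gt0// invr_gt0.
        rewrite (gtr0_norm h20).
        have xn : `|h * xi| <= 1.
          rewrite normrM (gtr0_norm h0) /h mulrC ler_pdivrMr// mul1r.
          by move: nx; rewrite /ball0 /= in_itv/= -ler_norml.
        have := @half_le_abs_sin (h * xi / 2).
        rewrite normrM [`|2^-1|]gtr0_norm ?invr_gt0// => /(_ _)/[!normrM].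
        rewrite (gtr0_norm h0) => H.
        have {}H : h * `|xi| / 2 / 2 <= `|sin (h * xi / 2)|.
          by apply: H; move: xn; rewrite normrM (gtr0_norm h0); lra.
        rewrite (_ : 2 * h^-1 * (2 * `|sin (h * xi / 2)|) = 4 * `|sin (h * xi / 2)| / h); last by ring.
        by rewrite ler_pdivlMr// [`|xi| * h]mulrC; lra.
    rewrite norm2Z// normc_C gtr0_norm ?mulr_gt0 ?invr_gt0// -norm2_increment//.
    apply: (@le_trans _ _ ((2 * h^-1)%:E * (h * K)%:E)%E).
      apply: lee_wpmul2l; first by rewrite lee_fin ltW// mulr_gt0// invr_gt0.
      exact: fK.
    by rewrite -EFinM lee_fin mulrA -(mulrA 2) mulVf ?mulr1// gt_eqF.
have XF2 : L2 nu (fun xi => xi%:C * fourier f xi).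
  by split => //; apply: (le_lt_trans D2); exact: ltry.
have mw := cmeasurable_weighted 1 f2.
pose S (xi : R) : R[i] := (normc (fourier f xi))%:C + (normc (xi%:C * fourier f xi))%:C.
have mA := cmeasurableC (measurable_normc mF).
have mB := cmeasurableC (measurable_normc mXF).
have wS : (norm2 nu (weighted M 1 f) <= (nrm mu f + 2 * K)%:E)%E.
  apply: (@le_trans _ _ (norm2 nu S)).
    apply: le_norm2 => //; first exact: cmeasurableD.
    apply: aeW => xi.
    have -> : normc (S xi) = normc (fourier f xi) + normc (xi%:C * fourier f xi).
      by rewrite /S -rmorphD normc_C ger0_norm// addr_ge0 ?normc_ge0.
    rewrite /weighted (normc_M (weight 1 xi) (fourier f xi)) (normc_M xi%:C) normc_weight expr1 normc_C.
    by rewrite -[X in _ <= X + _]mul1r -mulrDl ler_wpM2r ?normc_ge0// japanese_le.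
  apply: (le_trans (norm2D nu mA mB)); rewrite EFinD.
  apply: leeD.
    rewrite -nrmE// -norm2_fourier// le_eqVlt; apply/orP; left; apply/eqP.
    by apply: eq_norm2_normc => xi; rewrite normc_C ger0_norm ?normc_ge0.
  apply: le_trans D2; rewrite le_eqVlt; apply/orP; left; apply/eqP.
  by apply: eq_norm2_normc => xi; rewrite normc_C ger0_norm ?normc_ge0.
have w2 : L2 nu (weighted M 1 f) by split => //; apply: (le_lt_trans wS); exact: ltry.
split; first by split.
by rewrite -lee_fin /hnorm -nrmE.
Unshelve. all: by end_near. Qed.

End DifferenceQuotients.

(** * The algebra H^1 *)

Section Embedding.
Context {R : realType}.
Implicit Types (mu nu : {measure set (measurableTypeR R) -> \bar R}) (f g k : R -> R[i]).

(** The excess (|g| - B)_+ is dominated by |a n - g|. *)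
Lemma L2_cvg_bounded nu a g (B : R) : (forall n, cmeasurable (a n)) -> cmeasurable g ->
  L2_cvg nu a g -> (forall n x, normc (a n x) <= B) -> {ae nu, forall x, normc (g x) <= B}.
Proof.
move=> ma mg ag aB.
pose d (x : R) : R[i] := (Num.max (normc (g x) - B) 0)%:C.
have md : cmeasurable d.
  apply: cmeasurableC; apply: measurable_maxr; last exact: measurable_cst.
  by apply: measurable_funB; [exact: measurable_normc|exact: measurable_cst].
have dle n : (norm2 nu d <= norm2 nu (fun x => a n x - g x)%R)%E.
  apply: le_norm2 => //; first exact: cmeasurableB.
  apply: aeW => x; rewrite /d normc_C ger0_norm ?le_max ?lexx ?orbT//.
  rewrite ge_max normc_ge0 andbT normcBC.
  have := aB n x; have := normcD (g x - a n x) (a n x); rewrite subrK; lra.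
have d0 : norm2 nu d = 0.
  apply/eqP; rewrite eq_le norm2_ge0 andbT; apply/lee_addgt0Pr => e e0; rewrite add0e.
  have /cvge0P := ag => /(_ (fun n => norm2_ge0 _ _) e e0)[N _ /(_ N (leqnn N))] H.
  exact: le_trans (dle N) (ltW H).
apply: ae_imp (norm2_eq0 md d0) => x /(congr1 (@complex.Re R)) /= dx.
by rewrite -subr_le0 -dx le_max lexx.
Qed.

Variable M : domain.
Notation mu := (@space_measure R M).
Notation nu := (@freq_measure R M).
Notation fourier := (@fourier R M).
Notation L2_space := (@L2_space R M).
Notation Hs := (@Hs R M).
Notation hnorm := (@hnorm R M).
#[local] Opaque Defs.fourier Defs.multiplier norm2.

Definition embedding_cst : R := normalization * (2 * nrm nu inverse_japanese).

Lemma embedding_cst_ge0 : 0 <= embedding_cst.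
Proof. apply: mulr_ge0; first exact: ltW normalization_gt0.
by rewrite mulr_ge0// nrm_ge0. Qed.

Lemma integral_fourier_le f : Hs 1 f ->
  (\int[nu]_xi (normc (fourier f xi))%:E <= (nrm nu inverse_japanese * hnorm 1 f)%:E)%E.
Proof.
move=> [fL fs]; have [mF _] := L2_fourier (L2_space_L2 fL).
pose g (xi : R) : R[i] := (normc (weighted M 1 f xi))%:C.
have [mw w2] := fs; have mg : cmeasurable g by apply: cmeasurableC; exact: measurable_normc.
have gE : norm2 nu g = norm2 nu (weighted M 1 f).
  by apply: eq_norm2_normc => xi; rewrite normc_C ger0_norm ?normc_ge0.
have g2 : L2 nu g by split => //; rewrite gE.
have j2 := @L2_inverse_japanese R M.
have E xi : Re (inverse_japanese xi * (g xi)^*) = normc (fourier f xi).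
  rewrite /inverse_japanese /g Re_M !ReImE /= mul0r subr0 /weighted.
  rewrite (normc_M (weight 1 xi) (fourier f xi)) normc_weight expr1 mulrA mulVf ?mul1r//.
  by rewrite gt_eqF// japanese_gt0.
have [_ fin] := integrableP _ _ _ (ip_integrable j2 g2).
have finE : (\int[nu]_xi (normc (fourier f xi))%:E)%E \is a fin_num.
  rewrite ge0_fin_numE; last by apply: integral_ge0 => xi _; rewrite lee_fin normc_ge0.
  apply: le_lt_trans fin; apply: ge0_le_integral => //.
  - by move=> xi _; rewrite lee_fin normc_ge0.
  - by apply/measurable_EFinP; exact: measurable_normc.
  - apply: measurableT_comp => //; apply/measurable_EFinP.
    by have [mj _] := j2; exact: measurable_ReJ.
  - by move=> xi _; rewrite E /= lee_fin ger0_norm ?normc_ge0.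
rewrite -(fineK finE) lee_fin.
have ipE : ip nu inverse_japanese g = \int[nu]_xi normc (fourier f xi).
  by apply: eq_Rintegral => xi _; exact: E.
have := ip_CauchySchwarz j2 g2; rewrite ipE.
by move=> /(le_trans (ler_norm _)); rewrite /hnorm (_ : nrm nu g = nrm nu (weighted M 1 f))// /nrm gE.
Qed.

(** The transform of f is integrable by Cauchy-Schwarz, as the inverse weight is
    square integrable; f is the limit in the mean of its inverse truncated
    integrals, which are bounded by this integral. *)
Lemma Hs1_bounded f : Hs 1 f ->
  {ae mu, forall x, normc (f x) <= embedding_cst * hnorm 1 f}.
Proof.
move=> fs; have [fL _] := fs; have f2 := L2_space_L2 fL; have F2 := L2_fourier f2.
have [mF _] := F2; have [_ Ff] := inverseP f2; have [mf _ _] := fL.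
apply: (L2_cvg_bounded _ mf Ff) => [n|n x].
  by apply: cmeasurable_tf => //; exact: locally_finite_freq.
apply: (le_trans (tf_le 1 n x (@locally_finite_freq R M) F2)).
rewrite /embedding_cst -(mulrA normalization) -(mulrA 2).
apply: ler_wpM2l; first exact: ltW normalization_gt0.
apply: ler_wpM2l => //.
have le1 := integral_fourier_le fs.
have fin (k : R -> R[i]) : cmeasurable k -> (forall x, normc (k x) <= normc (fourier f x)) ->
    (\int[nu]_xi (normc (k xi))%:E <= (nrm nu inverse_japanese * hnorm 1 f)%:E)%E.
  move=> mk kF; apply: le_trans le1; apply: ge0_le_integral => //.
  - by move=> xi _; rewrite lee_fin normc_ge0.
  - by apply/measurable_EFinP; exact: measurable_normc.
  - by apply/measurable_EFinP; exact: measurable_normc.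
  - by move=> xi _; rewrite lee_fin.
have := fin _ (cmeasurable_truncate n mF) (fun x => normc_truncate n (fourier f) x).
have i0 : (0 <= \int[nu]_xi (normc (truncate n (fourier f) xi))%:E)%E.
  by apply: integral_ge0 => xi _; rewrite lee_fin normc_ge0.
by move=> H; rewrite -lee_fin fineK// ge0_fin_numE// (le_lt_trans H)// ltry.
Qed.

End Embedding.

Section Algebra.
Context {R : realType}.
#[local] Opaque Defs.fourier Defs.multiplier norm2 hnorm embedding_cst.
Variable M : domain.
Notation mu := (@space_measure R M).
Notation nu := (@freq_measure R M).
Notation fourier := (@fourier R M).
Notation L2_space := (@L2_space R M).
Notation Hs := (@Hs R M).
Notation hnorm := (@hnorm R M).
Implicit Types (f g k : R -> R[i]).
Local Notation C := (@embedding_cst R M).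

Lemma norm2_H1M f g : Hs 1 f -> L2 mu g ->
  (norm2 mu (fun x => f x * g x)%R <= (C * hnorm 1 f * nrm mu g)%:E)%E.
Proof.
move=> fs g2; have [[mf _ _] _] := fs; have [mg _] := g2.
rewrite (EFinM (C * hnorm 1 f)) -(nrmE g2); apply: norm2_bounded => //.
  exact: (mulr_ge0 (embedding_cst_ge0 M) (hnorm_ge0 M 1 f)).
exact: Hs1_bounded.
Qed.

Lemma L2_spaceM f g : Hs 1 f -> L2_space g -> L2_space (fun x => f x * g x).
Proof.
move=> fs gL; have [[mf pf _] _] := fs; have [mg pg _] := gL; split.
- exact: cmeasurableM.
- exact: (@wd2 _ _ (fun a b => a * b)).
- by apply: (le_lt_trans (norm2_H1M fs (L2_space_L2 gL))); exact: ltry.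
Qed.

Definition algebra_cst : R := 5 * C.

Lemma algebra_cst_ge0 : 0 <= algebra_cst.
Proof. by rewrite /algebra_cst mulr_ge0// embedding_cst_ge0. Qed.

(** By the product rule for increments, one factor being bounded each time. *)
Lemma Hs1M f g : Hs 1 f -> Hs 1 g ->
  Hs 1 (fun x => f x * g x) /\
  hnorm 1 (fun x => f x * g x) <= algebra_cst * hnorm 1 f * hnorm 1 g.
Proof.
move=> fs gs; have [fL _] := fs; have [gL _] := gs.
have C0 : 0 <= C := embedding_cst_ge0 M.
have hf0 := hnorm_ge0 M 1 f; have hg0 := hnorm_ge0 M 1 g.
have fgL := L2_spaceM fs gL; have fg2 := L2_space_L2 fgL.
pose K : R := 2 * (C * hnorm 1 f * hnorm 1 g).
have K0 : 0 <= K := mulr_ge0 (ler0n _ 2) (mulr_ge0 (mulr_ge0 C0 hf0) hg0).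
have inc (h : R) : 0 <= h <= 1 ->
    (norm2 mu (fun x => (f (x + h) * g (x + h)) - f x * g x)%R <= (h * K)%:E)%E.
  move=> h01; have [h0 _] := andP h01.
  have [fs' fle] := Hs_translate h01 fs; have [gs' gle] := Hs_translate h01 gs.
  have f'L : L2_space (fun x => f (x + h)) by case: fs'.
  have g'L : L2_space (fun x => g (x + h)) by case: gs'.
  have dg := L2_spaceB g'L gL; have df := L2_spaceB f'L fL.
  have [mfg _ _] := L2_spaceM fs' dg; have [mgf _ _] := L2_spaceM gs df.
  have -> : norm2 mu (fun x => (f (x + h) * g (x + h)) - f x * g x)%R =
      norm2 mu (fun x => f (x + h) * (g (x + h) - g x) + g x * (f (x + h) - f x))%R.
    by apply: eq_norm2_normc => x; congr normc; ring.
  apply: (le_trans (norm2D mu mfg mgf)).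
  have -> : h * K = C * hnorm 1 f * (h * hnorm 1 g) + C * hnorm 1 g * (h * hnorm 1 f).
    by rewrite /K; move: (hnorm 1 f) (hnorm 1 g) C => a b c; ring.
  rewrite EFinD; apply: leeD.
    apply: (le_trans (norm2_H1M fs' (L2_space_L2 dg))); rewrite lee_fin.
    exact: (ler_pM (mulr_ge0 C0 (hnorm_ge0 M 1 _)) (nrm_ge0 _ _) (ler_wpM2l C0 fle)
      (nrm_increment_le h01 gs)).
  apply: (le_trans (norm2_H1M gs (L2_space_L2 df))); rewrite lee_fin.
  exact: (ler_wpM2l (mulr_ge0 C0 hg0) (nrm_increment_le h01 fs)).
have [fgs fgle] := Hs1_of_increments K0 fgL inc; split => //.
apply: (le_trans fgle); have : nrm mu (fun x => f x * g x) <= C * hnorm 1 f * hnorm 1 g.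
  rewrite -lee_fin -(nrmE fg2); apply: (le_trans (norm2_H1M fs (L2_space_L2 gL))).
  rewrite lee_fin; exact: (ler_wpM2l (mulr_ge0 C0 hf0) (nrm_le_hnorm gs)).
have arith (n c a b : R) : n <= c * a * b -> n + 2 * (2 * (c * a * b)) <= 5 * c * a * b.
  by clear; rewrite -(mulrA 5) -(mulrA 5); move: (c * a * b) => p; lra.
exact: arith.
Qed.

(** Conjugation does not change the modulus of increments; the factor 3 comes from
    their characterization of H^1. *)
Lemma Hs1J f : Hs 1 f -> Hs 1 (fun x => (f x)^*) /\ hnorm 1 (fun x => (f x)^*) <= 3 * hnorm 1 f.
Proof.
move=> fs; have [fL _] := fs; have [mf pf f2] := fL.
have EJ : norm2 mu (fun x => (f x)^*) = norm2 mu f.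
  by apply: eq_norm2_normc => x; rewrite normc_J.
have JL : L2_space (fun x => (f x)^*).
  split; [exact: cmeasurableJ|exact: (@wd1 _ _ (fun a => a^*))|by rewrite EJ].
have inc (h : R) : 0 <= h <= 1 ->
    (norm2 mu (fun x => (f (x + h))^* - (f x)^*)%R <= (h * hnorm 1 f)%:E)%E.
  move=> h01; have := nrm_increment_le h01 fs.
  have f'L := L2_space_translate h01 fL; have d2 := L2_space_L2 (L2_spaceB f'L fL).
  rewrite -lee_fin -(nrmE d2); apply: le_trans; rewrite le_eqVlt; apply/orP; left; apply/eqP.
  by apply: eq_norm2_normc => x; rewrite -normc_J -rmorphB /= ?conjcK.
have [Js Jle] := Hs1_of_increments (hnorm_ge0 M 1 f) JL inc; split => //.
apply: (le_trans Jle); have := nrm_le_hnorm fs.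
have -> : nrm mu (fun x => (f x)^*) = nrm mu f by rewrite /nrm EJ.
by clear; move: (nrm _ _) (hnorm _ _) => a b; lra.
Qed.

End Algebra.

(** * A discrete Gronwall inequality with bootstrap *)

Section Gronwall.
Context {R : realType}.
Implicit Types (phi : R -> R).

(** The right-hand side telescopes, and each of its increments is at least the
    corresponding term because e^z >= 1 + z. *)
Lemma riemann_sum_exp (y : R) (n : nat) : (0 < n)%N -> 0 <= y ->
  \sum_(k < n) y / n%:R * expR (y * k%:R / n%:R) <= expR y - 1.
Proof.
move=> n0 y0; have nR : n%:R != 0 :> R by rewrite pnatr_eq0 -lt0n.
pose e (k : nat) := expR (y * k%:R / n%:R).
have -> : expR y - 1 = e n - e 0%N by rewrite /e mulfK// mulr0 mul0r expR0.
rewrite -(telescope_sumr e (leq0n n)) big_mkord; apply: ler_sum => k _.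
have -> : e k.+1 = e k * expR (y / n%:R).
  by rewrite /e -expRD; congr expR; rewrite -natr1; field.
rewrite -[X in _ <= _ - X]mulr1 -mulrBr mulrC ler_wpM2l ?expR_ge0//.
have := expR_ge1Dx (y / n%:R); lra.
Qed.

Variables (phi : R -> R) (T L delta : R).
Hypotheses (T0 : 0 <= T) (L0 : 0 < L) (delta0 : 0 <= delta).
Hypotheses (phi0 : forall r, 0 <= phi r) (cphi : continuous phi).
Hypothesis init : phi 0 <= delta.
Hypothesis iter : forall r, 0 <= r <= T -> (forall p, 0 <= p <= r -> phi p <= 1) ->
  forall eta, 0 < eta -> exists n : nat, (0 < n)%N /\
    phi r <= delta + eta + L * \sum_(k < n) r / n%:R * phi (r * k%:R / n%:R).
Hypothesis small : 2 * delta * expR (2 * L * T) < 1.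

(** Let A be the supremum of phi(r) exp(- 2 L r).  Replacing phi by A exp(2 L r) in
    the sum gives at most A exp(2 L r) / 2, whence A <= delta + A / 2. *)
Lemma gronwall_step r0 : 0 <= r0 <= T -> (forall p, 0 <= p <= r0 -> phi p <= 1) ->
  forall r, 0 <= r <= r0 -> phi r <= 2 * delta * expR (2 * L * r).
Proof.
move=> /andP[r00 r0T] phi1.
pose w (p : R) := phi p * expR (- (2 * L * p)).
pose S := [set w p | p in `[0, r0]%classic].
have SP p : 0 <= p <= r0 -> S (w p) by move=> h; exists p => //; rewrite /= in_itv.
have w1 p : 0 <= p <= r0 -> w p <= 1.
  move=> h; have [p0 _] := andP h; rewrite -[1]mulr1 /w; apply: ler_pM => //.
    exact: phi1.
  by rewrite -expR0 ler_expR oppr_le0 mulr_ge0// mulr_ge0// ltW.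
have Ssup : has_sup S.
  split; first by exists (w 0); apply: SP; rewrite lexx.
  by exists 1 => _ [p + <-]; rewrite /= in_itv; exact: w1.
pose A := sup S.
have wA p : 0 <= p <= r0 -> w p <= A by move=> h; apply: sup_upper_bound => //; exact: SP.
have phiA p : 0 <= p <= r0 -> phi p <= A * expR (2 * L * p).
  by move=> h; have := wA p h; rewrite /w expRN ler_pdivrMr ?expR_gt0//.
have A0 : 0 <= A.
  by apply: le_trans (wA 0 _); [rewrite /w mulr_ge0 ?expR_ge0|rewrite lexx].
have half : A <= delta + A / 2.
  apply: sup_le_ub; first by exists (w 0); apply: SP; rewrite lexx.
  move=> _ [r + <-]; rewrite /= in_itv => h; have [rr0 rr1] := andP h.
  apply/ler_addgt0Pr => eta eta0.
  have [n [n0 rn]] := iter (r := r) (introT andP (conj rr0 (le_trans rr1 r0T)))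
    (fun p hp => phi1 p (introT andP (conj (proj1 (andP hp)) (le_trans (proj2 (andP hp)) rr1)))) eta0.
  have nR : 0 < n%:R :> R by rewrite ltr0n.
  have y0 : 0 <= 2 * L * r by rewrite mulr_ge0// mulr_ge0// ltW.
  have sum_le : L * (\sum_(k < n) r / n%:R * phi (r * k%:R / n%:R)) <=
      A / 2 * (expR (2 * L * r) - 1).
    apply: (@le_trans _ _ (A / 2 * \sum_(k < n) (2 * L * r) / n%:R * expR (2 * L * r * k%:R / n%:R))).
      rewrite !mulr_sumr; apply: ler_sum => k _.
      have hk : 0 <= r * k%:R / n%:R <= r0.
        rewrite divr_ge0 ?mulr_ge0//=; apply: le_trans rr1.
        by rewrite ler_pdivrMr// ler_wpM2l// ler_nat ltnW.
      have := phiA _ hk; rewrite (_ : 2 * L * (_ / _) = 2 * L * r * k%:R / n%:R); last by rewrite !mulrA.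
      move: (expR _) (phi _) => e p pe.
      rewrite (_ : A / 2 * _ = L * (r / n%:R * (A * e))); last by field; rewrite gt_eqF.
      by apply: ler_wpM2l; [exact: ltW|apply: ler_wpM2l => //; rewrite divr_ge0].
    by apply: ler_wpM2l; [rewrite divr_ge0|exact: riemann_sum_exp].
  have {}rn := le_trans rn (lerD (lexx _) sum_le).
  rewrite /w expRN ler_pdivrMr ?expR_gt0//; apply: (le_trans rn).
  have e1 : 1 <= expR (2 * L * r) by rewrite -[leLHS]expR0 ler_expR.
  move: (expR _) e1 => e e1; have : 0 <= (delta + eta) * (e - 1).
    by rewrite mulr_ge0 ?subr_ge0// addr_ge0// ltW.
  by have := A0; nra.
move=> r h; apply: (le_trans (phiA r h)); apply: ler_wpM2r; first exact: expR_ge0.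
by move: half; lra.
Qed.

(** The times up to which phi <= 1 form an interval from 0.  At its end point c, the
    bound of the previous lemma is less than 1, so by continuity c = T. *)
Lemma gronwall r : 0 <= r <= T -> phi r <= 2 * delta * expR (2 * L * T).
Proof.
have ctn (c e : R) : 0 < e -> exists2 d, 0 < d & forall p, `|c - p| < d -> `|phi c - phi p| < e.
  have cc : phi x @[x --> c] --> phi c by exact: cphi.
  by move: cc => /cvgrPdist_lt H e0; have := H e e0 => /nbhs_ballP[d d0 Hd]; exists d.
pose S := [set r : R | 0 <= r <= T /\ forall p, 0 <= p <= r -> phi p <= 1].
have E1 : 1 <= expR (2 * L * T) by rewrite -[leLHS]expR0 ler_expR mulr_ge0// mulr_ge0// ltW.
have d1 : delta <= 1 by have := small; nra.
have bnd p : 0 <= p <= T -> S p -> phi p <= 2 * delta * expR (2 * L * T).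
  move=> hp [_ p1]; have [p0 pT] := andP hp.
  apply: (le_trans (gronwall_step hp p1 (r := p) _)); first by rewrite p0 lexx.
  apply: ler_wpM2l; first by rewrite mulr_ge0.
  by rewrite ler_expR ler_wpM2l// mulr_ge0// ltW.
have S0 : S 0.
  split; first by rewrite lexx.
  move=> p /andP[p0 p0']; rewrite (_ : p = 0); last by apply/eqP; rewrite eq_le p0 p0'.
  exact: le_trans init d1.
have Ssup : has_sup S by split; [exists 0|exists T => p [/andP[]]].
pose c := sup S.
have c0 : 0 <= c by exact: sup_upper_bound.
have cT : c <= T by apply: sup_le_ub; [exists 0|move=> p [/andP[]]].
have below p : 0 <= p < c -> phi p <= 1.
  move=> /andP[p0 pc]; have pc' : 0 < c - p by rewrite subr_gt0.
  have [q [_ q1] pq] := sup_adherent pc' Ssup.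
  by apply: q1; rewrite p0 ltW//; move: pq; rewrite -/c; lra.
have cS : S c.
  split; first by rewrite c0.
  have c1 : phi c <= 1.
    rewrite leNgt; apply/negP => pc.
    have pc1 : 0 < phi c - 1 by rewrite subr_gt0.
    have [e e0 He] := ctn c _ pc1.
    have [cz|cz] := eqVneq c 0; first by have [_ /(_ 0)] := S0; rewrite lexx -cz leNgt pc => /(_ isT).
    have cpos : 0 < c by rewrite lt_neqAle eq_sym cz.
    pose p := Num.max 0 (c - e / 2).
    have pc' : p < c by rewrite /p gt_max cpos/=; lra.
    have p0 : 0 <= p by rewrite /p le_max lexx.
    have := below p; rewrite p0 pc' => /(_ isT).
    have /He : `|c - p| < e.
      rewrite gtr0_norm ?subr_gt0//.
      have : c - e / 2 <= p by rewrite /p le_max lexx orbT.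
      lra.
    by rewrite ltr_norml => /andP[_]; lra.
  move=> p /andP[p0]; rewrite le_eqVlt => /orP[/eqP -> //|pc].
  by apply: below; rewrite p0.
have [cE|cT'] : c = T \/ c < T.
  by move: cT; rewrite le_eqVlt => /orP[/eqP|]; [left|right].
  move=> /andP[r0 rT]; apply: bnd; first by rewrite r0.
  split; first by rewrite r0.
  move=> p /andP[p0 pr]; have [_] := cS; apply; rewrite p0 cE/=; exact: le_trans pr rT.
exfalso; have cb : phi c < 1.
  by apply: le_lt_trans small; apply: bnd => //; rewrite c0.
have cb1 : 0 < 1 - phi c by rewrite subr_gt0.
have [e e0 He] := ctn c _ cb1.
pose q := Num.min T (c + e / 2).
have cq : c < q by rewrite /q lt_min cT'/=; lra.
have qT : q <= T by rewrite /q ge_min lexx.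
have qS : S q.
  split; first by rewrite qT (le_trans c0)// ltW.
  move=> p /andP[p0 pq]; have [pc|pc] := leP p c.
    by have [_] := cS; apply; rewrite p0.
  have /He : `|c - p| < e.
    rewrite distrC gtr0_norm ?subr_gt0//.
    have : q <= c + e / 2 by rewrite /q ge_min lexx orbT.
    lra.
  by rewrite ltr_norml => /andP[+ _]; lra.
by have := sup_upper_bound Ssup qS; rewrite -/c leNgt cq.
Qed.

End Gronwall.

(** * Continuous curves in H^1 and uniform smallness of symbols *)

Section ContinuousCurves.
Context {R : realType}.
#[local] Opaque Defs.fourier Defs.multiplier norm2 hnorm algebra_cst.
Variable M : domain.
Notation mu := (@space_measure R M).
Notation nu := (@freq_measure R M).
Notation fourier := (@fourier R M).
Notation L2_space := (@L2_space R M).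
Notation Hs := (@Hs R M).
Notation hnorm := (@hnorm R M).
Notation a := (@algebra_cst R M).
Implicit Types (f g : R -> R[i]) (F G u : R -> R -> R[i]).

Definition hdist f g : R := hnorm 1 (fun x => f x - g x).

Lemma hdist_ge0 f g : 0 <= hdist f g. Proof. exact: hnorm_ge0. Qed.

Lemma hnorm_le_hdist f g : Hs 1 f -> Hs 1 g -> hnorm 1 f <= hnorm 1 g + hdist f g.
Proof.
move=> fs gs; have := hnormD gs (HsB fs gs).
by rewrite (_ : (fun x => g x + (f x - g x)) = f)//; apply/funext => x; rewrite addrC subrK.
Qed.

Lemma hdist_trans f g h : Hs 1 f -> Hs 1 g -> Hs 1 h -> hdist f h <= hdist f g + hdist g h.
Proof.
move=> fs gs hs; have := hnormD (HsB fs gs) (HsB gs hs).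
by rewrite (_ : (fun x => _ + _) = (fun x => f x - h x))//; apply/funext => x; rewrite addrA subrK.
Qed.

Lemma hdistM f f' g g' : Hs 1 f -> Hs 1 f' -> Hs 1 g -> Hs 1 g' ->
  hdist (fun x => f x * g x) (fun x => f' x * g' x) <=
  a * hdist f f' * hnorm 1 g + a * hnorm 1 f' * hdist g g'.
Proof.
move=> fs f's gs g's.
have [H1 l1] := Hs1M (HsB fs f's) gs; have [H2 l2] := Hs1M f's (HsB gs g's).
rewrite /hdist (_ : (fun x => _ - _) =
    (fun x => (f x - f' x) * g x + f' x * (g x - g' x))).
  exact: le_trans (hnormD H1 H2) (lerD l1 l2).
by apply/funext => x; ring.
Qed.

Definition hcontinuous G := (forall t, Hs 1 (G t)) /\
  forall t0, hdist (G t) (G t0) @[t --> t0] --> (0 : R).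

Lemma sobolev_continuous_hcontinuous s u : (0 < s)%N -> sobolev_continuous M s u -> hcontinuous u.
Proof.
move=> s0 [us uc].
have u1 t : Hs 1 (u t).
  by apply/sobolevP; apply: (le_lt_trans (sobolev_norm_le M (u t) s0)); exact: us.
split => // t0; apply/cvgrPdist_lt => e e0.
have /cvge0P := uc t0 => /(_ (fun t => sobolev_norm_ge0 M s _) e e0); apply: filterS => t H.
have {}H : (sobolev_norm M 1 (fun x => u t x - u t0 x)%R < e%:E)%E.
  exact: le_lt_trans (sobolev_norm_le M _ s0) H.
by rewrite sub0r normrN ger0_norm ?hdist_ge0//; have [] := sobolev_norm_lt H.
Qed.

Lemma hcontinuousM F G : hcontinuous F -> hcontinuous G -> hcontinuous (fun t x => F t x * G t x).
Proof.
move=> [F1 Fc] [G1 Gc]; split=> [t|t0]; first by have [] := Hs1M (F1 t) (G1 t).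
pose bd (t : R) : R := a * hdist (F t) (F t0) * (hnorm 1 (G t0) + hdist (G t) (G t0)) +
  a * hnorm 1 (F t0) * hdist (G t) (G t0).
have bd0 : bd t @[t --> t0] --> (0 : R).
  have := cvgD (cvgM (cvgM (cvg_cst a) (Fc t0)) (cvgD (cvg_cst (hnorm 1 (G t0))) (Gc t0)))
    (cvgM (cvg_cst (a * hnorm 1 (F t0))) (Gc t0)).
  by rewrite !mulr0 mul0r addr0; apply.
apply: (squeeze_cvgr _ (cvg_cst 0) bd0); apply: nearW => t; rewrite hdist_ge0/=.
apply: (le_trans (hdistM (F1 t) (F1 t0) (G1 t) (G1 t0))); rewrite lerD2r.
apply: ler_wpM2l; first by rewrite mulr_ge0 ?hdist_ge0 ?algebra_cst_ge0.
exact: hnorm_le_hdist.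
Qed.

Lemma hdistJ f g : Hs 1 f -> Hs 1 g ->
  hdist (fun x => (f x)^*) (fun x => (g x)^*) <= 3 * hdist f g.
Proof.
move=> fs gs; have [_] := Hs1J (HsB fs gs).
by rewrite /hdist (_ : (fun x => (f x - g x)^*) = (fun x => (f x)^* - (g x)^*))//; apply/funext => x; rewrite rmorphB.
Qed.

Lemma hcontinuousJ G : hcontinuous G -> hcontinuous (fun t x => (G t x)^*).
Proof.
move=> [G1 Gc]; split=> [t|t0]; first by have [] := Hs1J (G1 t).
have bd0 : 3 * hdist (G t) (G t0) @[t --> t0] --> (0 : R).
  by have := cvgM (cvg_cst (3 : R)) (Gc t0); rewrite mulr0; apply.
apply: (squeeze_cvgr _ (cvg_cst 0) bd0); apply: nearW => t; rewrite hdist_ge0/=.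
exact: hdistJ.
Qed.

Lemma sq_modulusE f : sq_modulus f = (fun x => f x * (f x)^*).
Proof.
apply/funext => x; rewrite /sq_modulus; apply: complex_eqP; rewrite ?Re_mulJ//.
by rewrite !ReImE /=; ring.
Qed.

Lemma hcontinuous_sq_modulus G : hcontinuous G -> hcontinuous (fun t => sq_modulus (G t)).
Proof.
move=> Gc; rewrite (_ : (fun t => _) = (fun t x => G t x * (G t x)^*)).
  exact: (hcontinuousM Gc (hcontinuousJ Gc)).
by apply/funext => t; rewrite sq_modulusE.
Qed.

(** By compactness of [-T, T]. *)
Lemma hcontinuous_bounded G (T : R) : hcontinuous G ->
  exists B : R, 0 <= B /\ forall t, - T <= t <= T -> hnorm 1 (G t) <= B.
Proof.
move=> [G1 Gc].
have := @compact_near_coveringP _ `[- T, T]%classic => -[/(_ (@segment_compact R _ _)) cov _].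
have := cov _ \oo (fun (n : nat) t => hnorm 1 (G t) <= n%:R) _.
case=> [t0 _|N _ HN].
  have /cvgrPdist_lt /(_ 1 ltr01) near1 := Gc t0.
  near=> t n => /=.
  apply: (le_trans (hnorm_le_hdist (G1 t) (G1 t0))).
  have d1 : hdist (G t) (G t0) < 1.
    by rewrite -[hdist _ _]ger0_norm ?hdist_ge0// -normrN -sub0r; near: t; exact: near1.
  apply: (@le_trans _ _ (hnorm 1 (G t0) + 1)); first by rewrite lerD2l ltW.
  by near: n; exact: nbhs_infty_ger.
exists N%:R; split => // t tT; apply: (HN N (leqnn N)) => /=.
by rewrite in_itv/=.
Unshelve. all: by end_near. Qed.

End ContinuousCurves.

Section Tails.
Context {R : realType}.
#[local] Opaque Defs.fourier Defs.multiplier norm2 hnorm.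
Variable M : domain.
Notation mu := (@space_measure R M).
Notation nu := (@freq_measure R M).
Notation fourier := (@fourier R M).
Notation L2_space := (@L2_space R M).
Notation Hs := (@Hs R M).
Notation hnorm := (@hnorm R M).
Notation hdist := (@hdist R M).
Implicit Types (f g h F G : R -> R[i]) (q : R -> R).

Lemma nrm_le_ae f g : L2 nu g -> cmeasurable f ->
  {ae nu, forall xi, normc (f xi) <= normc (g xi)} -> nrm nu f <= nrm nu g.
Proof.
move=> g2 mf fg; have f2 := L2_normc_le mf fg g2; have [mg _] := g2.
exact: norm2_le_nrm f2 g2 (le_norm2 mf mg fg).
Qed.

(** This is the H^1 norm of q(D) g. *)
Definition tail q g : R := nrm nu (fun xi => (q xi)%:C * weighted M 1 g xi).

Lemma L2_tail q g : measurable_fun [set: measurableTypeR R] (q : measurableTypeR R -> R) ->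
  (forall xi, 0 <= q xi <= 2) -> Hs 1 g -> L2 nu (fun xi => (q xi)%:C * weighted M 1 g xi).
Proof.
move=> mq q2 [_ gs]; have mqC := cmeasurableC mq.
apply: (L2_bounded (ler0n _ 2) mqC _ gs).
by apply: aeW => xi; have /andP[q0 q2'] := q2 xi; rewrite normc_C ger0_norm.
Qed.

(** Write m f^ - m' g^ = m (f^ - g^) + (m - m') g^. *)
Lemma multiplier_compare q (m m' : R -> R[i]) f g F G :
  measurable_fun [set: measurableTypeR R] (q : measurableTypeR R -> R) ->
  (forall xi, 0 <= q xi <= 2) -> (forall xi, normc (m xi) <= 1) ->
  (forall xi, normc (m xi - m' xi) <= q xi) ->
  Hs 1 f -> Hs 1 g -> Hs 1 F -> Hs 1 G ->
  {ae nu, forall xi, fourier F xi = m xi * fourier f xi} ->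
  {ae nu, forall xi, fourier G xi = m' xi * fourier g xi} ->
  hdist F G <= hdist f g + tail q g.
Proof.
move=> mq q2 m1 mm' fs gs Fs Gs FE GE.
have [FL _] := Fs; have [GL _] := Gs; have [fL _] := fs; have [gL _] := gs.
have [_ D2] := HsB Fs Gs; have [_ d2] := HsB fs gs; have T2 := L2_tail mq q2 gs.
have [mD _] := D2; have [md _] := d2; have [mT _] := T2.
pose A (xi : R) : R[i] := (normc (weighted M 1 (fun x => f x - g x) xi))%:C.
pose B (xi : R) : R[i] := (normc ((q xi)%:C * weighted M 1 g xi))%:C.
have mA : cmeasurable A := cmeasurableC (measurable_normc md).
have mB : cmeasurable B := cmeasurableC (measurable_normc mT).
have EA : norm2 nu A = norm2 nu (weighted M 1 (fun x => f x - g x)).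
  by apply: eq_norm2_normc => xi; rewrite normc_C ger0_norm ?normc_ge0.
have EB : norm2 nu B = norm2 nu (fun xi => (q xi)%:C * weighted M 1 g xi).
  by apply: eq_norm2_normc => xi; rewrite normc_C ger0_norm ?normc_ge0.
have A2 : L2 nu A by split; [exact: mA|rewrite EA; case: d2].
have B2 : L2 nu B by split; [exact: mB|rewrite EB; case: T2].
have -> : hdist f g + tail q g = nrm nu A + nrm nu B.
  have -> : nrm nu A = hdist f g := congr1 fine EA.
  by have -> : nrm nu B = tail q g := congr1 fine EB.
apply: le_trans (nrmD A2 B2); apply: nrm_le_ae; [exact: L2D|exact: mD|].
have diff := fourierB (L2_space_L2 fL) (L2_space_L2 gL).
have Diff := fourierB (L2_space_L2 FL) (L2_space_L2 GL).
have arith (w x y p p' c : R[i]) (r : R) : normc p <= 1 -> normc (p - p') <= r -> 0 <= r ->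
    c = x - y ->
    normc (w * (p * x - p' * y)) <= normc ((normc (w * c))%:C + (normc (r%:C * (w * y)))%:C).
  move=> p1 pp r0 ->; rewrite -rmorphD normc_C ger0_norm ?addr_ge0 ?normc_ge0//.
  have -> : w * (p * x - p' * y) = p * (w * (x - y)) + (p - p') * (w * y) by ring.
  apply: (le_trans (normcD _ _)); apply: lerD.
    by rewrite normc_M ler_piMl ?normc_ge0.
  by rewrite normc_M (normc_M r%:C) normc_C (ger0_norm r0) ler_wpM2r ?normc_ge0.
have FG := ae_imp2 (fun xi (e1 : fourier F xi = _) (e2 : fourier G xi = _) => conj e1 e2) FE GE.
have dD := ae_imp2 (fun xi (e1 : fourier (fun x => f x - g x) xi = fourier f xi - fourier g xi)
   (e2 : fourier (fun x => F x - G x) xi = fourier F xi - fourier G xi) => conj e1 e2) diff Diff.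
apply: ae_imp2 FG dD => xi [eF eG] [ed eD].
rewrite /weighted eD eF eG; have [q0 _] := andP (q2 xi).
exact: arith (m1 xi) (mm' xi) q0 ed.
Qed.

Lemma tail_le q g h : measurable_fun [set: measurableTypeR R] (q : measurableTypeR R -> R) ->
  (forall xi, 0 <= q xi <= 2) -> Hs 1 g -> Hs 1 h ->
  tail q g <= tail q h + 2 * hdist g h.
Proof.
move=> mq q2 gs hs; have [gL _] := gs; have [hL _] := hs; have [_ d2] := HsB gs hs.
have Tg := L2_tail mq q2 gs; have Th := L2_tail mq q2 hs.
have D2 := L2Z (2%:C : R[i]) d2; have [mTg _] := Tg.
pose A (xi : R) : R[i] := (normc ((q xi)%:C * weighted M 1 h xi))%:C.
pose B (xi : R) : R[i] := (normc (2%:C * weighted M 1 (fun x => g x - h x) xi))%:C.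
have [mTh _] := Th; have [mD _] := D2.
have mA : cmeasurable A := cmeasurableC (measurable_normc mTh).
have mB : cmeasurable B := cmeasurableC (measurable_normc mD).
have EA : norm2 nu A = norm2 nu (fun xi => (q xi)%:C * weighted M 1 h xi).
  by apply: eq_norm2_normc => xi; rewrite normc_C ger0_norm ?normc_ge0.
have EB : norm2 nu B = norm2 nu (fun xi => 2%:C * weighted M 1 (fun x => g x - h x) xi).
  by apply: eq_norm2_normc => xi; rewrite normc_C ger0_norm ?normc_ge0.
have A2 : L2 nu A by split; [exact: mA|rewrite EA; case: Th].
have B2 : L2 nu B by split; [exact: mB|rewrite EB; case: D2].
have hA : nrm nu A <= tail q h by have -> : nrm nu A = tail q h := congr1 fine EA.
have hB : nrm nu B <= 2 * hdist g h.
  have -> := etrans (congr1 fine EB : nrm nu B = _) (nrmZ (2%:C : R[i]) d2).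
  by rewrite normc_C (ger0_norm (ler0n _ 2)).
apply: le_trans (le_trans (nrmD A2 B2) (lerD hA hB)); apply: nrm_le_ae; [exact: L2D|exact: mTg|].
have arith (w x y c : R[i]) (r : R) : 0 <= r <= 2 -> c = x - y ->
    normc (r%:C * (w * x)) <= normc ((normc (r%:C * (w * y)))%:C + (normc (2%:C * (w * c)))%:C).
  move=> /andP[r0 r2] ->; rewrite -rmorphD normc_C ger0_norm ?addr_ge0 ?normc_ge0//.
  have -> : r%:C * (w * x) = r%:C * (w * y) + r%:C * (w * (x - y)) by ring.
  apply: (le_trans (normcD _ _)); rewrite lerD2l normc_M (normc_M 2%:C) !normc_C.
  by rewrite (ger0_norm r0) ger0_norm// ler_wpM2r ?normc_ge0.
apply: ae_imp (fourierB (L2_space_L2 gL) (L2_space_L2 hL)) => xi ed.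
rewrite /A /B /weighted; exact: arith (q2 xi) ed.
Qed.

(** A single majorant for the symbol differences of the propagators, for times up
    to T, and of the resolvent. *)
Definition symbol_gap (T eps xi : R) : R := Num.min 2 ((T + 1) * eps ^+ 2 * (1 + xi ^+ 2) ^+ 2).

Lemma symbol_gap_bounds T eps xi : 0 <= T -> 0 <= symbol_gap T eps xi <= 2.
Proof.
move=> T0; rewrite /symbol_gap le_min ge_min lexx ler0n/= andbT.
by rewrite mulr_ge0 ?sqr_ge0// mulr_ge0 ?sqr_ge0// addr_ge0.
Qed.

Lemma measurable_symbol_gap T eps :
  measurable_fun [set: measurableTypeR R] (symbol_gap T eps : measurableTypeR R -> R).
Proof.
apply: measurable_minr; first exact: measurable_cst.
apply: measurable_funM; first exact: measurable_cst.
apply: measurable_funX; apply: measurable_funD; first exact: measurable_cst.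
exact: measurable_funX.
Qed.

Lemma tail_mono T eps eps' g : 0 <= T -> 0 <= eps <= eps' -> Hs 1 g ->
  tail (symbol_gap T eps) g <= tail (symbol_gap T eps') g.
Proof.
move=> T0 /andP[e0 ee'] gs.
have B e xi := symbol_gap_bounds e xi T0; have T' e := L2_tail (measurable_symbol_gap T e) (B e) gs.
have [mT _] := T' eps.
apply: nrm_le_ae; [exact: T'|exact: mT|apply: aeW => xi].
have /andP[q0 _] := B eps xi; have /andP[q0' _] := B eps' xi.
rewrite (normc_M (symbol_gap T eps xi)%:C) (normc_M (symbol_gap T eps' xi)%:C) !normc_C.
rewrite (ger0_norm q0) (ger0_norm q0'); apply: ler_wpM2r; first exact: normc_ge0.
rewrite /symbol_gap; apply: (le_min2 (lexx _)); rewrite ler_wpM2r ?sqr_ge0//.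
rewrite ler_wpM2l ?addr_ge0// lerXn2r// nnegrE//; exact: le_trans e0 ee'.
Qed.

(** Dominated convergence along eps = 1/(n+1); the tails are monotone in eps. *)
Lemma tail_cvg0 T g : 0 <= T -> Hs 1 g -> forall e : R, 0 < e ->
  \forall eps \near 0^'+, tail (symbol_gap T eps) g < e.
Proof.
move=> T0 gs e e0; have [_ g1] := gs.
pose ep (n : nat) : R := n.+1%:R^-1.
have B n xi := symbol_gap_bounds (ep n) xi T0.
pose m (n : nat) (xi : R) : R[i] := (symbol_gap T (ep n) xi)%:C.
have mm n : cmeasurable (m n) := cmeasurableC (measurable_symbol_gap T (ep n)).
have m2 n xi : normc (m n xi) <= 2.
  by have /andP[q0 q2] := B n xi; rewrite /m normc_C ger0_norm.
have m0 xi : normc (m n xi) @[n --> \oo] --> (0 : R).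
  have bd0 : (T + 1) * (1 + xi ^+ 2) ^+ 2 * ep n @[n --> \oo] --> (0 : R).
    by have := cvgM (cvg_cst ((T + 1) * (1 + xi ^+ 2) ^+ 2)) (@cvg_harmonic R); rewrite mulr0; apply.
  apply: (squeeze_cvgr _ (cvg_cst 0) bd0); apply: nearW => n; rewrite normc_ge0 andTb.
  have /andP[q0 _] := B n xi; rewrite /m normc_C (ger0_norm q0) /symbol_gap.
  rewrite ge_min; apply/orP; right; rewrite [leRHS]mulrAC; apply: ler_wpM2r; first exact: sqr_ge0.
  apply: ler_wpM2l; first by rewrite addr_ge0.
  by rewrite expr2 ler_piMl ?invr_ge0// invf_le1// ler1n.
have /cvge0P H0 := norm2_mul_cvg0 mm m2 g1 m0.
have [N _ /(_ N (leqnn N)) H] := H0 (fun n => norm2_ge0 nu _) e e0.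
have eN : 0 < ep N by rewrite invr_gt0.
near=> eps.
have h : 0 <= eps <= ep N.
  by apply/andP; split; apply: ltW; near: eps; [exact: nbhs_right_gt|exact: nbhs_right_lt].
apply: (le_lt_trans (tail_mono T0 h gs)); rewrite -lte_fin /tail -nrmE//.
exact: L2_tail (measurable_symbol_gap T (ep N)) (B N) gs.
Unshelve. all: by end_near. Qed.

(** By compactness of [-T, T]: near each time the tail varies by at most twice the
    H^1 distance, uniformly in eps. *)
Lemma tail_cvg0_uniform T (G : R -> R -> R[i]) : 0 <= T -> hcontinuous M G -> forall e : R, 0 < e ->
  \forall eps \near 0^'+, forall t, - T <= t <= T -> tail (symbol_gap T eps) (G t) < e.
Proof.
move=> T0 [G1 Gc] e e0.
have := @compact_near_coveringP _ `[- T, T]%classic => -[/(_ (@segment_compact R _ _)) cov _].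
have e4 : 0 < e / 4 by rewrite divr_gt0.
have loc : forall t0 : R, `[- T, T]%classic t0 ->
    \forall t \near t0 & eps \near 0^'+, tail (symbol_gap T eps) (G t) < e; last first.
  have Hn := cov _ (0^'+)%R (fun eps t => tail (symbol_gap T eps) (G t) < e) _ loc.
  near=> eps => t tT.
  have H : `[- T, T]%classic `<=` (fun t => tail (symbol_gap T eps) (G t) < e).
    by near: eps; exact: Hn.
  by apply: H; rewrite /= in_itv.
move=> t0 _; have /cvgrPdist_lt /(_ _ e4) near1 := Gc t0.
have near2 := tail_cvg0 T0 (G1 t0) e4.
near=> t eps => /=.
apply: (le_lt_trans (tail_le (measurable_symbol_gap T eps) (fun xi => symbol_gap_bounds eps xi T0) (G1 t) (G1 t0))).
have d1 : hdist (G t) (G t0) < e / 4.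
  by rewrite -[hdist _ _]ger0_norm ?hdist_ge0// -normrN -sub0r; near: t; exact: near1.
have d2 : tail (symbol_gap T eps) (G t0) < e / 4 by near: eps; exact: near2.
move: (tail _ _) (hdist _ _) d1 d2 => x y; clear - e0; lra.
Unshelve. all: by end_near. Qed.

End Tails.

(** * Comparison of the two nonlinearities *)

Section NonlinearEstimates.
Context {R : realType}.
#[local] Opaque Defs.fourier Defs.multiplier norm2 hnorm algebra_cst hdist tail.
Variable M : domain.
Notation nu := (@freq_measure R M).
Notation fourier := (@fourier R M).
Notation Hs := (@Hs R M).
Notation hnorm := (@hnorm R M).
Notation hdist := (@hdist R M).
Notation tail := (@tail R M).
Notation a := (@algebra_cst R M).
Implicit Types (f g u v : R -> R[i]) (l : R -> R).

Lemma measurable_laplacian :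
  measurable_fun [set: measurableTypeR R] (@symbol_laplacian R : measurableTypeR R -> R).
Proof. by apply: measurableT_comp => //; exact: measurable_funX. Qed.

Lemma measurable_fourth_order (eps : R) : measurable_fun [set: measurableTypeR R]
  ((fun xi => symbol_laplacian xi - eps ^+ 2 * symbol_laplacian xi ^+ 2) : measurableTypeR R -> R).
Proof.
have ml := measurable_laplacian; apply: measurable_funB => //.
by apply: measurable_funM; [exact: measurable_cst|exact: measurable_funX].
Qed.

Lemma propagatorP l (t : R) f :
  measurable_fun [set: measurableTypeR R] (l : measurableTypeR R -> R) -> Hs 1 f ->
  [/\ Hs 1 (propagator M l t f), hnorm 1 (propagator M l t f) <= hnorm 1 f &
      {ae nu, forall xi, fourier (propagator M l t f) xi = cis (t * l xi) * fourier f xi}].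
Proof.
move=> ml fs; have mc : cmeasurable (fun xi => cis (t * l xi) : R[i]).
  by apply: cmeasurable_cis; apply: measurable_funM => //; exact: measurable_cst.
have m1 (xi : R) : normc (cis (t * l xi) : R[i]) <= 1 by rewrite normc_cis.
have [H1 H2] := Hs_multiplier ler01 mc m1 fs; rewrite mul1r in H2.
have [fL _] := fs; have [_ H3] := multiplierP ler01 mc m1 (L2_space_L2 fL).
by split.
Qed.

Definition resolvent_symbol (eps xi : R) : R := (1 - eps ^+ 2 * symbol_laplacian xi)^-1.

Lemma resolvent_symbolE eps xi : resolvent_symbol eps xi = (1 + eps ^+ 2 * xi ^+ 2)^-1.
Proof. by rewrite /resolvent_symbol /symbol_laplacian mulrN opprK. Qed.

Lemma resolvent_symbol_bounds eps xi : 0 <= resolvent_symbol eps xi <= 1.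
Proof.
have h : 0 <= eps ^+ 2 * xi ^+ 2 by rewrite mulr_ge0// sqr_ge0.
by rewrite resolvent_symbolE invr_ge0 addr_ge0//= invf_le1 ?lerDl// ltr_pwDl.
Qed.

Lemma resolventP eps f : Hs 1 f ->
  [/\ Hs 1 (resolvent M eps f), hnorm 1 (resolvent M eps f) <= hnorm 1 f &
      {ae nu, forall xi, fourier (resolvent M eps f) xi = (resolvent_symbol eps xi)%:C * fourier f xi}].
Proof.
move=> fs; have mc : cmeasurable (fun xi => (resolvent_symbol eps xi)%:C : R[i]).
  apply: cmeasurableC; apply: continuous_measurable_fun => x.
  rewrite (_ : resolvent_symbol eps = fun xi => (1 + eps ^+ 2 * xi ^+ 2)^-1); last first.
    by apply/funext => xi; rewrite resolvent_symbolE.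
  apply: cvgV.
    have h : 0 <= eps ^+ 2 * x ^+ 2 by rewrite mulr_ge0// sqr_ge0.
    by rewrite gt_eqF// ltr_pwDl.
  by apply: cvgD; [exact: cvg_cst|apply: cvgM; [exact: cvg_cst|exact: exprn_continuous]].
have m1 xi : normc ((resolvent_symbol eps xi)%:C : R[i]) <= 1.
  by have /andP[r0 r1] := resolvent_symbol_bounds eps xi; rewrite normc_C ger0_norm.
have [H1 H2] := Hs_multiplier ler01 mc m1 fs; rewrite mul1r in H2.
have [fL _] := fs; have [_ H3] := multiplierP ler01 mc m1 (L2_space_L2 fL).
by split.
Qed.

Lemma laplacian_gap T eps t xi : 0 <= T -> `|t| <= T ->
  normc (cis (t * (symbol_laplacian xi - eps ^+ 2 * symbol_laplacian xi ^+ 2)) -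
         cis (t * symbol_laplacian xi) : R[i]) <= symbol_gap T eps xi.
Proof.
move=> T0 tT; rewrite /symbol_gap le_min; apply/andP; split.
  by apply: (le_trans (normcB _ _)); rewrite !normc_cis.
apply: (le_trans (normc_cisB_le _ _)); rewrite -mulrBr /symbol_laplacian.
have -> : - xi ^+ 2 - eps ^+ 2 * (- xi ^+ 2) ^+ 2 - - xi ^+ 2 = - (eps ^+ 2 * (xi ^+ 2) ^+ 2) by ring.
have e0 := sqr_ge0 eps; have x0 := sqr_ge0 xi.
rewrite normrM normrN (ger0_norm (mulr_ge0 e0 (sqr_ge0 _))) -mulrA.
apply: ler_pM => //; first by rewrite mulr_ge0// sqr_ge0.
  by apply: (le_trans tT); rewrite lerDl.
by apply: ler_wpM2l => //; rewrite lerXn2r ?nnegrE ?addr_ge0// lerDr.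
Qed.

Lemma resolvent_gap T eps xi : 0 <= T ->
  normc ((resolvent_symbol eps xi)%:C - 1 : R[i]) <= symbol_gap T eps xi.
Proof.
move=> T0; rewrite -[1 : R[i]]/((1 : R)%:C) -rmorphB normc_C.
have /andP[r0 r1] := resolvent_symbol_bounds eps xi.
rewrite distrC ger0_norm ?subr_ge0// /symbol_gap le_min; apply/andP; split; first by lra.
have e0 := sqr_ge0 eps; have x0 := sqr_ge0 xi.
have h : 0 <= eps ^+ 2 * xi ^+ 2 by rewrite mulr_ge0.
have h1 : 0 < 1 + eps ^+ 2 * xi ^+ 2 by rewrite ltr_pwDl.
apply: (@le_trans _ _ (eps ^+ 2 * xi ^+ 2)).
  rewrite lerBlDr -lerBlDl resolvent_symbolE -[leRHS]mul1r ler_pdivlMr//.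
  move: (eps ^+ 2 * xi ^+ 2) h => z z0; clear -z0; nra.
rewrite -mulrA -[leLHS]mul1r; apply: ler_pM => //; first by rewrite lerDr.
apply: ler_wpM2l => //; move: (xi ^+ 2) x0 => z z0; rewrite expr2; clear -z0; nra.
Qed.

Lemma Hs_sq_modulus u : Hs 1 u -> Hs 1 (sq_modulus u) /\
  hnorm 1 (sq_modulus u) <= a * hnorm 1 u * (3 * hnorm 1 u).
Proof.
move=> us; have [cs cle] := Hs1J us; have [ss sle] := Hs1M us cs.
rewrite sq_modulusE; split; first exact: ss.
apply: (le_trans sle); apply: ler_wpM2l cle.
exact: mulr_ge0 (algebra_cst_ge0 M) (hnorm_ge0 M 1 u).
Qed.

Lemma Hs_cubic u : Hs 1 u -> Hs 1 (cubic_nonlinearity u).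
Proof. by move=> us; have [ss _] := Hs_sq_modulus us; have [] := Hs1M ss us. Qed.

Lemma Hs_nonlocal eps v : Hs 1 v -> Hs 1 (nonlocal_nonlinearity M eps v).
Proof.
move=> vs; have [ss _] := Hs_sq_modulus vs; have [rs _ _] := resolventP eps ss.
by have [] := Hs1M rs vs.
Qed.

Definition lipschitz_cst (B : R) : R := 9 * (a * (B + 1)) ^+ 2 + 1.

(** The factors are bounded through hv <= hu + d <= B + 1; the constant 9 is the sum
    of 6 for the resolvent term and 3 for the remaining cubic one. *)
Lemma nonlinear_arith (A B d tl hu hv hcv dc s r n2 : R) :
  0 <= A -> 0 <= d -> d <= 1 -> 0 <= tl -> 0 <= hu -> hu <= B -> 0 <= hv -> hv <= hu + d ->
  hcv <= 3 * hv -> dc <= 3 * d -> s <= A * d * hcv + A * hu * dc -> r <= s + tl ->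
  n2 <= A * hu * (3 * hu) ->
  A * r * hv + A * n2 * d <= (9 * (A * (B + 1)) ^+ 2 + 1) * d + A * (B + 1) * tl.
Proof.
move=> A0 d0 d1 tl0 hu0 huB hv0 hvd hcv3 dc3 sle rle n2le.
have B1 : hv <= B + 1 by lra.
have B0 : 0 <= B + 1 by lra.
have AB : 0 <= A * (B + 1) by rewrite mulr_ge0.
have s6 : s <= 6 * (A * (B + 1)) * d.
  apply: (le_trans sle).
  have h1 : A * d * hcv <= A * d * (3 * (B + 1)) by apply: ler_wpM2l; [rewrite mulr_ge0|lra].
  have h2 : A * hu * dc <= A * (B + 1) * (3 * d).
    apply: (@le_trans _ _ (A * hu * (3 * d))); first by apply: ler_wpM2l => //; rewrite mulr_ge0.
    by apply: ler_wpM2r; [lra|apply: ler_wpM2l => //; lra].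
  apply: (le_trans (lerD h1 h2)); rewrite le_eqVlt; apply/orP; left; apply/eqP; ring.
have p1 : A * r * hv <= 6 * (A * (B + 1)) ^+ 2 * d + A * (B + 1) * tl.
  apply: (@le_trans _ _ (A * (6 * (A * (B + 1)) * d + tl) * hv)).
    by apply: ler_wpM2r => //; apply: ler_wpM2l => //; lra.
  apply: (@le_trans _ _ (A * (6 * (A * (B + 1)) * d + tl) * (B + 1))).
    apply: ler_wpM2l => //; rewrite mulr_ge0// addr_ge0// mulr_ge0// mulr_ge0//.
  by rewrite le_eqVlt; apply/orP; left; apply/eqP; ring.
have p2 : A * n2 * d <= 3 * (A * (B + 1)) ^+ 2 * d.
  apply: ler_wpM2r => //; apply: (@le_trans _ _ (A * (A * hu * (3 * hu)))).
    exact: ler_wpM2l.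
  have -> : A * (A * hu * (3 * hu)) = 3 * (A * hu) ^+ 2 by ring.
  apply: ler_wpM2l => //; rewrite lerXn2r ?nnegrE ?mulr_ge0//.
  by apply: ler_wpM2l => //; lra.
apply: (le_trans (lerD p1 p2)).
by move: ((A * (B + 1)) ^+ 2) (A * (B + 1) * tl) => x y; clear -d0; nra.
Qed.

(** With S the resolvent, S(|v|^2) v - |u|^2 u is
    (S(|v|^2) - |u|^2) v + |u|^2 (v - u), and
    |v|^2 - |u|^2 = (v - u) v^* + u (v - u)^*. *)
Lemma nonlinearity_compare (T eps B : R) v u : 0 <= T -> Hs 1 v -> Hs 1 u ->
  hnorm 1 u <= B -> hdist v u <= 1 ->
  hdist (nonlocal_nonlinearity M eps v) (cubic_nonlinearity u) <=
  lipschitz_cst B * hdist v u + a * (B + 1) * tail (symbol_gap T eps) (sq_modulus u).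
Proof.
move=> T0 vs us uB d1; have [cvs cvle] := Hs1J vs; have [cus _] := Hs1J us.
have [sv _] := Hs_sq_modulus vs; have [su sule] := Hs_sq_modulus us.
have [rs _ rE] := resolventP eps sv.
have sle := hdistM vs us cvs cus; rewrite -!sq_modulusE in sle.
have gE : {ae nu, forall xi, fourier (sq_modulus u) xi = (fun=> 1) xi * fourier (sq_modulus u) xi}.
  by apply: aeW => xi; rewrite mul1r.
have m1 xi : normc ((resolvent_symbol eps xi)%:C : R[i]) <= 1.
  by have /andP[r0 r1] := resolvent_symbol_bounds eps xi; rewrite normc_C ger0_norm.
have rle := multiplier_compare (measurable_symbol_gap T eps)
  (fun xi => symbol_gap_bounds eps xi T0) m1 (fun xi => resolvent_gap eps xi T0) sv su rs su rE gE.
apply: (le_trans (hdistM rs su vs us)).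
exact: (nonlinear_arith (algebra_cst_ge0 M) (hdist_ge0 M v u) d1 (nrm_ge0 _ _) (hnorm_ge0 M 1 u) uB
  (hnorm_ge0 M 1 v) (hnorm_le_hdist vs us) cvle (hdistJ vs us) sle rle sule).
Qed.

(** This serves for the free evolutions of the initial data as well as for the
    integrands of Duhamel's formula. *)
Lemma propagator_compare (T eps t : R) f g : 0 <= T -> `|t| <= T -> Hs 1 f -> Hs 1 g ->
  hdist (propagator M (fun xi => symbol_laplacian xi - eps ^+ 2 * symbol_laplacian xi ^+ 2) t f)
        (propagator M (@symbol_laplacian R) t g) <= hdist f g + tail (symbol_gap T eps) g.
Proof.
move=> T0 tT fs gs.
have [Fs _ FE] := propagatorP t (measurable_fourth_order eps) fs.
have [Gs _ GE] := propagatorP t measurable_laplacian gs.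
apply: (multiplier_compare (measurable_symbol_gap T eps) (fun xi => symbol_gap_bounds eps xi T0)
  _ (fun xi => laplacian_gap eps xi T0 tT) fs gs Fs Gs FE GE).
by move=> xi; rewrite normc_cis.
Qed.

Lemma Hs_sum (n : nat) (c : nat -> R) (f : nat -> R -> R[i]) : (forall k, Hs 1 (f k)) ->
  Hs 1 (fun y => \sum_(k < n) (c k)%:C * f k y) /\
  hnorm 1 (fun y => \sum_(k < n) (c k)%:C * f k y) <= \sum_(k < n) `|c k| * hnorm 1 (f k).
Proof.
move=> fs; have f0 := fs 0%N; elim: n => [|n [IH1 IH2]].
  have [H1 H2] := HsZ 0 f0; rewrite (_ : (fun y => _) = (fun x => 0 * f 0%N x)).
    by split => //; rewrite big_ord0; apply: (le_trans H2); rewrite Normc.normc0 mul0r.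
  by apply/funext => y; rewrite big_ord0 mul0r.
have [H1 H2] := HsZ (c n)%:C (fs n); rewrite normc_C in H2.
rewrite (_ : (fun y => \sum_(k < n.+1) _) =
    (fun y => \sum_(k < n) (c k)%:C * f k y + (c n)%:C * f n y)).
  split; first exact: HsD.
  by rewrite big_ord_recr; exact: le_trans (hnormD IH1 H1) (lerD IH2 H2).
by apply/funext => y; rewrite big_ord_recr.
Qed.

End NonlinearEstimates.

(** * Convergence *)

Section DistanceSymmetry.
Context {R : realType}.
#[local] Opaque Defs.fourier Defs.multiplier norm2 hnorm algebra_cst tail.
Variable M : domain.
Notation nu := (@freq_measure R M).
Notation Hs := (@Hs R M).
Notation hnorm := (@hnorm R M).
Notation hdist := (@hdist R M).
Notation tail := (@tail R M).
Notation a := (@algebra_cst R M).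
Notation hcontinuous := (@hcontinuous R M).
Implicit Types (f g : R -> R[i]) (u v : R -> R -> R[i]).

Lemma hdist_sym_le f g : Hs 1 f -> Hs 1 g -> hdist f g <= hdist g f.
Proof.
move=> fs gs; have := hnormN (HsB gs fs).
by rewrite (_ : (fun x => - (g x - f x)) = (fun x => f x - g x))//; apply/funext => x; rewrite opprB.
Qed.

End DistanceSymmetry.

Section DistanceAlongCurves.
Context {R : realType}.
#[local] Opaque Defs.fourier Defs.multiplier norm2 hnorm algebra_cst tail hdist.
Variable M : domain.
Notation nu := (@freq_measure R M).
Notation Hs := (@Hs R M).
Notation hnorm := (@hnorm R M).
Notation hdist := (@hdist R M).
Notation tail := (@tail R M).
Notation a := (@algebra_cst R M).
Notation hcontinuous := (@hcontinuous R M).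
Implicit Types (f g : R -> R[i]) (u v : R -> R -> R[i]).

Lemma hdist_continuous v u : hcontinuous v -> hcontinuous u ->
  continuous (fun t => hdist (v t) (u t)).
Proof.
move=> [v1 vc] [u1 uc] t0; apply/cvgrPdist_lt => e e0.
have e2 : 0 < e / 2 by rewrite divr_gt0.
have near_curve w : hcontinuous w -> \forall t \near t0, hdist (w t) (w t0) < e / 2.
  move=> [_ wc]; have /cvgrPdist_lt /(_ _ e2) := wc t0; apply: filterS => t.
  by rewrite sub0r normrN ger0_norm ?hdist_ge0.
have nv := near_curve v (conj v1 vc); have nu' := near_curve u (conj u1 uc).
apply: filterS2 nv nu' => t d1 d2.
have d1' := hdist_sym_le (v1 t0) (v1 t); have d2' := hdist_sym_le (u1 t0) (u1 t).
have t1 := hdist_trans (v1 t) (v1 t0) (u1 t); have t2 := hdist_trans (v1 t0) (u1 t0) (u1 t).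
have t3 := hdist_trans (v1 t0) (v1 t) (u1 t0); have t4 := hdist_trans (v1 t) (u1 t) (u1 t0).
move: (hdist (v t) (u t)) (hdist (v t0) (u t0)) (hdist (v t0) (u t)) (hdist (v t) (u t0))
  (hdist (v t) (v t0)) (hdist (v t0) (v t)) (hdist (u t) (u t0)) (hdist (u t0) (u t))
  d1 d2 d1' d2' t1 t2 t3 t4 => x0 x1 x2 x3 x4 x5 x6 x7 d1 d2 d1' d2' t1 t2 t3 t4.
by clear - d1 d2 d1' d2' t1 t2 t3 t4; rewrite ltr_norml; apply/andP; split; lra.
Qed.

Lemma hcontinuous_scale (s : R) u : hcontinuous u -> hcontinuous (fun r => u (s * r)).
Proof.
move=> [u1 uc]; split => [r|r0]; first exact: u1.
have sc : s * r @[r --> r0] --> s * r0 by apply: cvgM; [exact: cvg_cst|exact: cvg_id].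
exact: (cvg_comp _ _ sc (uc (s * r0))).
Qed.

Lemma uniform_partition (t : R) (n : nat) : (0 < n)%N ->
  tagged_partition 0 t n (fun k => t * k%:R / n%:R) (fun k => t * k%:R / n%:R).
Proof.
move=> n0; have nR : 0 < n%:R :> R by rewrite ltr0n.
split; [by rewrite mulr0 mul0r|by rewrite mulfK// gt_eqF|].
move=> k _; case: ifPn => [t0|]; rewrite lexx ?andbT /=.
  by rewrite ler_pM2r ?invr_gt0// ler_wpM2l// ler_nat.
by rewrite -ltNge => t0; rewrite ler_pM2r ?invr_gt0// ler_wnM2l ?(ltW t0)// ler_nat.
Qed.

End DistanceAlongCurves.

Section DuhamelComparison.
Context {R : realType}.
#[local] Opaque Defs.fourier Defs.multiplier norm2 hnorm algebra_cst tail.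
Variable M : domain.
Notation nu := (@freq_measure R M).
Notation Hs := (@Hs R M).
Notation hnorm := (@hnorm R M).
Notation hdist := (@hdist R M).
Notation tail := (@tail R M).
Notation a := (@algebra_cst R M).
Notation hcontinuous := (@hcontinuous R M).
Implicit Types (f g : R -> R[i]) (u v : R -> R -> R[i]).

(** Both integrals are approximated by Riemann sums along the same uniform
    partition, fine enough for the two of them.  The tag of each step is its end
    nearer to 0, so that Gronwall's inequality applies to the sums. *)
Lemma duhamel_difference (T eps : R) (u0e u0 : R -> R[i]) v u : 0 <= T ->
  Hs 1 u0e -> Hs 1 u0 -> fourth_order_solution M eps u0e v -> NLS_solution M u0 u ->
  forall t, `|t| <= T -> forall eta, 0 < eta -> exists n : nat, (0 < n)%N /\
    hdist (v t) (u t) <= hdist u0e u0 + tail (symbol_gap T eps) u0 + eta +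
      \sum_(k < n) `|t| / n%:R *
        (hdist (nonlocal_nonlinearity M eps (v (t * k%:R / n%:R)))
               (cubic_nonlinearity (u (t * k%:R / n%:R))) +
         tail (symbol_gap T eps) (cubic_nonlinearity (u (t * k%:R / n%:R)))).
Proof.
move=> T0 e0s u0s [vc vI] [uc uI] t tT eta eta0.
have [v1 _] := sobolev_continuous_hcontinuous (ltn0Sn 1) vc.
have [u1 _] := sobolev_continuous_hcontinuous (ltn0Sn 0) uc.
have eta2 : 0 < eta / 2 by rewrite divr_gt0.
have [d1 d10 P1] := vI t _ eta2; have [d2 d20 P2] := uI t _ eta2.
pose d := Num.min d1 d2; have d0 : 0 < d by rewrite /d lt_min d10.
pose n := (Num.bound (`|t| / d)).+1.
have nR : 0 < n%:R :> R by rewrite ltr0n.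
have mesh : `|t| / n%:R < d.
  rewrite ltr_pdivrMr// mulrC -ltr_pdivrMr//.
  apply: (@lt_le_trans _ _ (Num.bound (`|t| / d))%:R); last by rewrite ler_nat.
  by apply: archi_boundP; rewrite divr_ge0// ltW.
pose x (k : nat) : R := t * k%:R / n%:R.
have dx k : x k.+1 - x k = t / n%:R.
  by rewrite /x -natr1; field; rewrite gt_eqF.
have adx k : `|x k.+1 - x k| = `|t| / n%:R.
  by rewrite dx normrM [`|n%:R^-1|]gtr0_norm ?invr_gt0.
have part : tagged_partition 0 t n x x := uniform_partition t (ltn0Sn _).
have mesh1 k : (k < n)%N -> `|x k.+1 - x k| < d1.
  by move=> _; rewrite adx; apply: lt_le_trans mesh _; rewrite /d ge_min lexx.
have mesh2 k : (k < n)%N -> `|x k.+1 - x k| < d2.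
  by move=> _; rewrite adx; apply: lt_le_trans mesh _; rewrite /d ge_min lexx orbT.
have H1 := P1 n x x part mesh1; have H2 := P2 n x x part mesh2.
have [A1 a1] := sobolev_norm_lt (le_lt_trans (sobolev_norm_le M _ (leqnSn 1)) H1).
have [A2 a2] := sobolev_norm_lt H2.
pose le (xi : R) := symbol_laplacian xi - eps ^+ 2 * symbol_laplacian xi ^+ 2.
pose Gv k := propagator M le (t - x k) (nonlocal_nonlinearity M eps (v (x k))).
pose Gu k := propagator M (@symbol_laplacian R) (t - x k) (cubic_nonlinearity (u (x k))).
have Nv k := Hs_nonlocal eps (v1 (x k)); have Nu k := Hs_cubic (u1 (x k)).
have Gvs k : Hs 1 (Gv k) by have [] := propagatorP (t - x k) (measurable_fourth_order eps) (Nv k).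
have Gus k : Hs 1 (Gu k) by have [] := propagatorP (t - x k) (@measurable_laplacian R) (Nu k).
pose g k (y : R) : R[i] := 'i%C * (Gv k y - Gu k y).
have gs k : Hs 1 (g k) by have [] := HsZ 'i%C (HsB (Gvs k) (Gus k)).
have gle k : (k < n)%N -> hnorm 1 (g k) <=
    hdist (nonlocal_nonlinearity M eps (v (x k))) (cubic_nonlinearity (u (x k))) +
    tail (symbol_gap T eps) (cubic_nonlinearity (u (x k))).
  move=> kn; have [_] := HsZ 'i%C (HsB (Gvs k) (Gus k)); rewrite normc_i mul1r.
  have tx : `|t - x k| <= T; last first.
    by move=> H; exact: (le_trans H (propagator_compare eps T0 tx (Nv k) (Nu k))).
  have -> : t - x k = t * ((n%:R - k%:R) / n%:R) by rewrite /x; field; rewrite gt_eqF.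
  apply: le_trans tT; rewrite normrM ler_piMr// ger0_norm ?divr_ge0 ?subr_ge0 ?ler_nat ?(ltnW kn)//.
  by rewrite ler_pdivrMr// mul1r lerBlDr lerDl.
have [B1 b1] := Hs_sum n (fun k => x k.+1 - x k) gs.
have c1 := propagator_compare eps T0 tT e0s u0s.
have [P1s _ _] := propagatorP t (measurable_fourth_order eps) e0s.
have [P2s _ _] := propagatorP t (@measurable_laplacian R) u0s.
have C1 := HsB P1s P2s.
exists n; split => //.
have cancel (vt ut p q b c : R[i]) :
    vt - ut = ((p - q) + (b - c)) - (b - (vt - p)) + (c - (ut - q)) by ring.
have E : (fun y => v t y - u t y) = (fun y =>
    ((propagator M le t u0e y - propagator M (@symbol_laplacian R) t u0 y) +
      \sum_(k < n) (x k.+1 - x k)%:C * g k y) -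
    (\sum_(k < n) (x k.+1 - x k)%:C * ('i%C * Gv k y) - (v t y - propagator M le t u0e y)) +
    (\sum_(k < n) (x k.+1 - x k)%:C * ('i%C * Gu k y) -
      (u t y - propagator M (@symbol_laplacian R) t u0 y))).
  apply/funext => y.
  have -> : \sum_(k < n) (x k.+1 - x k)%:C * g k y =
      \sum_(k < n) (x k.+1 - x k)%:C * ('i%C * Gv k y) -
      \sum_(k < n) (x k.+1 - x k)%:C * ('i%C * Gu k y).
    by rewrite -sumrB; apply: eq_bigr => k _; rewrite -mulrBr -mulrBr.
  exact: cancel.
have main : hnorm 1 (fun y => v t y - u t y) <= hdist u0e u0 + tail (symbol_gap T eps) u0 +
    (\sum_(k < n) `|x k.+1 - x k| * hnorm 1 (g k)) + eta / 2 + eta / 2.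
  rewrite E; apply: (le_trans (hnormD (HsB (HsD C1 B1) A1) A2)).
  apply: (lerD _ (ltW a2)); apply: (le_trans (hnormB (HsD C1 B1) A1)).
  apply: (lerD _ (ltW a1)); apply: (le_trans (hnormD C1 B1)).
  exact: (lerD c1 b1).
apply: (le_trans main); rewrite -addrA -addrA.
rewrite (_ : _ + (eta / 2 + eta / 2) = eta + \sum_(k < n) `|x k.+1 - x k| * hnorm 1 (g k)); last first.
  by rewrite -splitr addrC.
rewrite addrA lerD2l; apply: ler_sum => k _; rewrite adx; apply: ler_wpM2l.
  by rewrite divr_ge0.
exact: gle.
Qed.

Lemma sup_sobolev_dist_ge0 s (T : R) u v : 0 <= T -> (0 <= sup_sobolev_dist M s T u v)%E.
Proof.
move=> T0; apply: (le_trans (sobolev_norm_ge0 M s (fun x => u 0 x - v 0 x))).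
by apply: ereal_sup_ubound; exists 0 => //; rewrite /= in_itv/= oppr_le0 T0.
Qed.

(** The curve phi measures the distance along the half-line from 0 through t, which
    reduces negative times to positive ones. *)
Lemma uniform_estimate (T eps B delta kappa : R) (u0e u0 : R -> R[i]) v u : 0 <= T ->
  Hs 1 u0e -> Hs 1 u0 -> fourth_order_solution M eps u0e v -> NLS_solution M u0 u ->
  0 <= B -> (forall t, - T <= t <= T -> hnorm 1 (u t) <= B) -> 0 <= kappa ->
  hdist u0e u0 + tail (symbol_gap T eps) u0 + T * ((a * (B + 1) + 1) * kappa) <= delta ->
  (forall t, - T <= t <= T -> tail (symbol_gap T eps) (sq_modulus (u t)) <= kappa) ->
  (forall t, - T <= t <= T -> tail (symbol_gap T eps) (cubic_nonlinearity (u t)) <= kappa) ->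
  2 * delta * expR (2 * lipschitz_cst M B * T) < 1 ->
  forall t, - T <= t <= T -> hdist (v t) (u t) <= 2 * delta * expR (2 * lipschitz_cst M B * T).
Proof.
move=> T0 e0s u0s vsol usol B0 uB k0 small tail1 tail2 small' t tT.
have [vc _] := vsol; have [uc _] := usol.
have vH := sobolev_continuous_hcontinuous (ltn0Sn 1) vc.
have uH := sobolev_continuous_hcontinuous (ltn0Sn 0) uc.
have [v1 _] := vH; have [u1 _] := uH.
have duh := duhamel_difference T0 e0s u0s vsol usol.
have A0 : 0 <= a * (B + 1) by rewrite mulr_ge0 ?algebra_cst_ge0// addr_ge0.
have L0 : 0 < lipschitz_cst M B.
  by rewrite /lipschitz_cst ltr_wpDl// mulr_ge0// sqr_ge0.
have d0' : 0 <= hdist u0e u0 + tail (symbol_gap T eps) u0.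
  by rewrite addr_ge0 ?hdist_ge0//; exact: nrm_ge0.
have K0 : 0 <= T * ((a * (B + 1) + 1) * kappa).
  by rewrite mulr_ge0// mulr_ge0// addr_ge0.
have delta0 : 0 <= delta by apply: le_trans small; rewrite addr_ge0.
pose s : R := if 0 <= t then 1 else - 1.
have s1 : `|s| = 1 by rewrite /s; case: ifP; rewrite ?normrN normr1.
have ts : t = s * `|t|.
  rewrite /s; case: (leP 0 t) => h; first by rewrite mul1r ger0_norm.
  by rewrite mulN1r ltr0_norm// opprK.
pose phi r := hdist (v (s * r)) (u (s * r)).
have absT r : 0 <= r <= T -> `|s * r| <= T.
  by move=> /andP[r0 rT]; rewrite normrM s1 mul1r ger0_norm.
have tabs : 0 <= `|t| <= T by rewrite normr_ge0/= ler_norml.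
rewrite ts -/(phi `|t|); apply: (gronwall T0 L0 delta0) => //.
- by move=> r; exact: hdist_ge0.
- exact: hdist_continuous (hcontinuous_scale s vH) (hcontinuous_scale s uH).
- apply/ler_addgt0Pr => eta eta0; rewrite /phi mulr0.
  have [n [_ H]] := duh 0 (ltac:(by rewrite normr0)) eta eta0.
  apply: (le_trans H); rewrite big1 ?addr0; last by move=> k _; rewrite normr0 !mul0r.
  by rewrite lerD2r; apply: le_trans small; rewrite lerDl.
- move=> r r0T phi1 eta eta0; have /andP[r0 rT] := r0T.
  have [n [n0 H]] := duh (s * r) (absT r r0T) eta eta0; exists n; split => //.
  apply: (le_trans H); rewrite normrM s1 mul1r (ger0_norm r0).
  have nR : 0 < n%:R :> R by rewrite ltr0n.
  have term (k : 'I_n) : r / n%:R *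
      (hdist (nonlocal_nonlinearity M eps (v (s * r * k%:R / n%:R)))
             (cubic_nonlinearity (u (s * r * k%:R / n%:R))) +
       tail (symbol_gap T eps) (cubic_nonlinearity (u (s * r * k%:R / n%:R)))) <=
      lipschitz_cst M B * (r / n%:R * phi (r * k%:R / n%:R)) + r / n%:R * ((a * (B + 1) + 1) * kappa).
    have -> : s * r * k%:R / n%:R = s * (r * k%:R / n%:R) by rewrite !mulrA.
    set p := r * k%:R / n%:R.
    have hp : 0 <= p <= r.
      rewrite /p divr_ge0 ?mulr_ge0//=.
      by rewrite ler_pdivrMr// ler_wpM2l// ler_nat ltnW.
    have hpT : - T <= s * p <= T.
      rewrite -ler_norml; apply: absT; have /andP[p0 pr] := hp.
      by rewrite p0 (le_trans pr).
    have cmp := nonlinearity_compare eps T0 (v1 (s * p)) (u1 (s * p)) (uB _ hpT) (phi1 p hp).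
    have t1 := tail1 _ hpT; have t2 := tail2 _ hpT.
    have arith (w x y z q al l kp : R) : 0 <= w -> 0 <= al -> x <= l * q + al * y -> y <= kp -> z <= kp ->
        w * (x + z) <= l * (w * q) + w * ((al + 1) * kp).
      move=> w0 al0 xl ykp zkp.
      have -> : l * (w * q) + w * ((al + 1) * kp) = w * ((l * q + al * kp) + kp) by ring.
      apply: ler_wpM2l => //; apply: lerD => //; apply: (le_trans xl); rewrite lerD2l.
      exact: ler_wpM2l.
    apply: (arith _ _ _ _ _ _ _ _ _ A0 cmp t1 t2); by rewrite divr_ge0.
  rewrite -addrA; apply: (le_trans (lerD (lexx _) (lerD (lexx eta) (ler_sum _ (fun k _ => term k))))).
  rewrite big_split/= -mulr_sumr.
  have -> : \sum_(i < n) r / n%:R * ((a * (B + 1) + 1) * kappa) = r * ((a * (B + 1) + 1) * kappa).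
    rewrite sumr_const card_ord -[_ *+ n]mulr_natr; move: ((_ + 1) * kappa) => z.
    by field; rewrite gt_eqF.
  have rK : r * ((a * (B + 1) + 1) * kappa) <= T * ((a * (B + 1) + 1) * kappa).
    by apply: ler_wpM2r => //; rewrite mulr_ge0// addr_ge0.
  have arith (D et S x y dl : R) : D + y <= dl -> x <= y -> D + (et + (S + x)) <= dl + et + S.
    by clear; lra.
  exact: arith small rK.
Qed.

End DuhamelComparison.

Theorem theorem1p2 (R : realType) (M : domain)
    (u0eps : R -> R -> R[i]) (u0 : R -> R[i])
    (ueps : R -> R -> R -> R[i]) (u : R -> R -> R[i])
    (hueps : forall eps : R, 0 < eps ->
      fourth_order_solution M eps (u0eps eps) (ueps eps))
    (hu : NLS_solution M u0 u)
    (hbounded : exists K : R, forall eps : R, 0 < eps ->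
      (sobolev_norm M 2 (u0eps eps) <= K%:E)%E)
    (hu0 : sobolev M 1 u0)
    (hconv : sobolev_dist M 1 (u0eps eps) u0 @[eps --> 0^'+] --> 0%E) :
  forall T : R, 0 < T ->
    sup_sobolev_dist M 1 T (ueps eps) u @[eps --> 0^'+] --> 0%E.
Proof.
move=> T /ltW T0; have u0s : Hs M 1 u0 by apply/sobolevP.
have [uc _] := hu; have uH := sobolev_continuous_hcontinuous (ltn0Sn 0) uc.
have [B [B0 uB]] := hcontinuous_bounded T uH.
have sqH := hcontinuous_sq_modulus uH.
have cubH : hcontinuous M (fun t => cubic_nonlinearity (u t)) := hcontinuousM sqH uH.
have [Kd Kdle] := hbounded.
apply/cvge0P => [eps|e e0]; first exact: sup_sobolev_dist_ge0.
pose E := expR (2 * lipschitz_cst M B * T); have E0 : 0 < E by exact: expR_gt0.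
pose m := Num.min (e / 2) (1 / 2).
have m0 : 0 < m by rewrite /m lt_min !divr_gt0.
pose delta := m / (2 * E); have delta0 : 0 < delta by rewrite divr_gt0// mulr_gt0.
pose K := algebra_cst M * (B + 1) + 1.
have K0 : 0 <= K by rewrite addr_ge0// mulr_ge0 ?algebra_cst_ge0// addr_ge0.
pose kappa := delta / 3 / (T * K + 1).
have TK : 0 < T * K + 1 by rewrite ltr_wpDl// mulr_ge0.
have kappa0 : 0 < kappa by rewrite divr_gt0// divr_gt0.
have delta3 : 0 < delta / 3 by rewrite divr_gt0.
have /cvge0P near0 := hconv.
have {}near0 := near0 (fun eps => sobolev_norm_ge0 M 1 _) _ delta3.
have near1 := tail_cvg0 T0 u0s delta3.
have near2 := tail_cvg0_uniform T0 sqH kappa0.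
have near3 := tail_cvg0_uniform T0 cubH kappa0.
have pos : \forall eps \near (0 : R)^'+, 0 < eps by exact: nbhs_right_gt.
have FF : Filter (0 : R)^'+ by typeclasses eauto.
have all := @filterI _ _ FF _ _ pos (@filterI _ _ FF _ _ near0
  (@filterI _ _ FF _ _ near1 (@filterI _ _ FF _ _ near2 near3))).
apply: (@filterS _ _ FF _ _ _ all) => eps [eps0 [/sobolev_norm_lt[_ d0] [d1 [d2 d3]]]].
have e0s : Hs M 1 (u0eps eps).
  apply/sobolevP; apply: (le_lt_trans (sobolev_norm_le M _ (leqnSn 1))).
  by apply: (le_lt_trans (Kdle eps eps0)); exact: ltry.
have mE : 2 * delta * E = m by rewrite /delta; field; rewrite gt_eqF.
have small' : 2 * delta * E < 1.
  by rewrite mE /m gt_min; apply/orP; right; lra.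
have small : hdist M (u0eps eps) u0 + tail M (symbol_gap T eps) u0 + T * (K * kappa) <= delta.
  have : T * (K * kappa) <= delta / 3.
    rewrite /kappa mulrA mulrA ler_pdivrMr// mulrC ler_wpM2l ?(ltW delta3)//.
    by rewrite lerDl.
  have d0' : hdist M (u0eps eps) u0 < delta / 3 := d0.
  have arith (x y z dl : R) : x < dl / 3 -> y < dl / 3 -> z <= dl / 3 -> x + y + z <= dl.
    by clear; lra.
  exact: arith d0' d1.
have est := uniform_estimate T0 e0s u0s (hueps eps eps0) hu B0 uB (ltW kappa0) small
  (fun t tT => ltW (d2 t tT)) (fun t tT => ltW (d3 t tT)) small'.
apply: (@le_lt_trans _ _ m%:E); last first.
  by rewrite lte_fin /m gt_min; apply/orP; left; lra.
apply: ge_ereal_sup => _ [t + <-]; rewrite /= in_itv/= => tT.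
have [vc _] := hueps eps eps0; have [v1 _] := sobolev_continuous_hcontinuous (ltn0Sn 1) vc.
have [u1 _] := uH.
rewrite /sobolev_dist (sobolev_normE (HsB (v1 t) (u1 t))) lee_fin -mE.
exact: est.
Qed.
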